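(* Let $\mathbb{G}$ be a stratified Lie group, let $1<p<\infty$, and let $f:\mathbb{R}^{+}\to\mathbb{R}^{+}$ be a locally Lipschitz function such that $(p-1)|f(t)|^{\frac{p-2}{p-1}}\leq f'(t)$ for a.e. $t\in\mathbb{R}^{+}$. Let $\Omega\subset\mathbb{G}$ be a bounded open set and let $g:\Omega\times\mathbb{R}\to\mathbb{R}$ be a positive, bounded and measurable function such that, for some constant $C$, $g(x,\rho)\leq C(\rho^{p-1}+1)$ for all $\rho>0$. If functions $u,v\in\overset{\circ}{S}{}^{1,p}(\Omega)$, with $v\not\equiv 0$ and $v\geq 0$ a.e. in $\Omega$, are such that $-\mathcal{L}_{p}v=g(x,v)$, then $$\int_{\Omega}\frac{|u|^{p}}{f(v)}(-\mathcal{L}_{p}v)\,dx\leq\int_{\Omega}|\nabla_{\mathbb G}u|^{p}\,dx .$$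
   Context: Stratified Lie group: a Lie group $\mathbb{G}=(\mathbb{R}^{N},\circ)$ such that (i) for some natural numbers $N_{1}+\dots+N_{r}=N$, writing $\mathbb{R}^{N}=\mathbb{R}^{N_1}\times\dots\times\mathbb{R}^{N_r}$, $x=(x^{(1)},\dots,x^{(r)})$, for every $\lambda>0$ the dilation $\delta_\lambda(x)=(\lambda x^{(1)},\dots,\lambda^{r}x^{(r)})$ is an automorphism of $\mathbb{G}$; (ii) if $X_1,\dots,X_{N_1}$ are the left invariant vector fields with $X_k(0)=\frac{\partial}{\partial x_k}|_0$, $k=1,\dots,N_1$, then the iterated commutators of $X_1,\dots,X_{N_1}$ span the Lie algebra of $\mathbb{G}$, i.e. $\operatorname{rank}(\operatorname{Lie}\{X_1,\dots,X_{N_1}\})=N$ at every point. The horizontal gradient is $\nabla_{\mathbb{G}}=(X_1,\dots,X_{N_1})$; $dx$ is Lebesgue measure on $\mathbb{R}^N$ (the Haar measure of $\mathbb{G}$). $u\in C^1(\Omega)$ means $\nabla_{\mathbb{G}}u\in C(\Omega)$; $\mathbb{R}^+=(0,\infty)$. $\overset{\circ}{S}{}^{1,p}(\Omega)$ is the completion of $C^1_0(\Omega)$ (real-valued, compactly supported) in the norm $J_p(u)=\left(\int_\Omega|\nabla_{\mathbb{G}}u|^p\,dx\right)^{1/p}$. The $p$-sub-Laplacian is $\mathcal{L}_{p}f=\nabla_{\mathbb{G}}\cdot(|\nabla_{\mathbb{G}}f|^{p-2}\nabla_{\mathbb{G}}f)$, understood in the weak sense: $-\mathcal{L}_pv=g(x,v)$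 means $\int_\Omega|\nabla_{\mathbb{G}}v|^{p-2}\nabla_{\mathbb{G}}v\cdot\nabla_{\mathbb{G}}\phi\,dx=\int_\Omega g(x,v)\phi\,dx$ for all $\phi\in C_0^\infty(\Omega)$. *)

(* Defs.v *)
From HB Require Import structures.
From mathcomp Require Import all_boot all_order all_algebra.
From mathcomp Require Import all_classical all_reals all_analysis.

Set Implicit Arguments.
Unset Strict Implicit.
Unset Printing Implicit Defensive.

Import Order.TTheory GRing.Theory Num.Theory.
Import numFieldNormedType.Exports.

Local Open Scope classical_set_scope.
Local Open Scope ring_scope.

(* The Borel sets of R^n, as the sigma-algebra generated by the coordinates. *)
Section rV_measurable.
Variables (R : realType) (n : nat).

Let coor (i : 'I_n) (x : 'rV[R]_n) : R := x ord0 i.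

Let rV_set0 : g_sigma_preimage coor set0.
Proof. exact: sigma_algebra0. Qed.

Let rV_setC A : g_sigma_preimage coor A -> g_sigma_preimage coor (~` A).
Proof. exact: sigma_algebraC. Qed.

Let rV_bigcup (F : (set 'rV[R]_n)^nat) :
  (forall i, g_sigma_preimage coor (F i)) ->
  g_sigma_preimage coor (\bigcup_i (F i)).
Proof. exact: sigma_algebra_bigcup. Qed.

HB.instance Definition _ := @isMeasurable.Build default_measure_display
  'rV[R]_n (g_sigma_preimage coor) rV_set0 rV_setC rV_bigcup.

End rV_measurable.

Lemma measurable_coord (R : realType) n (i : 'I_n) :
  measurable_fun setT (fun x : 'rV[R]_n => x ord0 i).
Proof.
move=> _ Y mY; rewrite setTI; apply: sub_sigma_algebra => /=.
rewrite -bigcup_seq/=; exists i => /=; first by rewrite mem_index_enum.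
by exists Y => //; rewrite setTI.
Qed.

Lemma measurable_rVP d (T : measurableType d) (R : realType) n
    (f : T -> 'rV[R]_n) :
  (forall i, measurable_fun setT (fun x => f x ord0 i)) ->
  measurable_fun setT f.
Proof.
move=> mf.
suff sub : g_sigma_preimage (fun i x => f x ord0 i) `<=` (@measurable _ T).
  move=> _ Y mY; rewrite setTI; apply: sub.
  rewrite (g_sigma_preimage_comp (fun i (x : 'rV[R]_n) => x ord0 i) f).
  by exists Y => //; rewrite setTI.
apply: smallest_sub; first exact: sigma_algebra_measurable.
case: n => [|n] in f mf *; first by rewrite big_ord0.
rewrite -bigcup_mkord_ord; apply: bigcup_sub => i Ii.
by move=> A [B mB <-]; exact: mf.
Qed.

Section lebesgue_rV.
Variable R : realType.

Definition rV_cons n (z : measurableTypeR R * 'rV[R]_n) : 'rV[R]_n.+1 :=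
  \row_i oapp (z.2 ord0) z.1 (unlift ord0 i).

Definition rV_uncons n (x : 'rV[R]_n.+1) : measurableTypeR R * 'rV[R]_n :=
  (x ord0 ord0, \row_i x ord0 (lift ord0 i)).

Lemma rV_consK n : cancel (@rV_cons n) (@rV_uncons n).
Proof.
move=> [a x]; rewrite /rV_uncons /rV_cons /= mxE unlift_none/=; congr pair.
by apply/rowP => i; rewrite !mxE liftK.
Qed.

Lemma measurable_rV_cons n : measurable_fun setT (@rV_cons n).
Proof.
apply: measurable_rVP => i; rewrite [X in measurable_fun _ X](_ : _ =
  fun z : measurableTypeR R * 'rV[R]_n => oapp (z.2 ord0) z.1 (unlift ord0 i));
  last by apply/funext => z; rewrite mxE.
case: (unlift ord0 i) => [j|] /=; last exact: measurable_fst.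
apply: (@measurableT_comp _ _ _ _ _ _ (fun x : 'rV[R]_n => x ord0 j)) => //.
exact: measurable_coord.
Qed.

Lemma measurable_rV_uncons n : measurable_fun setT (@rV_uncons n).
Proof.
apply/measurable_fun_pairP; split; first exact: measurable_coord.
apply: measurable_rVP => i; rewrite [X in measurable_fun _ X](_ : _ =
  fun x : 'rV[R]_n.+1 => x ord0 (lift ord0 i)).
  exact: measurable_coord.
by apply/funext => x; rewrite /= mxE.
Qed.

Section step.
Variables (n : nat) (mu : {sigma_finite_measure set 'rV[R]_n -> \bar R}).

Definition leb_step : set 'rV[R]_n.+1 -> \bar R :=
  pushforward (@lebesgue_measure R \x mu)%E (@rV_cons n).

Let leb_step0 : leb_step set0 = 0%E.
Proof. by rewrite /leb_step /pushforward preimage_set0 measure0. Qed.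

Let leb_step_ge0 A : (0 <= leb_step A)%E.
Proof. by apply: (@measure_ge0 _ _ _ (@lebesgue_measure R \x mu)%E). Qed.

Let leb_step_sigma_additive : semi_sigma_additive leb_step.
Proof.
move=> F mF tF mUF; rewrite /leb_step /pushforward preimage_bigcup.
have mpre (A : set 'rV[R]_n.+1) : measurable A ->
    measurable (@rV_cons n @^-1` A).
  by move=> mA; rewrite -[X in measurable X]setTI; exact: measurable_rV_cons.
apply: measure_semi_sigma_additive.
- by move=> k; exact: mpre.
- apply/trivIsetP => /= i j _ _ ij; rewrite -preimage_setI.
  by move/trivIsetP : tF => /(_ _ _ _ _ ij) ->//; rewrite preimage_set0.
- by rewrite -preimage_bigcup; exact: mpre.
Qed.

HB.instance Definition _ := isMeasure.Build _ _ _ leb_step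
  leb_step0 leb_step_ge0 leb_step_sigma_additive.

Let leb_step_sigma_finite : sigma_finite setT leb_step.
Proof.
have /sigma_finiteP[F [TF ndF Foo]] :=
  sigma_finiteT [the {sigma_finite_measure set _ -> \bar R} of
    @lebesgue_measure R].
have /sigma_finiteP[G [TG ndG Goo]] := sigma_finiteT mu.
exists (fun k => @rV_uncons n @^-1` (F k `*` G k)).
  rewrite predeqE => x; split => // _.
  have [[i _ Fi] [j _ Gj]] :
      (\bigcup_k F k) (rV_uncons x).1 /\ (\bigcup_k G k) (rV_uncons x).2.
    by rewrite -TF -TG.
  exists (maxn i j) => //; split.
  - by move: Fi; exact/subsetPset/ndF/leq_maxl.
  - by move: Gj; exact/subsetPset/ndG/leq_maxr.
move=> k; have [mF Fk] := Foo k; have [mG Gk] := Goo k; split.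
  rewrite -[X in measurable X]setTI.
  by apply: measurable_rV_uncons => //; exact: measurableX.
rewrite /leb_step /pushforward -comp_preimage (_ : _ \o _ = id); last first.
  by apply/funext => z; exact: rV_consK.
by rewrite preimage_id product_measure1E// lte_mul_pinfty// ge0_fin_numE.
Qed.

HB.instance Definition _ := Measure_isSigmaFinite.Build _ _ _ leb_step
  leb_step_sigma_finite.

End step.

(* Lebesgue measure on R^n, as the n-fold product of the one on R. *)
Fixpoint lebesgue_rV (n : nat) : {sigma_finite_measure set 'rV[R]_n -> \bar R} :=
  match n with
  | 0 => \d_(0 : 'rV[R]_0)
  | m.+1 => leb_step (lebesgue_rV m)
  end.

End lebesgue_rV.

Section smoothness.
Variable R : realType.

(* C^k on a finite-dimensional space, through iterated directional
   derivatives. *)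
Fixpoint is_Ck (U W : normedModType R) (k : nat) (f : U -> W) : Prop :=
  match k with
  | 0 => continuous f
  | j.+1 => [/\ continuous f, (forall x v, derivable f x v)
              & forall v, is_Ck j (fun x => 'D_v f x)]
  end.

Definition smooth (U W : normedModType R) (f : U -> W) : Prop :=
  forall k, is_Ck k f.

End smoothness.

Section vector_fields.
Variables (R : realType) (N : nat).
Local Notation V := 'rV[R]_N.

(* A vector field on R^N is identified with its map of coefficients. *)
Definition Lie_bracket (X Y : V -> V) : V -> V :=
  fun x => 'D_(X x) Y x - 'D_(Y x) X x.

Inductive Lie_generated m (X : 'I_m -> V -> V) : (V -> V) -> Prop :=
| Lie_gen k : Lie_generated X (X k)
| Lie_lin a Y Z : Lie_generated X Y -> Lie_generated X Z ->
    Lie_generated X (fun x => a *: Y x + Z x)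
| Lie_br Y Z : Lie_generated X Y -> Lie_generated X Z ->
    Lie_generated X (Lie_bracket Y Z).

Definition left_invariant (op : V -> V -> V) (X : V -> V) : Prop :=
  forall a x, 'D_(X x) (op a) x = X (op a x).

Definition integral_curve (X : V -> V) (gamma : R -> V) : Prop :=
  forall t, is_derive t (1 : R) gamma (X (gamma t)).

End vector_fields.

(* The dilation of R^N = R^(N_1) x ... x R^(N_r): the layer of the coordinate
   j is (reshape_index ns j).+1. *)
Definition dilation (R : realType) (ns : seq nat) (l : R)
    (x : 'rV[R]_(sumn ns)) : 'rV[R]_(sumn ns) :=
  \row_j (l ^+ (reshape_index ns j).+1 * x ord0 j).

(* The identity is the origin: every dilation fixes it. *)
Record stratified_group (R : realType) (ns : seq nat) := StratifiedGroup {
  sg_op : 'rV[R]_(sumn ns) -> 'rV[R]_(sumn ns) -> 'rV[R]_(sumn ns) ;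
  sg_inv : 'rV[R]_(sumn ns) -> 'rV[R]_(sumn ns) ;
  sg_X : 'I_(head 0%N ns) -> 'rV[R]_(sumn ns) -> 'rV[R]_(sumn ns) ;
  sg_layers : (0 < size ns)%N && all (leq 1) ns ;
  sg_opA : associative sg_op ;
  sg_op0x : left_id 0 sg_op ;
  sg_opx0 : right_id 0 sg_op ;
  sg_opVx : left_inverse 0 sg_inv sg_op ;
  sg_opxV : right_inverse 0 sg_inv sg_op ;
  sg_op_smooth :
    smooth (fun z : 'rV[R]_(sumn ns) * 'rV[R]_(sumn ns) => sg_op z.1 z.2) ;
  sg_inv_smooth : smooth sg_inv ;
  sg_dilation : forall l : R, 0 < l ->
    {morph dilation l : x y / sg_op x y} ;
  sg_X_smooth : forall k, smooth (sg_X k) ;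
  sg_X_left : forall k, left_invariant sg_op (sg_X k) ;
  sg_X_at0 : forall k, sg_X k 0 = \row_j (j == k :> nat)%:R ;
  sg_rank : forall x, exists Y : 'I_(sumn ns) -> 'rV[R]_(sumn ns) -> _,
    (forall i, Lie_generated sg_X (Y i)) /\
    \rank (\matrix_i Y i x) = sumn ns }.

Definition dotR (R : realType) n (a b : 'rV[R]_n) : R :=
  \sum_i a ord0 i * b ord0 i.

(* Euclidean norm; the library's norm of a row vector is the sup norm. *)
Definition enorm (R : realType) n (a : 'rV[R]_n) : R := Num.sqrt (dotR a a).

Section horizontal.
Variables (R : realType) (ns : seq nat) (G : stratified_group R ns).
Local Notation V := 'rV[R]_(sumn ns).
Local Notation H := 'rV[R]_(head 0%N ns).
Local Notation mu := (@lebesgue_rV R (sumn ns)).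

(* X_k phi is the derivative of phi along the flow of X_k. The integral curves
   of a left-invariant field are defined for all times, so restricting to
   global curves loses nothing. For a function that is only C^1 in the
   horizontal directions, the derivative along the straight line
   t |-> x + t X_k(x) would not be the right notion. *)
Definition is_hgrad (phi : V -> R) (Dphi : V -> H) : Prop :=
  forall k gamma, integral_curve (sg_X G k) gamma ->
  forall t, is_derive t (1 : R) (phi \o gamma) (Dphi (gamma t) ord0 k).

Definition compact_support_in (Omega : set V) (phi : V -> R) : Prop :=
  let S := closure [set x | phi x != 0] in compact S /\ S `<=` Omega.

(* C^1_0(Omega), each function extended by 0 and paired with its horizontal
   gradient. *)
Definition C10 (Omega : set V) (phi : V -> R) (Dphi : V -> H) : Prop :=
  [/\ continuous phi, is_hgrad phi Dphi, continuous Dphi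
    & compact_support_in Omega phi].

Definition Lp_norm (Omega : set V) (p : R) (w : V -> R) : \bar R :=
  ((\int[mu]_(x in Omega) (`|w x| `^ p)%:E) `^ p^-1)%E.

(* J_p(u), as a function of the horizontal gradient Du of u. *)
Definition Jp (Omega : set V) (p : R) (Du : V -> H) : \bar R :=
  Lp_norm Omega p (fun x => enorm (Du x)).

(* The completion of C^1_0(Omega) for J_p, Omega bounded. By the Poincare
   inequality a J_p-Cauchy sequence converges in L^p(Omega), which realizes the
   completion as a space of functions u with a horizontal gradient Du. *)
Definition S1p0 (Omega : set V) (p : R) (u : V -> R) (Du : V -> H) : Prop :=
  [/\ measurable_fun Omega u, measurable_fun Omega Du
    & exists phi Dphi, [/\ forall n : nat, C10 Omega (phi n) (Dphi n),
        Lp_norm Omega p (fun x => phi n x - u x) @[n --> \oo] --> 0%E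
      & Jp Omega p (fun x => Dphi n x - Du x) @[n --> \oo] --> 0%E]].

Definition locally_integrable_on (Omega : set V) (w : V -> R) : Prop :=
  measurable_fun Omega w /\
  forall K, compact K -> K `<=` Omega ->
    (\int[mu]_(x in K) `|w x|%:E < +oo)%E.

(* w is L_p v, in the weak sense, for v with horizontal gradient Dv. At points
   where Dv = 0 the flux |Dv|^(p-2) Dv is 0, also for p < 2. *)
Definition weak_p_sub_Laplacian (Omega : set V) (p : R) (Dv : V -> H)
    (w : V -> R) : Prop :=
  locally_integrable_on Omega w /\
  forall phi Dphi, smooth phi -> compact_support_in Omega phi ->
    is_hgrad phi Dphi ->
    (\int[mu]_(x in Omega)
        (enorm (Dv x) `^ (p - 2) * dotR (Dv x) (Dphi x))%:E
     = \int[mu]_(x in Omega) (- w x * phi x)%:E)%E.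

End horizontal.

(* Main.v *)
Require Import Defs.
From mathcomp Require Import all_boot all_order all_algebra.
From mathcomp Require Import all_classical all_reals all_analysis.
From mathcomp Require Import measurable_realfun ring lra.

Set Implicit Arguments.
Unset Strict Implicit.
Unset Printing Implicit Defensive.

Import Order.TTheory GRing.Theory Num.Theory.
Import numFieldNormedType.Exports.

Local Open Scope classical_set_scope.
Local Open Scope ring_scope.

(* Since (f^(1/(p-1)))' >= 1 a.e., f(t) >= t^(p-1), so it suffices to treat
   f(t) = t^(p-1). Test the equation of v with |phi|^p (v + 2e)^(1-p) for phi
   in C^1_0: Young's inequality bounds the flux term pointwise by |D phi|^p
   (Picone); then let phi tend to u and e to 0. As |phi|^p (v + 2e)^(1-p) is
   not smooth, v is first replaced by C^1_0 functions converging to it fast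
   enough to be dominated, and C^1_0 test functions are approximated by their
   convolutions from the left with smooth bumps. A left translate of an
   integral curve of a left-invariant field is again one, so these convolutions
   have as horizontal gradient the convolution of the gradient; they are smooth
   because z |-> x z^-1 preserves Lebesgue measure. No separate positivity
   argument for v is needed: as e tends to 0 the left side stays bounded, and
   as -L_p v > 0 this forces u = 0 a.e. on {v = 0}. *)

(** * Growth of the nonlinearity *)

(** The obstacle is the weak form: it admits only smooth test functions, while Picone's test
    function inherits mere horizontal C^1 regularity from the approximants of [v]. Euclidean
    mollification does not commute with the fields [sg_X], hence the convolution from the left. Its
    change of variable is obtained without Jacobians: by homogeneity under dilations, each
    coordinate of x z^-1 is minus that of z plus a function of x and of the earlier coordinates of
    z, so Fubini reduces everything to reflections of the line. The nonlinear flux never has to pass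
    to a limit: it keeps the true gradient [Dv] throughout, and the approximants of [v] enter only
    through the test function, on which the weak form depends linearly. Boundedness of [g] makes L_p
    v bounded, which dominates the other side of the equation. *)

Section monotonicity.
Variable R : realType.
Local Notation leb := (@lebesgue_measure R).

(** A supremum argument. At the supremum [c] of the points where [w a <= w x], the hypothesis
    compares [w c] with values on both sides: with points of the set on the left, so [c] belongs to
    it, then with a point on the right, which contradicts [c < b]. *)
Lemma locally_nondecreasing (w : R -> R) (a b : R) : a <= b ->
  (forall x, a <= x <= b -> \forall y \near x, 0 <= (w y - w x) * (y - x)) ->
  w a <= w b.
Proof.
move=> ab loc; pose S := [set x | a <= x <= b /\ w a <= w x].
have Sa : S a by split => //; rewrite lexx ab.
have ubS : ubound S b by move=> x [/andP[_ ->]].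
have hS : has_sup S by split; [exists a | exists b].
set c := sup S.
have ac : a <= c by apply: ub_le_sup => //; case: hS.
have cb : c <= b by apply: ge_sup => //; exists a.
have acb : a <= c <= b by rewrite ac cb.
have /nbhs_ballP[e /= e0 He] := loc c acb.
have wac : w a <= w c.
  have [x Sx] := sup_adherent e0 hS; rewrite -/c => cx.
  have xc : x <= c by apply: ub_le_sup => //; case: hS.
  have [_ wax] := Sx; move: xc; rewrite le_eqVlt => /orP[/eqP<-//|xc].
  apply: (le_trans wax).
  have /He : ball c e x by rewrite /ball/= ger0_norm ?subr_ge0 ?(ltW xc)//; lra.
  by rewrite nmulr_lge0 ?subr_lt0// subr_le0.
have [bc|] := leP b c.
  by have -> : b = c by apply/eqP; rewrite eq_le bc cb.
move=> cltb; pose y := c + Num.min (e / 2) (b - c).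
have m0 : 0 < Num.min (e / 2) (b - c) by rewrite lt_min divr_gt0//= subr_gt0.
have me : Num.min (e / 2) (b - c) <= e / 2 by rewrite ge_min lexx.
have mb : Num.min (e / 2) (b - c) <= b - c by rewrite ge_min lexx orbT.
have cy : c < y by rewrite /y; lra.
have /He : ball c e y.
  rewrite /ball/= distrC ger0_norm ?subr_ge0 ?(ltW cy)// /y; move: (e0); lra.
rewrite pmulr_lge0 ?subr_gt0// subr_ge0 => wcy.
have : y <= c.
  apply: ub_le_sup; first by case: hS.
  split; last exact: le_trans wcy.
  by apply/andP; split; rewrite /y; move: ac; lra.
by rewrite leNgt cy.
Qed.

(** [psi] is the distribution function of Lebesgue measure on [U]: it increases by at most [leb U]
    in total, yet has slope 1 at points of [U], since an interval around such a point lies in [U].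
    Adding a multiple of it repairs a function on a small open set at small cost. The products with
    [y - x] treat both sides of [x] at once. *)
Lemma lebesgue_ray_increment (U : set R) : open U -> (leb U < +oo)%E ->
  let psi x := fine (leb (U `&` `]-oo, x])) in
  (forall x y, 0 <= (psi y - psi x) * (y - x)) /\
  (forall x, U x -> \forall y \near x, (y - x) ^+ 2 <= (psi y - psi x) * (y - x)).
Proof.
move=> oU Ufin psi.
have mU : measurable U by exact: open_measurable.
have leM (A B : set R) : measurable A -> measurable B -> A `<=` B ->
    (leb A <= leb B)%E.
  by move=> mA mB AB; apply: le_measure; rewrite ?inE.
have mI x : measurable (U `&` `]-oo, x]) by exact: measurableI.
have fin x : leb (U `&` `]-oo, x]) \is a fin_num.
  rewrite ge0_fin_numE//; apply: le_lt_trans Ufin.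
  exact: leM.
have mono x y : x <= y -> psi x <= psi y.
  move=> xy; apply: fine_le => //; apply: leM => //.
  by apply: setIS => z /=; rewrite !in_itv/= => /le_trans; apply.
have grow x y : x <= y -> `]x, y] `<=` U -> y - x <= psi y - psi x.
  move=> xy sU; rewrite lerBrDr -lee_fin EFinD /psi !fineK//.
  rewrite (_ : (y - x)%:E = leb `]x, y]); last first.
    rewrite lebesgue_measure_itv/= lte_fin; case: ltP => // yx.
    by have -> : x = y; [lra | rewrite subrr].
  rewrite -[X in (X <= _)%E]measureU//; last 2 first.
  - exact: mI.
  - apply/seteqP; split => // z [/= h [_ h']]; move: h h'.
    by rewrite !in_itv/= => /andP[xz _]; rewrite leNgt xz.
  apply: leM => //; first exact: measurableU.
  move=> z [h|[Uz h]]; split => //; first exact: sU.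
    by move: h; rewrite /= !in_itv/= => /andP[].
  by move: h; rewrite /= !in_itv/= => /le_trans; apply.
split.
  move=> x y; have [xy|yx] := leP x y.
    by rewrite mulr_ge0 ?subr_ge0// mono.
  by rewrite nmulr_lge0 ?subr_lt0// subr_le0 mono// ltW.
move=> x Ux; have /nbhs_ballP[e /= e0 He] := open_nbhs_nbhs (conj oU Ux).
apply/nbhs_ballP; exists e => //= y; rewrite /ball/= => yx.
have [xy|xy] := leP x y.
  rewrite expr2 ler_wpM2r ?subr_ge0//; apply: grow => // z /=.
  rewrite in_itv/= => /andP[xz zy]; apply: He; rewrite /ball/= distrC.
  rewrite ger0_norm ?subr_ge0 ?ltW//; move: yx.
  by rewrite distrC ger0_norm ?subr_ge0//; lra.
rewrite expr2 ler_wnM2r ?subr_le0 ?(ltW xy)//.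
rewrite -lerN2 !opprB; apply: grow; first exact: ltW.
move=> z /=; rewrite in_itv/= => /andP[xz zy]; apply: He; rewrite /ball/=.
rewrite ger0_norm ?subr_ge0//; move: yx.
by rewrite ger0_norm ?subr_ge0 ?(ltW xy)//; lra.
Qed.

(* Adding [L * leb (U `&` `]-oo, x])] with [U] a small open cover of the
   exceptional null set makes [h] locally nondecreasing at every point. *)
Lemma lipschitz_ae_nondecreasing (h : R -> R) (a b L : R) :
  a <= b -> 0 <= L ->
  (forall x, a <= x <= b -> \forall y \near x, `|h y - h x| <= L * `|y - x|) ->
  {ae leb, forall x, a <= x <= b -> forall e, 0 < e ->
    \forall y \near x, - (e * (y - x) ^+ 2) <= (h y - h x) * (y - x)} ->
  h a <= h b.
Proof.
move=> ab L0 hL [N [/= mN N0 sN]].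
(* The error is [e * (b - a)] from adding [e * x] and at most [L * e] from adding [L * psi], whose
   total increase is at most [e]. *)
suff key (e : R) : 0 < e -> h a <= h b + e * (b - a + L).
  apply/ler_addgt0Pr => e e0.
  have h1 : 0 < b - a + L + 1 by lra.
  apply: (le_trans (key (e / (b - a + L + 1)) _)); first by rewrite divr_gt0.
  rewrite lerD2l -mulrA ler_piMr ?(ltW e0)// mulrC ler_pdivrMr// mul1r; lra.
move=> e0.
have Nfin : (leb N < +oo)%E by rewrite N0.
have leM (A B : set R) : measurable A -> measurable B -> A `<=` B ->
    (leb A <= leb B)%E.
  by move=> mA mB AB; apply: le_measure; rewrite ?inE.
have [U [oU NU Ue]] := lebesgue_regularity_outer mN Nfin e0.
have mU : measurable U by exact: open_measurable.
have Ule : (leb U < e%:E)%E.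
  rewrite -(setDUK NU).
  have UN : (leb (N `|` (U `\` N)) <= leb N + leb (U `\` N))%E.
    by apply: measureU2 => //; exact: measurableD.
  by apply: (le_lt_trans UN); rewrite N0 add0e.
have Ufin : (leb U < +oo)%E by apply: (lt_trans Ule); exact: ltry.
pose psi x := fine (leb (U `&` `]-oo, x])).
have [/= mono grow] := lebesgue_ray_increment oU Ufin.
change (forall x y, 0 <= (psi y - psi x) * (y - x)) in mono.
have : h a + e * a + L * psi a <= h b + e * b + L * psi b.
  apply: (@locally_nondecreasing (fun x => h x + e * x + L * psi x)) => // x xab.
  have E y : (h y + e * y + L * psi y - (h x + e * x + L * psi x)) * (y - x) =
    (h y - h x) * (y - x) + e * (y - x) ^+ 2 + L * ((psi y - psi x) * (y - x)).
    by ring.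
  (* On [U] the term [L * psi] outweighs the Lipschitz bound; off [U] the point is not exceptional,
     and [e * x] outweighs the defect allowed there. *)
  have [Ux|Ux] := pselect (U x).
    near=> y; rewrite E.
    have h1 : `|h y - h x| <= L * `|y - x| by near: y; exact: hL.
    have h2 : (y - x) ^+ 2 <= (psi y - psi x) * (y - x) by near: y; exact: (grow x Ux).
    have h3 : - (L * (y - x) ^+ 2) <= (h y - h x) * (y - x).
      rewrite -[_ ^+ 2]real_normK ?num_real// expr2 mulrA.
      have := ler_norm (- ((h y - h x) * (y - x))).
      rewrite normrN normrM => h4.
      have := ler_wpM2r (normr_ge0 (y - x)) h1; lra.
    have h5 := ler_wpM2l L0 h2.
    have h6 : 0 <= e * (y - x) ^+ 2 by rewrite mulr_ge0 ?sqr_ge0// ltW.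
    by lra.
  have NNx : ~ N x by move=> /NU.
  have Px : forall d, 0 < d ->
      \forall y \near x, - (d * (y - x) ^+ 2) <= (h y - h x) * (y - x).
    by apply: contrapT => nP; apply: NNx; apply: sN => /= /(_ xab).
  near=> y; rewrite E.
  have h1 : - (e * (y - x) ^+ 2) <= (h y - h x) * (y - x) by near: y; exact: Px.
  by have := mulr_ge0 L0 (mono x y); lra.
have psi0 : 0 <= psi a by rewrite fine_ge0.
have psie : psi b <= e.
  rewrite -lee_fin /psi fineK; last first.
    rewrite ge0_fin_numE//; apply: le_lt_trans Ufin.
    by apply: leM => //; exact: measurableI.
  by apply: le_trans (ltW Ule); apply: leM => //; exact: measurableI.
have := ler_wpM2l L0 psie; have := mulr_ge0 L0 psi0; lra.
Unshelve. all: by end_near. Qed.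

End monotonicity.

Section is_derive_eps.
Variables (R : realType) (V W : normedModType R).

(** The form in which derivatives are used below: with the factor [|h|] on the right the estimate
    also holds at [h = 0], so full neighbourhoods replace punctured ones. *)
Lemma is_derive_eps (f : V -> W) x v (l : W) : is_derive x v f l ->
  forall e : R, 0 < e -> \forall h \near (0 : R),
    `|f (h *: v + x) - f x - h *: l| <= e * `|h|.
Proof.
move=> [df <-] e e0; have /derivable_nbhsP/eqaddoP/(_ e e0) := df.
apply: filterS => h /=.
by rewrite opprD -![(_ + _ : _ -> _) _]/(_ + _) -![(- _ : _ -> _) _]/(- _) /= addrA.
Qed.

Lemma eps_is_derive (f : V -> W) x v (l : W) :
  (forall e : R, 0 < e -> \forall h \near (0 : R),
    `|f (h *: v + x) - f x - h *: l| <= e * `|h|) ->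
  is_derive x v f l.
Proof.
move=> H.
have C : (fun h : R => h^-1 *: ((f \o shift x) (h *: v) - f x)) @ 0^' --> l.
  apply/cvgrPdist_le => e e0.
  apply/nbhs_ballP; have /nbhs_ballP[d /= d0 Hd] := H _ e0; exists d => //= h.
  move=> /Hd He h0.
  rewrite /= -[X in X - _]scale1r -(mulVf h0) -scalerA -scalerBr normrZ normfV.
  by rewrite ler_pdivrMl ?normr_gt0// distrC mulrC.
by split; [apply/cvg_ex; exists l | apply: cvg_lim].
Qed.

Lemma is_derive_cvg_continuous (f : R -> W) (x : R) (l : W) : is_derive x (1 : R) f l ->
  {for x, continuous f}.
Proof. by move=> [df _]; exact/differentiable_continuous/derivable1_diffP. Qed.

End is_derive_eps.

Section powR_lower_bound.
Variable R : realType.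
Local Notation leb := (@lebesgue_measure R).

(** Mean value theorem, the derivative being at most [|d c| + 1] in absolute value near [c]; a
    radius at most [c] keeps the ball in the positive half-line. *)
Lemma powR_locally_lipschitz (q c : R) : 0 < c ->
  exists2 L, 0 <= L & exists2 e, 0 < e & forall y z,
    ball c e y -> ball c e z -> `|y `^ q - z `^ q| <= L * `|y - z|.
Proof.
move=> c0; pose d (x : R) := q * x `^ (q - 1).
have cd : {for c, continuous d}.
  apply: (@continuousM _ _ (fun _ => q) (fun x : R => x `^ (q - 1))) => //.
    exact: cst_continuous.
  exact: (is_derive_cvg_continuous (is_derive1_powR (q - 1) c0)).
have /cvgrPdist_lt /(_ 1 ltr01) := cd.
rewrite near_simpl => /nbhs_ballP[e /= e0 He].
exists (`|d c| + 1); first by rewrite addr_ge0.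
exists (Num.min e c); first by rewrite lt_min e0.
have wlog (y z : R) : y < z -> ball c (Num.min e c) y -> ball c (Num.min e c) z ->
    `|y `^ q - z `^ q| <= (`|d c| + 1) * `|y - z|.
  move=> yz; rewrite /ball/= !lt_min => /andP[ye yc] /andP[ze zc].
  have y0 : 0 < y by move: yc; rewrite ltr_norml => /andP[]; lra.
  have [||x xyz E] := @MVT R (fun x : R => x `^ q) d y z yz.
  - move=> x; rewrite in_itv/= => /andP[yx _].
    by apply: is_derive1_powR; exact: lt_trans yx.
  - apply: continuous_in_subspaceT => x; rewrite inE/= in_itv/= => /andP[yx _].
    apply: is_derive_cvg_continuous (is_derive1_powR q _).
    exact: lt_le_trans yx.
  rewrite distrC E distrC normrM ler_wpM2r//.
  have : ball c e x.
    move: xyz; rewrite in_itv/= /ball/= => /andP[yx xz].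
    move: ye ze; rewrite !ltr_norml => /andP[? ?] /andP[? ?].
    by apply/andP; split; lra.
  move=> /He /=; rewrite distrC => h; rewrite -lerBlDl.
  by apply/ltW; apply: le_lt_trans h; exact: lerB_dist.
move=> y z By Bz; have [yz|zy|->] := ltgtP y z; first exact: wlog.
  by rewrite distrC [`|y - z|]distrC; exact: wlog.
by rewrite !subrr normr0 mulr0.
Qed.

(* [f `^ (p - 1)^-1] has slope at least [1] almost everywhere. *)
Lemma powR_le_of_derive_ge (p : R) (f : R -> R) : 1 < p ->
  (forall t : R, 0 < t -> 0 < f t) ->
  (forall t : R, 0 < t ->
     exists2 A : set R, nbhs t A & [lipschitz f s | s in A]) ->
  {ae leb, forall t : R, 0 < t ->
     derivable f t 1 /\
     (p - 1) * `|f t| `^ ((p - 2) / (p - 1)) <= derive1 f t} ->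
  forall t : R, 0 < t -> t `^ (p - 1) <= f t.
Proof.
move=> p1 f0 flip fder.
have p10 : 0 < p - 1 by lra.
set q := (p - 1)^-1; have q0 : 0 < q by rewrite invr_gt0.
pose h t := f t `^ q.
(* With [h s >= 0] and [s] tending to 0, [key] gives [t <= h t], which is the claim before raising
   to the power [p - 1]. *)
suff key (s t : R) : 0 < s -> s <= t -> h s - s <= h t - t.
  move=> t t0.
  have th : t <= h t.
    apply/ler_addgt0Pr => e e0; pose s := Num.min e t.
    have s0 : 0 < s by rewrite lt_min e0.
    have st : s <= t by rewrite ge_min lexx orbT.
    have se : s <= e by rewrite ge_min lexx.
    have hs : 0 <= h s by exact: powR_ge0.
    by have := key s t s0 st; lra.
  have -> : f t = h t `^ (p - 1).
    by rewrite /h -powRrM mulVf ?gt_eqF// powRr1// ltW// f0.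
  by apply: ge0_ler_powR => //; rewrite ?nnegrE ?powR_ge0 ?ltW.
move=> s0 st.
(* Lipschitz constants exist only locally: the almost everywhere criterion is applied on a small
   ball around each point, and the resulting local monotonicity is glued here. *)
apply: (@locally_nondecreasing R (fun x => h x - x)) => // x /andP[sx _].
have x0 : 0 < x by exact: lt_le_trans sx.
have [A nA lipA] := flip x x0.
have [L L0 [e e0 HL]] := powR_locally_lipschitz q (f0 x x0).
have [k k0 Hk] : exists2 k, 0 <= k &
    forall y z, A y -> A z -> `|f y - f z| <= k * `|y - z|.
  have [M [_ HM]] := lipA.
  exists (`|M| + 1); first by rewrite addr_ge0.
  move=> y z Ay Az; apply: (HM (`|M| + 1) _ (y, z)) => //=.
  by apply: le_lt_trans (ler_norm M) _; rewrite ltrDl.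
have [d d0 Bd] : exists2 d, 0 < d & forall y, ball x d y ->
    [/\ A y, ball (f x) e (f y) & 0 < y].
  have nA' : \forall y \near x, A y by [].
  have nf : \forall y \near x, ball (f x) e (f y).
    have k1 : 0 < k + 1 by rewrite ltr_wpDl.
    have nb : \forall y \near x, `|x - y| < e / (k + 1).
      by apply/nbhs_ballP; exists (e / (k + 1)) => //=; rewrite divr_gt0.
    near=> y.
    have Ay : A y by near: y.
    have Ax : A x by exact: nbhs_singleton.
    apply: (le_lt_trans (Hk _ _ Ax Ay)).
    have : `|x - y| < e / (k + 1) by near: y.
    rewrite ltr_pdivlMr// => h1.
    by apply: le_lt_trans h1; rewrite mulrC ler_wpM2l// lerDl.
  have n0 : \forall y \near x, 0 < y by exact: lt_nbhsr.
  have /nbhs_ballP[d /= d0 Hd] : \forall y \near x,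
      [/\ A y, ball (f x) e (f y) & 0 < y].
    by near=> y; split; near: y.
  by exists d.
have lip y z : ball x d y -> ball x d z -> `|h y - h z| <= L * k * `|y - z|.
  move=> /Bd[Ay By _] /Bd[Az Bz _]; apply: (le_trans (HL _ _ By Bz)).
  by rewrite -mulrA ler_wpM2l// Hk.
have incr y z : ball x d y -> ball x d z -> y <= z -> h y - y <= h z - z.
  move=> By Bz yz.
  have conv w : y <= w <= z -> ball x d w.
    move: By Bz; rewrite /ball/= !ltr_norml => /andP[? ?] /andP[? ?] /andP[? ?].
    by apply/andP; split; lra.
  apply: (@lipschitz_ae_nondecreasing R (fun x => h x - x) y z (L * k + 1)) => //.
  - by rewrite addr_ge0// mulr_ge0.
  - move=> w /conv Bw.
    have nw : \forall u \near w, ball x d u.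
      by apply: open_nbhs_nbhs; split => //; exact: ball_open.
    near=> u.
    have Bu : ball x d u by near: u.
    have -> : h u - u - (h w - w) = (h u - h w) - (u - w) by lra.
    apply: (le_trans (ler_normB _ _)); rewrite mulrDl mul1r lerD2r.
    exact: lip.
  have [N [mN N0 sN]] := fder; exists N; split => //.
  apply: (subset_trans _ sN); apply: subsetC => w fw /conv Bw e' e'0.
  have [_ _ w0] := Bd _ Bw; have [dfw dfge] := fw w0.
  have fw0 : 0 < f w := f0 w w0.
  pose D := q * f w `^ (q - 1) * derive1 f w.
  (* The exponents [q - 1] and [(p - 2) / (p - 1)] are opposite, so the hypothesis on the derivative
     of [f] says that f^q has slope at least 1. *)
  have D1 : 1 <= D.
    have -> : (1 : R) = q * f w `^ (q - 1) * ((p - 1) * `|f w| `^ ((p - 2) / (p - 1))).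
      rewrite gtr0_norm// mulrACA mulVf ?gt_eqF// mul1r -powRD; last first.
        by apply/implyP => _; rewrite gt_eqF.
      have -> : q - 1 + (p - 2) / (p - 1) = 0 by rewrite /q; field; rewrite gt_eqF.
      by rewrite powRr0.
    by rewrite ler_wpM2l// mulr_ge0 ?powR_ge0// ltW.
  have hD : is_derive w 1 h D.
    have dh : is_derive (f w) 1 (fun x : R => x `^ q) (q * f w `^ (q - 1)).
      exact: is_derive1_powR.
    have df : is_derive w 1 f (derive1 f w) by rewrite derive1E; exact: derivableP.
    have := @is_derive1_comp _ (fun x : R => x `^ q) f w _ _ dh df.
    by rewrite /D mulrC.
  have := is_derive_eps hD e'0.
  move=> /nbhs_ballP[r /= r0 Hr].
  apply/nbhs_ballP; exists r => //= u; rewrite /ball/= distrC => uw.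
  have := Hr (u - w); rewrite /ball/= sub0r normrN => /(_ uw).
  rewrite [_ *: 1]mulr1 subrK [_ *: _]mulrC => h1.
  have -> : (h u - u - (h w - w)) * (u - w) =
    (h u - h w - D * (u - w)) * (u - w) + (D - 1) * (u - w) ^+ 2 by ring.
  have h2 : 0 <= (D - 1) * (u - w) ^+ 2 by rewrite mulr_ge0 ?sqr_ge0// subr_ge0.
  have h3 := ler_norm (- ((h u - h w - D * (u - w)) * (u - w))).
  rewrite normrN normrM in h3.
  have h4 := ler_wpM2r (normr_ge0 (u - w)) h1.
  have h5 : e' * `|u - w| * `|u - w| = e' * (u - w) ^+ 2.
    by rewrite -mulrA -expr2 real_normK ?num_real.
  by lra.
apply/nbhs_ballP; exists d => //= y By.
have Bx : ball x d x by exact: ballxx.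
have [yx|xy] := leP y x.
  by rewrite mulr_le0 ?subr_le0//; exact: incr.
by rewrite mulr_ge0 ?subr_ge0 ?(ltW xy)//; apply: incr => //; exact: ltW.
Unshelve. all: by end_near. Qed.

End powR_lower_bound.

(** * Lebesgue measure on R^n *)

Section rV_borel.
Variables (R : realType) (n : nat).
Implicit Types (x y : 'rV[R]_n) (U : set 'rV[R]_n).

Lemma ball_rV x (e : R) y : 0 < e ->
  ball x e y <-> forall i, `|x ord0 i - y ord0 i| < e.
Proof.
move=> e0; split=> [[_ h] i|h]; first exact: (h ord0 i).
by split => // i j; rewrite ord1; exact: h.
Qed.

Lemma measurable_rV_box (P : 'I_n -> set R) : (forall i, measurable (P i)) ->
  measurable [set x : 'rV[R]_n | forall i, P i (x ord0 i)].
Proof.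
move=> mP; rewrite (_ : mkset _ =
  \bigcap_(i in [set: 'I_n]) ((fun x : 'rV[R]_n => x ord0 i) @^-1` P i)).
  apply: fin_bigcap_measurable => // i _.
  by rewrite -[X in measurable X]setTI; exact: measurable_coord.
by apply/seteqP; split => x /= h i => [_|]; exact: h.
Qed.

(** Balls of the sup norm are cubes, measurable coordinate by coordinate; an open set is the union
    of the countably many cubes with rational centre and radius [1 / (k + 1)] that it contains. *)
Lemma rV_open_measurable U : open U -> measurable U.
Proof.
move=> oU.
pose box (qk : 'rV[rat]_n * nat) : set 'rV[R]_n :=
  [set x : 'rV[R]_n | forall i, `|ratr (qk.1 ord0 i) - x ord0 i| < qk.2.+1%:R^-1].
pose F qk := if pselect (box qk `<=` U) then box qk else set0.
have mF qk : measurable (F qk).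
  rewrite /F; case: pselect => [?|?]; last exact: measurable0.
  apply: (@measurable_rV_box (fun i =>
    [set t : R | `|ratr (qk.1 ord0 i) - t| < qk.2.+1%:R^-1])) => i.
  apply: open_measurable.
  exact: (@ball_open _ R (ratr (qk.1 ord0 i)) qk.2.+1%:R^-1).
suff -> : U = \bigcup_(qk in [set: 'rV[rat]_n * nat]) F qk.
  by apply: countable_bigcupT_measurable => //; exact: countableP.
apply/seteqP; split => [x Ux|x [qk _]]; last first.
  by rewrite /F; case: pselect => // h; exact: h.
have /nbhs_ballP[e /= e0 He] := open_nbhs_nbhs (conj oU Ux).
(* Half of [e]: the rational centre is within [r] of [x], and the cube around it has radius [r]. *)
have [r [k [r0 re rk]]] : exists (r : R) (k : nat),
    [/\ 0 < r, r < e / 2 & r = k.+1%:R^-1].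
  have [k _ /(_ k (leqnn k)) /= h] :=
    near_infty_natSinv_lt (PosNum (divr_gt0 e0 (ltr0Sn R 1))).
  by exists k.+1%:R^-1, k; rewrite invr_gt0.
have qi (i : 'I_n) : exists q : rat, `|ratr q - x ord0 i| < r.
  have [|q] := @rat_in_itvoo R (x ord0 i - r) (x ord0 i + r).
    by move: r0; lra.
  rewrite in_itv/= => /andP[? ?]; exists q; rewrite ltr_norml.
  by apply/andP; split; lra.
have [q Hq] := choice qi.
exists (\row_i q i, k) => //; rewrite /F; case: pselect => [?|].
  by move=> i; rewrite /= mxE -rk.
case=> y yb; apply: He; apply/(ball_rV _ _ e0) => i.
have := yb i; rewrite /= mxE -rk => h1; have h2 := Hq i.
rewrite (_ : _ - _ = (ratr (q i) - y ord0 i) - (ratr (q i) - x ord0 i)); last by ring.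
by apply: (le_lt_trans (ler_normB _ _)); lra.
Qed.

Lemma rV_continuous_measurable (f : 'rV[R]_n -> R) : continuous f ->
  measurable_fun setT f.
Proof.
move=> cf; apply: (measurability _ (RGenOInfty.measurableE R)).
move=> /= _ [_ [a ->] <-]; rewrite setTI; apply: rV_open_measurable.
by apply: open_comp => [x _|]; [exact: cf|exact: rray_open].
Qed.

End rV_borel.

Section reflection.
Variable R : realType.
Local Notation leb := (@lebesgue_measure R).

Lemma lebesgue_measure_reflection (c : R) (A : set R) : measurable A ->
  pushforward leb (fun b : measurableTypeR R => (c - b : measurableTypeR R)) A
  = leb A.
Proof.
move=> mA.
have mr : measurable_fun setT (fun b : measurableTypeR R => (c - b : measurableTypeR R)).
  exact: measurable_funB.
apply/esym/lebesgue_measure_unique => //= _ [[a b]] _ <-.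
rewrite /pushforward.
rewrite (_ : _ @^-1` _ = `[c - b, c - a[%classic); last first.
  apply/seteqP; split => x /=; rewrite !in_itv/= => /andP[? ?];
  by apply/andP; split; lra.
rewrite !lebesgue_measure_itv/= !lte_fin ltrD2l ltrN2.
by case: ifP => // _; rewrite -!EFinB; congr EFin; lra.
Qed.

Lemma ge0_integral_reflection (c : R) (f : R -> \bar R) :
  measurable_fun setT f -> (forall x, 0 <= f x)%E ->
  (\int[leb]_x f (c - x)%R = \int[leb]_x f x)%E.
Proof.
move=> mf f0.
have mr : measurable_fun setT (fun b : measurableTypeR R => (c - b : measurableTypeR R)).
  exact: measurable_funB.
have := @ge0_integral_pushforward _ _ _ _ R _ mr leb setT f measurableT mf (fun y _ => f0 y).
rewrite preimage_setT => <-.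
by apply: eq_measure_integral => A mA _; exact: lebesgue_measure_reflection.
Qed.

End reflection.

(** * Measure-preserving triangular maps *)

Section triangular.
Variable R : realType.

Lemma rV_unconsK n : cancel (@rV_uncons R n) (@rV_cons R n).
Proof.
move=> x; apply/rowP => i; rewrite mxE /=.
by case: unliftP => [j ->|->] /=; rewrite ?mxE.
Qed.

Lemma leb_stepE n (A : set 'rV[R]_n.+1) :
  lebesgue_rV R n.+1 A = (\int[@lebesgue_measure R]_a
    lebesgue_rV R n [set z | A (rV_cons (a, z))])%E.
Proof.
rewrite /= /leb_step /pushforward /product_measure1.
apply: eq_integral => a _ /=; congr (lebesgue_rV R n _).
by apply/seteqP; split => z; rewrite xsectionE /=.
Qed.

Lemma lebesgue_rV_box n (M : R) : 0 <= M ->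
  lebesgue_rV R n [set x | forall i, `|x ord0 i| <= M] = ((M *+ 2) ^+ n)%:E.
Proof.
move=> M0; elim: n => [|n IH].
  rewrite expr0 (_ : mkset _ = setT) /=; last first.
    by apply/seteqP; split => // x _ [].
  by rewrite diracT.
rewrite leb_stepE.
transitivity (\int[@lebesgue_measure R]_a
    (((M *+ 2) ^+ n)%:E * (\1_(`[- M, M]%classic : set R) a)%:E))%E.
  apply: eq_integral => a _; rewrite indicE.
  case: (boolP (a \in _)) => ha; last first.
    rewrite mule0 (_ : mkset _ = set0) ?measure0//.
    apply/seteqP; split => // z /(_ ord0); rewrite mxE unlift_none/= => h.
    by move: ha; rewrite notin_setE /= in_itv/= -ler_norml.
  rewrite mule1 -IH; congr (lebesgue_rV R n _).
  move: ha; rewrite inE /= in_itv/= -ler_norml => ha.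
  apply/seteqP; split => z /= h i.
    by have := h (lift ord0 i); rewrite mxE liftK.
  by rewrite mxE; case: unliftP => [j _|_] /=.
rewrite ge0_integralZl_EFin//; last 2 first.
- exact/measurable_EFinP.
- by rewrite exprn_ge0// mulrn_wge0.
rewrite integral_indic// setIT.
rewrite [X in (_ * X)%E](lebesgue_measure_itv `[- M, M])/= lte_fin.
rewrite exprSr EFinM; congr (_ * _)%E; case: ifPn => [_|].
  by rewrite -EFinD opprK mulr2n.
rewrite -leNgt => h; have -> : M = 0 by lra.
by rewrite mul0rn.
Qed.

(** The hypothesis says that coordinate [j] of [T z] is a function of the earlier coordinates of
    [z], minus [z ord0 j]. [T] reflects the first coordinate, and with that coordinate fixed it acts
    on the others by a map of the same kind, so Fubini and induction reduce to reflections of the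
    line. *)
Lemma triangular_reflection_measure n (T : 'rV[R]_n -> 'rV[R]_n) :
  measurable_fun setT T ->
  (forall (j : 'I_n) (z w : 'rV[R]_n), (forall i : 'I_n, (i < j)%N -> z ord0 i = w ord0 i) ->
     T z ord0 j + z ord0 j = T w ord0 j + w ord0 j) ->
  forall A, measurable A -> lebesgue_rV R n (T @^-1` A) = lebesgue_rV R n A.
Proof.
elim: n T => [|n IH] T mT tri A mA.
  congr (lebesgue_rV R 0 _); apply/seteqP; split => x /=;
    by rewrite (_ : T x = x)//; apply/rowP => -[].
pose c := T 0 ord0 ord0.
have T0 z : T z ord0 ord0 = c - z ord0 ord0.
  apply/eqP; rewrite eq_sym subr_eq; apply/eqP.
  by rewrite (tri ord0 z 0)// [X in _ + X]mxE addr0.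
pose Ta a (z : 'rV[R]_n) := (rV_uncons (T (rV_cons (a, z)))).2.
have mcons a : measurable_fun setT (fun z : 'rV[R]_n => rV_cons ((a : measurableTypeR R), z)).
  by apply: measurableT_comp; [exact: measurable_rV_cons|exact: measurable_pair1].
have Ta_tri a (j : 'I_n) (z w : 'rV[R]_n) :
    (forall i : 'I_n, (i < j)%N -> z ord0 i = w ord0 i) ->
    Ta a z ord0 j + z ord0 j = Ta a w ord0 j + w ord0 j.
  move=> zw; rewrite /Ta /rV_uncons /= !mxE.
  have := tri (lift ord0 j) (rV_cons (a, z)) (rV_cons (a, w)).
  rewrite [rV_cons (a, z) _ _]mxE [rV_cons (a, w) _ _]mxE liftK /=; apply.
  move=> i ij; rewrite !mxE; case: unliftP ij => [k ->|->]//=.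
  by rewrite /bump /= !add1n ltnS; exact: zw.
have mTa a : measurable_fun setT (Ta a).
  apply: measurable_rVP => i.
  rewrite [X in measurable_fun _ X](_ : _ =
    (fun x : 'rV[R]_n.+1 => x ord0 (lift ord0 i)) \o T \o
    (fun z : 'rV[R]_n => rV_cons ((a : measurableTypeR R), z))); last first.
    by apply/funext => z; rewrite /Ta /= mxE.
  apply: measurableT_comp; last exact: mcons.
  apply: measurableT_comp => //; exact: measurable_coord.
have mS a : measurable [set z : 'rV[R]_n | A (rV_cons (a, z))].
  by rewrite -[X in measurable X]setTI; exact: mcons.
pose phi (a : R) := lebesgue_rV R n [set z | A (rV_cons (a, z))].
have mphi : measurable_fun setT phi.
  have mA' : measurable (@rV_cons R n @^-1` A).
    by rewrite -[X in measurable X]setTI; exact: measurable_rV_cons.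
  have := measurable_fun_xsection (lebesgue_rV R n) mA'.
  congr (measurable_fun _ _); apply/funext => a; congr (lebesgue_rV R n _).
  by apply/seteqP; split => z; rewrite xsectionE /=.
(* After reflecting the first variable on the right, it remains that the slice at [a] of the
   preimage is the preimage under [Ta a] of the slice of [A] at [c - a]. *)
rewrite !leb_stepE -[RHS](ge0_integral_reflection c mphi)//; last first.
apply: eq_integral => a _.
rewrite -[RHS](IH (Ta a) (mTa a) (Ta_tri a) _ (mS _)).
congr (lebesgue_rV R n _); apply/seteqP.
suff E z : T (rV_cons (a, z)) = rV_cons (c - a, Ta a z).
  by split => z /=; rewrite E.
rewrite -[LHS]rV_unconsK; congr rV_cons.
by rewrite /rV_uncons T0 /= [rV_cons _ _ _]mxE unlift_none.
Qed.

End triangular.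

(** * Calculus in finitely many variables *)

Lemma near_forall_fin (T : topologicalType) (I : finType) (x : T)
    (P : I -> T -> Prop) :
  (forall i, \forall y \near x, P i y) -> \forall y \near x, forall i, P i y.
Proof. by move=> h; exact: (@filter_forall T I P (nbhs x) _ h). Qed.

Section coordinate_systems.
Variables (R : realType).

(** A finite basis with its coordinate functionals, each bounded by the norm. The chain rule is
    proved once in this setting and used on R, on row vectors and on pairs of row vectors. *)
Definition coord_system (U : normedModType R) (I : finType)
    (b : I -> U) (c : I -> U -> R) : Prop :=
  [/\ forall i (a : R) x y, c i (a *: x + y) = a * c i x + c i y,
      forall x, x = \sum_i c i x *: b i
    & forall i x, `|c i x| <= `|x|].

Lemma rV_norm_le n (x : 'rV[R]_n) (e : R) : 0 <= e ->
  `|x| <= e <-> forall i, `|x ord0 i| <= e.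
Proof.
move=> e0; rewrite -[`|x|]/(mx_norm x) mx_normrE; split.
  move=> /bigmax_leP[_ h] i; exact: (h (ord0, i)).
by move=> h; apply/bigmax_leP; split => // -[i j] _ /=; rewrite ord1.
Qed.

Lemma rV_coord_le n (x : 'rV[R]_n) i : `|x ord0 i| <= `|x|.
Proof. exact: (rV_norm_le x (normr_ge0 x)).1. Qed.

Lemma rV_coord_system n :
  coord_system (fun i => delta_mx ord0 i : 'rV[R]_n) (fun i x => x ord0 i).
Proof.
split; first by move=> i a x y; rewrite !mxE.
  by move=> x; exact: row_sum_delta.
by move=> i x; exact: rV_coord_le.
Qed.

Lemma rV2_coord_system n m :
  coord_system
    (fun i : 'I_n + 'I_m => match i with
       | inl j => (delta_mx ord0 j, 0) | inr j => (0, delta_mx ord0 j) end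
       : 'rV[R]_n * 'rV[R]_m)
    (fun i z => match i with inl j => z.1 ord0 j | inr j => z.2 ord0 j end).
Proof.
split.
- by move=> [] i a [x x'] [y y'] /=; rewrite !mxE.
- move=> [x y]; rewrite big_sumType /=; apply/eqP; rewrite xpair_eqE.
  apply/andP; split; apply/eqP.
    rewrite !(big_morph fst (fun x y => erefl) (erefl _)) /= [X in _ = _ + X]big1 => [|i _]; last first.
      by rewrite scaler0.
    by rewrite addr0; exact: row_sum_delta.
  rewrite !(big_morph snd (fun x y => erefl) (erefl _)) /= [X in _ = X + _]big1 => [|i _]; last first.
    by rewrite scaler0.
  by rewrite add0r; exact: row_sum_delta.
- move=> [] i [x y] /=; rewrite prod_normE/= le_max.
    by rewrite rV_coord_le.
  by rewrite rV_coord_le orbT.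
Qed.

Lemma is_derive_rVP (V : normedModType R) n (f : V -> 'rV[R]_n) x v l :
  is_derive x v f l <-> forall i, is_derive x v (fun y => f y ord0 i) (l ord0 i).
Proof.
split=> [df i|df].
  apply: eps_is_derive => e e0; have := is_derive_eps df e0.
  apply: filterS => h; apply: le_trans.
  by have := rV_coord_le (f (h *: v + x) - f x - h *: l) i; rewrite !mxE.
apply: eps_is_derive => e e0.
have : \forall h \near (0 : R), forall i, `|f (h *: v + x) ord0 i - f x ord0 i
    - h *: l ord0 i| <= e * `|h|.
  apply: (@near_forall_fin _ _ _ (fun i (h : R) => `|f (h *: v + x) ord0 i -
    f x ord0 i - h *: l ord0 i| <= e * `|h|)) => i.
  exact: is_derive_eps.
apply: filterS => h H; apply/rV_norm_le => [|i]; first by rewrite mulr_ge0// ltW.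
by have := H i; rewrite !mxE.
Qed.

End coordinate_systems.

Section mean_value.
Variables (R : realType) (U : normedModType R).

Lemma mvt_directional (f : U -> R) (y b : U) (s D e : R) :
  (forall x, derivable f x b) ->
  (forall t, `|t| <= `|s| -> `|'D_b f (t *: b + y) - D| <= e) ->
  `|f (s *: b + y) - f y - s * D| <= e * `|s|.
Proof.
move=> df H.
pose g (t : R) := f (t *: b + y).
have dg t : is_derive t (1 : R) g ('D_b f (t *: b + y)).
  apply: eps_is_derive => e' e'0.
  have := is_derive_eps (derivableP (df (t *: b + y))) e'0.
  by apply: filterS => h; rewrite /g [h *: 1]mulr1 scalerDl addrA.
have cg : continuous g by move=> t; exact: is_derive_cvg_continuous (dg t).
have g0 : f y = g 0 by rewrite /g scale0r add0r.
have [s0|s0|->] := ltgtP s 0; last by rewrite scale0r add0r subrr sub0r mul0r oppr0 !normr0 mulr0.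
- have [c] := @MVT R g (fun t => 'D_b f (t *: b + y)) s 0 s0 (fun x _ => dg x)
    (continuous_subspaceT cg).
  rewrite in_itv/= => /andP[sc c0] E.
  rewrite g0 -/(g s) (_ : _ - _ - _ = ('D_b f (c *: b + y) - D) * s); last first.
    by move: E; rewrite sub0r => E; rewrite mulrBl; lra.
  by rewrite normrM ler_wpM2r// H// !ler0_norm ?(ltW s0) ?(ltW c0)// lerN2 ltW.
- have [c] := @MVT R g (fun t => 'D_b f (t *: b + y)) 0 s s0 (fun x _ => dg x)
    (continuous_subspaceT cg).
  rewrite in_itv/= => /andP[c0 sc] E.
  rewrite g0 -/(g s) (_ : _ - _ - _ = ('D_b f (c *: b + y) - D) * s); last first.
    by move: E; rewrite subr0 => E; rewrite mulrBl; lra.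
  by rewrite normrM ler_wpM2r// H// !ger0_norm ?(ltW s0) ?(ltW c0)// ltW.
Qed.

Variables (I : finType) (b : I -> U) (c : I -> U -> R).
Hypothesis bc : coord_system b c.

(** The coordinates change one at a time along [s], each by a one-variable mean value estimate. [y0]
    is the displacement already made; bounding it plus the length of the remaining path keeps every
    intermediate point where the partial derivatives are controlled. *)
Lemma mvt_path (f : U -> R) (x : U) (d e : R) (D : I -> R) (h : I -> R) :
  0 <= e ->
  (forall x v, derivable f x v) ->
  (forall i y, `|y| < d -> `|'D_(b i) f (y + x) - D i| <= e) ->
  forall (s : seq I) (y0 : U),
    `|y0| + \sum_(i <- s) `|h i| * `|b i| < d ->
    `|f (\sum_(i <- s) h i *: b i + (y0 + x)) - f (y0 + x) - \sum_(i <- s) h i * D i|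
      <= e * \sum_(i <- s) `|h i|.
Proof.
move=> e0 df H; elim => [|i s IH] y0; first by rewrite !big_nil add0r !subrr normr0 mulr0.
rewrite !big_cons => hd.
set y1 := h i *: b i + y0.
have y1d : `|y1| + \sum_(j <- s) `|h j| * `|b j| < d.
  apply: le_lt_trans hd; rewrite addrA lerD2r /y1 addrC.
  by apply: (le_trans (ler_normD _ _)); rewrite normrZ.
have := IH y1 y1d; rewrite /y1 => h1.
have h2 : `|f (h i *: b i + (y0 + x)) - f (y0 + x) - h i * D i| <= e * `|h i|.
  apply: mvt_directional => // t ht; rewrite addrA; apply: H.
  apply: le_lt_trans (ler_normD _ _) _; apply: le_lt_trans hd.
  rewrite addrC lerD2l normrZ; apply: ler_wpDr; last by rewrite ler_wpM2r.
  by apply: sumr_ge0 => j _; rewrite mulr_ge0.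
rewrite mulrDr.
have -> : h i *: b i + \sum_(j <- s) h j *: b j + (y0 + x) =
   \sum_(j <- s) h j *: b j + (h i *: b i + y0 + x).
  by rewrite [h i *: b i + _]addrC -!addrA.
apply: le_trans (lerD h2 h1); apply: le_trans (ler_normD _ _).
by rewrite [h i *: b i + (y0 + x)]addrA le_eqVlt; apply/orP; left; apply/eqP; congr `|_|; lra.
Qed.

(** Continuous partial derivatives give differentiability. [M] bounds the length of the coordinate
    path relative to [|h|], and [N] shares [e] among the coordinates. *)
Lemma C1_expansion (f : U -> R) (x : U) :
  (forall x v, derivable f x v) ->
  (forall i, {for x, continuous ('D_(b i) f)}) ->
  forall e : R, 0 < e -> \forall h \near (0 : U),
    `|f (h + x) - f x - \sum_i c i h * 'D_(b i) f x| <= e * `|h|.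
Proof.
move=> df cf e e0.
pose M := \sum_i `|b i| + 1; pose N := (#|I|%:R + 1 : R).
have M0 : 0 < M by rewrite ltr_wpDl// sumr_ge0.
have N0 : 0 < N by rewrite ltr_wpDl.
have eN0 : 0 < e / N by rewrite divr_gt0.
have : \forall y \near x, forall i, `|'D_(b i) f x - 'D_(b i) f y| < e / N.
  apply: (@near_forall_fin _ _ _ (fun i y => `|'D_(b i) f x - 'D_(b i) f y| < e / N)).
  by move=> i; move/cvgrPdist_lt : (cf i); exact.
move=> /nbhs_ballP[d /= d0 Hd].
have dM0 : 0 < d / M by rewrite divr_gt0.
apply/nbhs_ballP; exists (d / M) => //= h.
rewrite -ball_normE/= sub0r normrN ltr_pdivlMr// => hd.
have [clin cdec cbnd] := bc.
have := @mvt_path f x d (e / N) (fun i => 'D_(b i) f x) (c ^~ h) (ltW eN0) df _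
  (index_enum I) 0.
rewrite -cdec add0r; move=> /(_ _ _)/le_trans; apply.
- move=> i y yd; rewrite distrC; apply/ltW/Hd.
  by rewrite -ball_normE/= distrC addrK.
- rewrite normr0 add0r; apply: le_lt_trans hd.
  apply: (@le_trans _ _ (\sum_i `|h| * `|b i|)).
    by apply: ler_sum => i _; rewrite ler_wpM2r.
  by rewrite -mulr_sumr /M mulrDr lerDl mulr1.
- rewrite -mulrA ler_pM2l// ler_pdivrMl//.
  apply: (@le_trans _ _ (\sum_(i : I) `|h|)); first exact: ler_sum.
  by rewrite sumr_const -mulr_natl ler_wpM2r// lerDl.
Qed.

(** Coordinate [i] of the increment of [g] is [h * d i] up to a small multiple of [|h|]; inserting
    this in the first order expansion of [f] leaves the remainder of that expansion and the
    coordinate errors weighted by the partial derivatives. *)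
Lemma is_derive_chain (T : normedModType R) (g : T -> U) (t v : T)
    (d : I -> R) (f : U -> R) :
  (forall x v, derivable f x v) ->
  (forall i, {for g t, continuous ('D_(b i) f)}) ->
  (forall i, is_derive t v (c i \o g) (d i)) ->
  is_derive t v (f \o g) (\sum_i d i * 'D_(b i) f (g t)).
Proof.
move=> df cf dg; apply: eps_is_derive => e e0.
have [clin cdec cbnd] := bc.
have cB i x y : c i (x - y) = c i x - c i y.
  have := clin i (-1) y x; rewrite scaleN1r mulN1r => E.
  by rewrite addrC E addrC.
(* [K] bounds the increment of [g] relative to [|h|], the 1 in [|d i| + 1] being the cap in [nD];
   [S] bounds the weights of the coordinate errors. Each of the two remainders gets [e / 2]. *)
pose K := \sum_i (`|d i| + 1) * `|b i| + 1.
have K0 : 0 < K by rewrite ltr_wpDl// sumr_ge0// => i _; rewrite mulr_ge0// addr_ge0.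
pose S := \sum_i `|'D_(b i) f (g t)| + 1.
have S0 : 0 < S by rewrite ltr_wpDl// sumr_ge0.
have e1 : 0 < e / 2 / K by rewrite !divr_gt0.
have e2 : 0 < e / 2 / S by rewrite !divr_gt0.
have /nbhs_ballP[r /= r0 Hr] := C1_expansion df cf e1.
pose D (h : R) := g (h *: v + t) - g t.
have nD : \forall h \near (0 : R), forall i,
    `|c i (D h) - h * d i| <= Num.min 1 (e / 2 / S) * `|h|.
  apply: (@near_forall_fin _ _ _ (fun i h =>
    `|c i (D h) - h * d i| <= Num.min 1 (e / 2 / S) * `|h|)) => i; rewrite /D.
  have m0 : 0 < Num.min 1 (e / 2 / S) by rewrite lt_min ltr01.
  have := is_derive_eps (dg i) m0; apply: filterS => h /=.
  by rewrite cB.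
have nh : \forall h \near (0 : R), `|h| < r / K.
  apply/nbhs_ballP; exists (r / K) => /=; first by rewrite divr_gt0.
  by move=> h; rewrite /ball/= sub0r normrN.
near=> h.
have H1 i : `|c i (D h) - h * d i| <= Num.min 1 (e / 2 / S) * `|h|.
  by move: i; near: h.
have DK : `|D h| <= K * `|h|.
  rewrite [in leLHS](cdec (D h)); apply: (le_trans (ler_norm_sum _ _ _)).
  rewrite /K mulrDl mulr_suml ler_wpDr ?mul1r//; apply: ler_sum => i _.
  rewrite normrZ mulrAC ler_wpM2r//.
  rewrite -[c i (D h)](subrK (h * d i)); apply: (le_trans (ler_normD _ _)).
  rewrite mulrDl addrC normrM mulrC mul1r lerD// ?[_ * `|d i|]mulrC//.
  by apply: (le_trans (H1 i)); rewrite ler_piMl// ge_min lexx.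
have /Hr : ball 0 r (D h).
  rewrite -ball_normE/= sub0r normrN; apply: (le_lt_trans DK).
  by rewrite mulrC -ltr_pdivlMr//; near: h.
rewrite /= /D subrK -/(D h) => h2.
have -> : f (g (h *: v + t)) - f (g t) - h *: (\sum_i d i * 'D_(b i) f (g t)) =
  (f (g (h *: v + t)) - f (g t) - \sum_i c i (D h) * 'D_(b i) f (g t)) +
  \sum_i (c i (D h) - h * d i) * 'D_(b i) f (g t).
  have -> : \sum_i (c i (D h) - h * d i) * 'D_(b i) f (g t) =
    \sum_i c i (D h) * 'D_(b i) f (g t) - h *: (\sum_i d i * 'D_(b i) f (g t)).
    rewrite scaler_sumr -sumrB; apply: eq_bigr => i _.
    by rewrite mulrBl [_ *: _]mulrA.
  by lra.
apply: (le_trans (ler_normD _ _)).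
have -> : e * `|h| = e / 2 * `|h| + e / 2 * `|h| by lra.
apply: lerD.
  apply: (le_trans h2); rewrite -mulrA.
  apply: ler_wpM2l; first by rewrite divr_ge0// ltW.
  by rewrite ler_pdivrMl.
apply: (le_trans (ler_norm_sum _ _ _)).
apply: (@le_trans _ _ (\sum_i e / 2 / S * `|h| * `|'D_(b i) f (g t)|)).
  apply: ler_sum => i _; rewrite normrM ler_wpM2r//.
  by apply: (le_trans (H1 i)); rewrite ler_wpM2r// ge_min lexx orbT.
rewrite -mulr_sumr -!mulrA; apply: ler_wpM2l; first exact: ltW.
apply: ler_wpM2l => //; rewrite mulrCA ler_piMr// ler_pdivrMl// mulr1 /S.
by rewrite lerDl.
Unshelve. all: by end_near. Qed.

End mean_value.

(** * Calculus of C^k functions *)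

Section is_Ck_theory.
Variables (R : realType) (U : normedModType R).
Implicit Types f g : U -> R.

Lemma is_Ck_continuous (W : normedModType R) k (f : U -> W) :
  is_Ck k f -> continuous f.
Proof. by case: k => [|k] //= []. Qed.

Lemma is_Ck_pred (W : normedModType R) k (f : U -> W) :
  is_Ck k.+1 f -> is_Ck k f.
Proof.
elim: k f => [|k IH] f; first by case.
by move=> [cf df Df]; split => // v; apply: IH; exact: Df.
Qed.

Lemma is_Ck_cst (W : normedModType R) k (a : W) : is_Ck k (fun _ : U => a).
Proof.
elim: k a => [|k IH] a /=; first exact: cst_continuous.
split; [exact: cst_continuous|move=> x v; exact: derivable_cst|move=> v].
rewrite [X in is_Ck _ X](_ : _ = fun=> 0); first exact: IH.
by apply/funext => x; rewrite derive_cst.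
Qed.

Lemma is_CkD k f g : is_Ck k f -> is_Ck k g -> is_Ck k (fun x => f x + g x).
Proof.
have cD f' g' : continuous f' -> continuous g' -> continuous (fun x : U => f' x + g' x : R).
  by move=> cf cg x; exact: continuousD (cf x) (cg x).
elim: k f g => [|k IH] f g /=; first exact: cD.
move=> [cf df Df] [cg dg Dg]; split; first exact: cD.
  by move=> x v; exact: derivableD.
move=> v; rewrite [X in is_Ck _ X](_ : _ = (fun x => 'D_v f x + 'D_v g x)).
  exact: IH.
by apply/funext => x; rewrite (deriveD (df x v) (dg x v)).
Qed.

Lemma is_CkM k f g : is_Ck k f -> is_Ck k g -> is_Ck k (fun x => f x * g x).
Proof.
have cM f' g' : continuous f' -> continuous g' -> continuous (fun x : U => f' x * g' x : R).
  by move=> cf cg x; exact: continuousM (cf x) (cg x).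
elim: k f g => [|k IH] f g /=; first exact: cM.
move=> Cf Cg; have [cf df Df] := Cf; have [cg dg Dg] := Cg.
have {}Cf := is_Ck_pred Cf; have {}Cg := is_Ck_pred Cg.
split; first exact: cM.
  by move=> x v; exact: derivableM.
move=> v; rewrite [X in is_Ck _ X](_ : _ =
    (fun x => (f x * 'D_v g x) + (g x * 'D_v f x))).
  by apply: is_CkD; apply: IH.
by apply/funext => x; rewrite (deriveM (df x v) (dg x v)).
Qed.

Lemma is_Ck_sum k (I : Type) (s : seq I) (F : I -> U -> R) :
  (forall i, is_Ck k (F i)) -> is_Ck k (fun x => \sum_(i <- s) F i x).
Proof.
move=> CF; elim: s => [|i s IH].
  by rewrite [X in is_Ck _ X](_ : _ = fun=> 0);
    [exact: is_Ck_cst|apply/funext => x; rewrite big_nil].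
rewrite [X in is_Ck _ X](_ : _ = fun x => F i x + \sum_(j <- s) F j x).
  exact: is_CkD.
by apply/funext => x; rewrite big_cons.
Qed.

Lemma is_Ck_prod k (I : Type) (s : seq I) (F : I -> U -> R) :
  (forall i, is_Ck k (F i)) -> is_Ck k (fun x => \prod_(i <- s) F i x).
Proof.
move=> CF; elim: s => [|i s IH].
  by rewrite [X in is_Ck _ X](_ : _ = fun=> 1);
    [exact: is_Ck_cst|apply/funext => x; rewrite big_nil].
rewrite [X in is_Ck _ X](_ : _ = fun x => F i x * \prod_(j <- s) F j x).
  exact: is_CkM.
by apply/funext => x; rewrite big_cons.
Qed.

Lemma is_derive_linear (c : U -> R) x v :
  (forall (a : R) x y, c (a *: x + y) = a * c x + c y) -> is_derive x v c (c v).
Proof.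
move=> lin; apply: eps_is_derive => e e0.
apply/nbhs_ballP; exists 1 => //= h _.
by rewrite lin addrK subrr normr0 mulr_ge0// ltW.
Qed.

Lemma is_Ck_linear k (c : U -> R) :
  (forall (a : R) x y, c (a *: x + y) = a * c x + c y) ->
  (forall x, `|c x| <= `|x|) -> is_Ck k c.
Proof.
move=> lin bnd.
have cc : continuous c.
  move=> x; apply/cvgrPdist_lt => e e0; apply/nbhs_ballP; exists e => //= y.
  rewrite -ball_normE/=; apply: le_lt_trans.
  apply: le_trans (bnd _); rewrite le_eqVlt; apply/orP; left; apply/eqP.
  by have := lin (-1) y x; rewrite scaleN1r mulN1r addrC => ->; rewrite addrC.
case: k => [//|k]; split => //.
  by move=> x v; case: (is_derive_linear x v lin).
move=> v; rewrite [X in is_Ck _ X](_ : _ = fun=> c v); first exact: is_Ck_cst.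
by apply/funext => x; case: (is_derive_linear x v lin).
Qed.

End is_Ck_theory.

Section is_Ck_composition.
Variables (R : realType) (U U' : normedModType R).
Variables (I : finType) (b : I -> U') (c : I -> U' -> R).
Hypothesis bc : coord_system b c.

(** Induction on [k]: by the chain rule a directional derivative of the composite is a sum of
    products of derivatives of the coordinates of [g] with partial derivatives of [f] composed with
    [g], all of one order less. *)
Lemma is_Ck_comp k (f : U' -> R) (g : U -> U') : continuous g ->
  is_Ck k f -> (forall i, is_Ck k (c i \o g)) -> is_Ck k (f \o g).
Proof.
move=> contg; elim: k f => [|k IH] f Cf Cg.
  by move=> x; apply: continuous_comp; [exact: contg|exact: Cf].
have [cf df Df] := Cf.
have cDf i : continuous ('D_(b i) f) by exact: is_Ck_continuous (Df (b i)).
have dg x v i : is_derive x v (c i \o g) ('D_v (c i \o g) x).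
  by apply: derivableP; case: (Cg i) => _ /(_ x v).
have dfg x v := is_derive_chain bc df (fun i => cDf i (g x)) (dg x v).
split.
- by move=> x; apply: continuous_comp; [exact: contg|exact: cf].
- by move=> x v; case: (dfg x v).
move=> v; rewrite [X in is_Ck _ X](_ : _ =
  (fun x => \sum_i 'D_v (c i \o g) x * ('D_(b i) f \o g) x)); last first.
  by apply/funext => x; case: (dfg x v).
apply: is_Ck_sum => i; apply: is_CkM.
  by case: (Cg i) => _ _; exact.
by apply: IH => [|j]; [exact: Df|exact: is_Ck_pred].
Qed.

Lemma derive_coord_sum (f : U' -> R) (x v : U') : is_Ck 1 f ->
  is_derive x v f (\sum_i c i v * 'D_(b i) f x).
Proof.
move=> [_ df cDf].
have dg i : is_derive x v (c i \o id) (c i v).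
  by case: bc => lin _ _; exact: (is_derive_linear x v (lin i)).
have := is_derive_chain bc df (fun i => cDf (b i) (id x)) dg.
exact.
Qed.

End is_Ck_composition.

Lemma is_Ck_coord (R : realType) (U : normedModType R) n k
    (f : U -> 'rV[R]_n) i :
  is_Ck k f -> is_Ck k (fun x => f x ord0 i).
Proof.
have cC (g : U -> 'rV[R]_n) : continuous g -> continuous (fun x => g x ord0 i).
  move=> cg x.
  apply: (@continuous_comp _ _ _ g (fun y : 'rV[R]_n => y ord0 i)).
    exact: cg.
  exact: coord_continuous.
elim: k f => [|k IH] f; first exact: cC.
move=> [cf df Df].
have dfi x v : is_derive x v (fun x => f x ord0 i) ('D_v f x ord0 i).
  exact: ((is_derive_rVP f x v _).1 (derivableP (df x v)) i).
split; first exact: cC.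
  by move=> x v; case: (dfi x v).
move=> v; rewrite [X in is_Ck _ X](_ : _ = (fun x => 'D_v f x ord0 i)).
  by apply: IH; exact: Df.
by apply/funext => x; case: (dfi x v).
Qed.

(** * Parameter integrals *)

Lemma pair_right_continuous (U V : topologicalType) (x : U) :
  continuous (fun z : V => (x, z)).
Proof.
move=> z A [[P Q] /= [nP nQ] PQ]; apply: filterS nQ => w Qw.
by apply: (PQ (x, w)); split => //; exact: nbhs_singleton.
Qed.

Section parametric_integrals.
Variables (R : realType) (n : nat).
Local Notation V := 'rV[R]_n.
Local Notation mu := (@lebesgue_rV R n).

Definition rV_cbox (r : R) : set V := [set x | forall i, `|x ord0 i| <= r].

Lemma rV_cbox_compact r : compact (rV_cbox r).
Proof.
have := @rV_compact R n (fun=> `[- r, r]%classic) (fun=> @segment_compact R (- r) r).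
congr compact; apply/seteqP; split => x /= h i; have := h i;
  by rewrite in_itv/= ler_norml.
Qed.

Lemma rV_cbox_measurable r : measurable (rV_cbox r).
Proof.
apply: (@measurable_rV_box R n (fun=> [set t : R | `|t| <= r])) => _.
rewrite (_ : mkset _ = `[- r, r]%classic)//.
by apply/seteqP; split => t; rewrite /= in_itv/= ler_norml.
Qed.

Lemma rV_cbox_finite r : (mu (rV_cbox r) < +oo)%E.
Proof.
have [r0|r0] := leP 0 r; first by rewrite lebesgue_rV_box// ltry.
(* For [n = 0] the box of negative [r] is not empty, so it is compared with the box of radius
   [- r]. *)
have r'0 : 0 <= - r by lra.
have := lebesgue_rV_box n r'0 => E.
apply: le_lt_trans (ltry ((- r *+ 2) ^+ n)); rewrite -E.
apply: le_measure; rewrite ?inE; [exact: rV_cbox_measurable|exact: (rV_cbox_measurable (- r))|].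
by move=> x h i; apply: (le_trans (h i)); lra.
Qed.

Lemma rV_bounded_sub_cbox (A : set V) : bounded_set A ->
  exists2 r, 0 < r & A `<=` rV_cbox r.
Proof.
move=> [M [_ hM]]; exists (`|M| + 1); first by rewrite ltr_wpDl.
move=> x Ax i; apply: (le_trans (rV_coord_le x i)); apply: hM => //.
by rewrite ltr_pwDr// ler_norm.
Qed.

Lemma rV_continuous_integrable (B : set V) (f : V -> R) :
  measurable B -> bounded_set B -> continuous f -> mu.-integrable B (EFin \o f).
Proof.
move=> mB /rV_bounded_sub_cbox[r r0 Br] cf.
apply: (@integrableS _ _ _ mu (rV_cbox r)) => //; first exact: rV_cbox_measurable.
apply: measurable_bounded_integrable.
- exact: rV_cbox_measurable.
- exact: rV_cbox_finite.
- by apply: (@measurable_funS _ _ _ _ setT) => //; exact: rV_continuous_measurable.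
have cfr : {within rV_cbox r, continuous f} by exact: continuous_subspaceT.
have /compact_bounded[M [Mr hM]] := continuous_compact cfr (@rV_cbox_compact r).
by exists M; split => // y My x Bx; apply: hM => //; exists x.
Qed.

Variables (B : set V).
Hypothesis cB : compact B.

Let mB : measurable B.
Proof.
have clB : closed B by apply: compact_closed => //; exact: norm_hausdorff.
rewrite -[B]setCK; apply: measurableC; apply: rV_open_measurable.
exact: closed_openC.
Qed.

Let bB : bounded_set B. Proof. exact: compact_bounded. Qed.

Let fB : (mu B < +oo)%E.
Proof.
have [r r0 Br] := rV_bounded_sub_cbox bB.
apply: le_lt_trans (rV_cbox_finite r); apply: le_measure; rewrite ?inE//.
exact: rV_cbox_measurable.
Qed.

Variable U : normedModType R.
Implicit Types F : U * V -> R.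

Definition param_int F (x : U) : R := \int[mu]_(z in B) F (x, z).

(** The tube argument: near each [z] in [B] the estimate follows from continuity at [(x0, z)], and
    compactness yields one neighbourhood of [x0] for all [z]. *)
Lemma compact_uniform_near F (x0 : U) (e : R) : continuous F -> 0 < e ->
  \forall x \near x0, forall z, B z -> `|F (x, z) - F (x0, z)| < e.
Proof.
move=> cF e0.
have := (@compact_near_coveringP V B).1 cB U (nbhs x0)
  (fun x z => `|F (x, z) - F (x0, z)| < e) _.
apply => z Bz.
have cz : {for z, continuous (fun z => F (x0, z))}.
  apply: (@continuous_comp _ _ _ (fun z => (x0, z)) F); last exact: cF.
  exact: pair_right_continuous.
have e2 : 0 < e / 2 by rewrite divr_gt0.
have /cvgrPdist_lt/(_ _ e2) H1 := cF (x0, z).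
have /cvgrPdist_lt/(_ _ e2) H2 := cz.
have H1' : \forall z' \near z & x \near x0, `|F (x0, z) - F (x, z')| < e / 2.
  move: H1 => [[P Q] /= [nP nQ] PQ]; exists (Q, P) => //= -[z' x'] /= [Qz Px].
  by apply: (PQ (x', z')).
have H2' : \forall z' \near z & x \near x0, `|F (x0, z) - F (x0, z')| < e / 2.
  by exists ([set z' | `|F (x0, z) - F (x0, z')| < e / 2], setT);
    [split => //; exact: filterT|case=> z' x' /= []].
apply: filterS2 H1' H2' => -[z' x'] /= h1 h2.
rewrite (_ : _ - _ = (F (x0, z) - F (x0, z')) - (F (x0, z) - F (x', z'))); last by ring.
by apply: (le_lt_trans (ler_normB _ _)); lra.
Qed.

Lemma continuous_slice F x : continuous F -> continuous (fun z => F (x, z)).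
Proof.
move=> cF z; apply: (@continuous_comp _ _ _ (fun z => (x, z)) F); last exact: cF.
exact: pair_right_continuous.
Qed.

Lemma integrable_slice F x : continuous F ->
  mu.-integrable B (EFin \o (fun z => F (x, z))).
Proof. by move=> cF; apply: rV_continuous_integrable => //; exact: continuous_slice. Qed.

Lemma le_Rintegral_cst (f : V -> R) (e : R) : mu.-integrable B (EFin \o f) ->
  (forall z, B z -> `|f z| <= e) -> `|\int[mu]_(z in B) f z| <= e * fine (mu B).
Proof.
move=> If fe; apply: (le_trans (le_normr_Rintegral mB If)).
rewrite -Rintegral_cst//; apply: le_Rintegral => //.
- exact: integrable_norm.
- by apply: measurable_bounded_integrable => //; exact: bounded_cst.
Qed.

Lemma param_int_continuous F : continuous F -> continuous (param_int F).
Proof.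
move=> cF x0; apply/cvgrPdist_lt => e e0.
have m0 : 0 < fine (mu B) + 1 by rewrite ltr_wpDl// fine_ge0.
have := compact_uniform_near x0 cF (divr_gt0 e0 m0).
apply: filterS => x H; rewrite /param_int -RintegralB//; last 2 first.
- exact: integrable_slice.
- exact: integrable_slice.
apply: (@le_lt_trans _ _ (e / (fine (mu B) + 1) * fine (mu B))).
  apply: le_Rintegral_cst => [|z Bz]; last by rewrite distrC ltW// H.
  by rewrite (_ : _ \o _ = (EFin \o (fun z => F (x0, z))) \-
    (EFin \o (fun z => F (x, z))))%E//; apply: integrableB => //; exact: integrable_slice.
by rewrite mulrAC ltr_pdivrMr// ltr_pM2l// ltrDl.
Qed.

(** Joint continuity of [F'] and compactness make the mean value estimate of the increment uniform
    in [z], so it integrates to an error proportional to [mu B]. *)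
Lemma param_int_derive F F' v : continuous F -> continuous F' ->
  (forall x z, is_derive x v (fun y => F (y, z)) (F' (x, z))) ->
  forall x, is_derive x v (param_int F) (param_int F' x).
Proof.
move=> cF cF' dF x; apply: eps_is_derive => e e0.
have m0 : 0 < fine (mu B) + 1 by rewrite ltr_wpDl// fine_ge0.
have em0 := divr_gt0 e0 m0.
have /nbhs_ballP[d /= d0 Hd] := compact_uniform_near x cF' em0.
have v0 : 0 < `|v| + 1 by rewrite ltr_wpDl.
apply/nbhs_ballP; exists (d / (`|v| + 1)) => /=; first by rewrite divr_gt0.
move=> h; rewrite /ball/= sub0r normrN => hd.
have IF y : mu.-integrable B (EFin \o (fun z => F (y, z))) by exact: integrable_slice.
have IF' y : mu.-integrable B (EFin \o (fun z => F' (y, z))) by exact: integrable_slice.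
have IhF' : mu.-integrable B (EFin \o (fun z => h * F' (x, z))).
  by have := integrableZl mB h (IF' x).
have ID : mu.-integrable B (EFin \o (fun z => F (h *: v + x, z) - F (x, z))).
  by have := integrableB mB (IF (h *: v + x)) (IF x).
rewrite /param_int -RintegralB// -[X in _ - X]/(h * \int[mu]_(z in B) F' (x, z)).
rewrite -RintegralZl// -RintegralB//.
apply: (@le_trans _ _ (e / (fine (mu B) + 1) * `|h| * fine (mu B))).
  apply: le_Rintegral_cst => [|z Bz]; first by have := integrableB mB ID IhF'.
  have dvb y w : derivable (fun y => F (y, w)) y v by case: (dF y w).
  have := @mvt_directional R U (fun y => F (y, z)) x v h (F' (x, z))
    (e / (fine (mu B) + 1)) (dvb ^~ z); apply => t th.
  have [_ ->] := dF (t *: v + x) z; apply/ltW/Hd => //.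
  rewrite -ball_normE/= opprD addrCA subrr addr0 normrN normrZ.
  apply: (@le_lt_trans _ _ (`|h| * (`|v| + 1))).
    by rewrite ler_pM// lerDl.
  by rewrite -ltr_pdivlMr.
rewrite -mulrA [`|h| * _]mulrC mulrA ler_wpM2r//.
by rewrite mulrAC ler_pdivrMr//; apply: ler_wpM2l; rewrite ?lerDl//; exact: ltW.
Qed.

End parametric_integrals.

(** Derivatives are taken in directions [(v, 0)], which leave the factor [psi] alone: the induction
    keeps its form, and continuity of [psi] is enough. *)
Lemma is_Ck_param_int (R : realType) n (B : set 'rV[R]_n) (U : normedModType R)
    k (F : U * 'rV[R]_n -> R) (psi : 'rV[R]_n -> R) :
  compact B -> continuous psi -> is_Ck k F ->
  is_Ck k (param_int B (fun z => F z * psi z.2)).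
Proof.
move=> cB cpsi.
have cFpsi (F' : U * 'rV[R]_n -> R) : continuous F' ->
    continuous (fun z : U * 'rV[R]_n => F' z * psi z.2 : R).
  move=> cF z; apply: continuousM; first exact: cF.
  apply: (@continuous_comp _ _ _ snd psi); [exact: cvg_snd|exact: cpsi].
elim: k F => [|k IH] F CF.
  by apply: param_int_continuous => //; exact: cFpsi.
have [cF dF DF] := CF.
have dI x v : is_derive x v (param_int B (fun z => F z * psi z.2))
    (param_int B (fun z => 'D_(v, 0) F z * psi z.2) x).
  apply: param_int_derive => //; first exact: cFpsi.
    by apply: cFpsi; exact: is_Ck_continuous (DF (v, 0)).
  move=> {}x z; apply: eps_is_derive => e e0 /=.
  have p0 : 0 < `|psi z| + 1 by rewrite ltr_wpDl.
  have := is_derive_eps (derivableP (dF (x, z) (v, 0))) (divr_gt0 e0 p0).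
  apply: filterS => h.
  rewrite (_ : h *: (v, 0) + (x, z) = (h *: v + x, z)); last first.
    by rewrite -[LHS]/(h *: v + x, h *: 0 + z) scaler0 add0r.
  move=> H; rewrite -[h *: ('D_(v, 0) F (x, z) * psi z)]/(h * ('D_(v, 0) F (x, z) * psi z)).
  rewrite -[h *: 'D_(v, 0) F (x, z)]/(h * 'D_(v, 0) F (x, z)) in H.
  rewrite mulrA -!mulrBl normrM.
  apply: (le_trans (ler_wpM2r (normr_ge0 _) H)).
  rewrite mulrAC ler_wpM2r// mulrAC ler_pdivrMr//; apply: ler_wpM2l; first exact: ltW.
  by rewrite lerDl.
split.
- by apply: param_int_continuous => //; exact: cFpsi.
- by move=> x v; case: (dI x v).
move=> v; rewrite [X in is_Ck _ X](_ : _ =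
  param_int B (fun z => 'D_(v, 0) F z * psi z.2)).
  by apply: IH; exact: DF.
by apply/funext => x; case: (dI x v).
Qed.

(** * Smooth bumps *)

Section flat_functions.
Variable R : realType.
Implicit Types P : {poly R}.

(** The flat function exp(-1/t), extended by 0, with a polynomial factor in 1/t: this family is
    closed under differentiation, so smoothness becomes an induction. *)
Definition flat P (t : R) : R :=
  if 0 < t then P.[t^-1] * expR (- t^-1) else 0.

(** From exp(s / (m + 1)) >= 1 + s / (m + 1) >= s / (m + 1), raised to the power [m.+1] and
    inverted. *)
Lemma expRN_le_pow (m : nat) (s : R) : 0 < s -> expR (- s) <= (m.+1%:R / s) ^+ m.+1.
Proof.
move=> s0; rewrite expRN -[leRHS]invrK lef_pV2 ?posrE ?expR_gt0//; last first.
  by rewrite invr_gt0 exprn_gt0// divr_gt0.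
rewrite -exprVn invf_div -[in leRHS](@divfK _ m.+1%:R _ s) ?pnatr_eq0// mulrC.
rewrite [_ * m.+1%:R]mulrC expRM_natl.
have h0 : 0 <= m.+1%:R^-1 * s by rewrite mulr_ge0 ?invr_ge0// ltW.
apply: lerXn2r; rewrite ?nnegrE ?expR_ge0//.
by apply: le_trans (expR_ge1Dx _); rewrite lerDr.
Qed.

Lemma horner_le_pow P (s : R) : 1 <= s ->
  `|P.[s]| <= (\sum_(i < size P) `|P`_i|) * s ^+ size P.
Proof.
move=> s1; rewrite horner_coef; apply: (le_trans (ler_norm_sum _ _ _)).
rewrite mulr_suml; apply: ler_sum => i _; rewrite normrM ler_wpM2l//.
have s0 : 0 <= s by apply: le_trans s1.
by rewrite ger0_norm ?exprn_ge0// ler_weXn2l// ltnW.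
Qed.

(** The polynomial grows at most like h^-n, with [n] its size, and the exponential is estimated with
    the power [n + 2]; the factor [h ^+ 2] left over makes the derivative at 0 vanish. *)
Lemma flat_le P : exists2 C, 0 <= C & forall h, `|h| <= 1 -> `|flat P h| <= C * h ^+ 2.
Proof.
pose n := size P; pose S : R := \sum_(i < n) `|P`_i|.
have S0 : 0 <= S by apply: sumr_ge0 => i _; exact: normr_ge0.
have CS0 : 0 <= S * n.+2%:R ^+ n.+2 by rewrite mulr_ge0// exprn_ge0.
exists (S * n.+2%:R ^+ n.+2) => //.
move=> h h1; rewrite /flat; case: ifPn => [h0|_]; last first.
  by rewrite normr0 mulr_ge0// sqr_ge0.
have hv1 : 1 <= h^-1 by rewrite invf_ge1// (le_trans (ler_norm h)).
have hv0 : 0 < h^-1 by rewrite invr_gt0.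
rewrite normrM (gtr0_norm (expR_gt0 _)).
have h2 := horner_le_pow P hv1; have h3 := expRN_le_pow n.+1 hv0.
apply: (le_trans (ler_pM (normr_ge0 _) (expR_ge0 _) h2 h3)).
rewrite invrK exprMn -/n -/S le_eqVlt; apply/orP; left; apply/eqP.
rewrite -addn2 [h ^+ (n + 2)]exprD exprVn; field.
by rewrite expf_neq0// gt_eqF.
Qed.

Lemma flat_derive P (t : R) : is_derive t (1 : R) (flat P) (flat ((P - P^`()) * 'X^2) t).
Proof.
have [t0|t0|->] := ltgtP t 0.
- rewrite [flat _ t]/flat ltNge (ltW t0)/=.
  apply: (@near_eq_is_derive _ _ _ (cst 0)) => //.
  by near=> z; rewrite /flat ltNge ltW//; near: z; exact: lt_nbhsl.
- have tn0 : t != 0 by rewrite gt_eqF.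
  rewrite [flat _ t]/flat t0.
  apply: (@near_eq_is_derive _ _ _ (fun z : R => P.[z^-1] * expR (- z^-1))) => //.
    by near=> z; rewrite /flat ifT//; near: z; exact: lt_nbhsr.
  have dV : is_derive t (1 : R) (fun z : R => z^-1) (- t ^- 2).
    have := is_deriveV tn0 (is_derive_id t (1 : R)).
    by rewrite [_ *: _]mulr1.
  have dP : is_derive (t^-1) (1 : R) (horner P) (P^`().[t^-1]).
    exact: is_derive_poly.
  have d1 := is_derive1_comp dP dV.
  have dNV : is_derive t (1 : R) (fun z : R => - z^-1) (t ^- 2).
    by have := is_deriveN dV; rewrite opprK.
  have d2 := @is_derive1_comp R expR (fun z => - z^-1) t _ _ (is_derive_expR (- t^-1)) dNV.
  have dM := is_deriveM d1 d2; apply: (is_derive_eq dM) => /=.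
  rewrite hornerM hornerD hornerN hornerXn exprVn.
  rewrite -[P.[t^-1] *: _]/(P.[t^-1] * _) -[expR _ *: _]/(expR _ * _).
  by ring.
rewrite [flat _ 0]/flat ltxx; apply: eps_is_derive => e e0.
have [C C0 HC] := flat_le P.
have C1 : 0 < C + 1 by rewrite ltr_wpDl.
apply/nbhs_ballP; exists (Num.min 1 (e / (C + 1))) => /=.
  by rewrite lt_min ltr01 divr_gt0.
move=> h; rewrite /ball/= sub0r normrN lt_min => /andP[h1 h2].
rewrite [h *: 1]mulr1 addr0 scaler0 subr0 {2}/flat ltxx subr0.
apply: (le_trans (HC h (ltW h1))); rewrite -[h ^+ 2]real_normK ?num_real//.
rewrite expr2 mulrA ler_wpM2r//; move: h2; rewrite ltr_pdivlMr// mulrC => /ltW.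
by apply: le_trans; rewrite ler_wpM2r// lerDl.
Unshelve. all: by end_near. Qed.

Lemma is_derive1_scale (f : R -> R) (x v l : R) : is_derive x (1 : R) f l ->
  is_derive x v f (v * l).
Proof.
move=> df; apply: eps_is_derive => e e0.
have v1 : 0 < `|v| + 1 by rewrite ltr_wpDl.
have /nbhs_ballP[d /= d0 Hd] := is_derive_eps df (divr_gt0 e0 v1).
apply/nbhs_ballP; exists (d / (`|v| + 1)) => /=; first by rewrite divr_gt0.
move=> h; rewrite /ball/= sub0r normrN ltr_pdivlMr// => hd.
have /Hd : ball 0 d (h * v).
  rewrite /ball/= sub0r normrN normrM; apply: le_lt_trans hd.
  by rewrite ler_wpM2l// lerDl.
rewrite [(h * v) *: 1]mulr1 -[h *: v]/(h * v) -[(h * v) *: l]/(h * v * l).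
rewrite -[h *: (v * l)]/(h * (v * l)) mulrA => /le_trans; apply.
rewrite normrM (_ : _ * _ = `|h| * (e * `|v| / (`|v| + 1))); last by ring.
rewrite [leRHS]mulrC; apply: ler_wpM2l => //.
by rewrite ler_pdivrMr//; apply: ler_wpM2l; [exact: ltW|rewrite lerDl].
Qed.

Lemma flat_smooth P : smooth (flat P).
Proof.
move=> k; elim: k P => [|k IH] P.
  by move=> t; exact: is_derive_cvg_continuous (flat_derive P t).
split.
- by move=> t; exact: is_derive_cvg_continuous (flat_derive P t).
- by move=> x v; case: (is_derive1_scale v (flat_derive P x)).
move=> v; rewrite [X in is_Ck _ X](_ : _ =
    fun x => v * flat ((P - P^`()) * 'X^2) x).
  by apply: is_CkM; [exact: is_Ck_cst|exact: IH].
by apply/funext => x; case: (is_derive1_scale v (flat_derive P x)).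
Qed.

Lemma flat1_ge0 t : 0 <= flat 1 t.
Proof. by rewrite /flat; case: ifP => // _; rewrite hornerC mul1r expR_ge0. Qed.

Lemma flat1_gt0 t : (0 < flat 1 t) = (0 < t).
Proof.
rewrite /flat; case: ifP => [t0|_]; last by rewrite ltxx.
by rewrite hornerC mul1r expR_gt0.
Qed.

Lemma real_coord_system : coord_system (fun _ : unit => 1 : R) (fun _ x => x : R).
Proof.
split => [//|x|//]; rewrite (bigD1 tt)//= big1 => [|[]//].
by rewrite addr0 [x *: 1]mulr1.
Qed.

(** A product of one-variable bumps: the two factors of coordinate [j] vanish at and beyond the two
    faces of the cube orthogonal to it. Positivity on the half cube will make the integral
    positive. *)
Lemma exists_smooth_bump n (r : R) : 0 < r ->
  exists eta : 'rV[R]_n -> R, [/\ smooth eta, forall x, 0 <= eta x,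
    forall x, eta x != 0 -> rV_cbox r x &
    forall x, rV_cbox (r / 2) x -> 0 < eta x].
Proof.
move=> r0.
exists (fun x => \prod_(j < n) (flat 1 (r + x ord0 j) * flat 1 (r - x ord0 j))).
have sm (s : R) (j : 'I_n) k : is_Ck k (fun x : 'rV[R]_n => flat 1 (r + s * x ord0 j)).
  have Cg : is_Ck k (fun x : 'rV[R]_n => r + s * x ord0 j).
    apply: is_CkD; first exact: is_Ck_cst.
    apply: is_CkM; first exact: is_Ck_cst.
    have [lin _ bnd] := rV_coord_system R n.
    by apply: is_Ck_linear => [a x y|x]; [exact: lin|exact: bnd].
  apply: (is_Ck_comp real_coord_system (f := flat 1)
     (g := fun x : 'rV[R]_n => r + s * x ord0 j)) => //.
    exact: is_Ck_continuous Cg.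
  exact: flat_smooth.
split.
- move=> k; apply: is_Ck_prod => j; apply: is_CkM.
    have := sm 1 j k; congr is_Ck; apply/funext => x; by rewrite mul1r.
  have := sm (-1) j k; congr is_Ck; apply/funext => x; by rewrite mulN1r.
- by move=> x; apply: prodr_ge0 => j _; rewrite mulr_ge0// flat1_ge0.
- move=> x /prodf_neq0 h j; have := h j isT; rewrite mulf_eq0 negb_or.
  have fl t : flat 1 t != 0 -> 0 < t.
    by move=> tn; rewrite -flat1_gt0 lt_neqAle eq_sym tn flat1_ge0.
  by move=> /andP[/fl ? /fl ?]; rewrite ler_norml; apply/andP; split; lra.
- move=> x h; apply: prodr_gt0 => j _; have := h j.
  by rewrite ler_norml => /andP[? ?]; rewrite mulr_gt0// flat1_gt0; lra.
Qed.

End flat_functions.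

(** * Group operations *)

Lemma continuous_pair (T U V : topologicalType) (f : T -> U) (g : T -> V) :
  continuous f -> continuous g -> continuous (fun x => (f x, g x)).
Proof.
move=> cf cg x A [[P Q] /= [nP nQ] PQ].
have nP' : nbhs x (f @^-1` P) := cf x P nP.
have nQ' : nbhs x (g @^-1` Q) := cg x Q nQ.
have : nbhs x ((f @^-1` P) `&` (g @^-1` Q)) by exact: filterI.
by apply: filterS => y [Py Qy]; apply: (PQ (f y, g y)).
Qed.

Section directional_lines.
Variables (R : realType) (U : normedModType R).

Lemma is_derive_line (f : U -> R) (t : R) (x v : U) (l : R) :
  is_derive (t *: v + x) v f l ->
  is_derive t (1 : R) (fun s : R => f (s *: v + x)) l.
Proof.
move=> df; apply: eps_is_derive => e e0; have := is_derive_eps df e0.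
by apply: filterS => h; rewrite [h *: 1]mulr1 scalerDl addrA.
Qed.

Lemma is_derive_affine (f : U -> R) (x v : U) (d : R) :
  (forall h : R, f (h *: v + x) = f x + h * d) -> is_derive x v f d.
Proof.
move=> H; apply: eps_is_derive => e e0; apply/nbhs_ballP; exists 1 => //= h _.
by rewrite H [f x + _]addrC addrK -[h *: d]/(h * d) subrr normr0 mulr_ge0// ltW.
Qed.

Lemma is_derive_unique (f : U -> R) (x v : U) (a b : R) :
  is_derive x v f a -> is_derive x v f b -> a = b.
Proof. by move=> [_ <-] [_ <-]. Qed.

End directional_lines.

Lemma sum_delta_mx (R : pzRingType) n (i : 'I_n) (F : 'I_n -> R) :
  \sum_k (delta_mx ord0 i : 'rV[R]_n) ord0 k * F k = F i.
Proof.
rewrite (bigD1 i isT) big1 => [|k ki]; last by rewrite mxE eqxx (negbTE ki) mul0r.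
by rewrite /= mxE !eqxx mul1r addr0.
Qed.

Lemma derive_rV2 (R : realType) n (f : 'rV[R]_n * 'rV[R]_n -> R) y a b :
  is_Ck 1 f ->
  'D_(a, b) f y = \sum_k a ord0 k * 'D_(delta_mx ord0 k, 0) f y +
                  \sum_k b ord0 k * 'D_(0, delta_mx ord0 k) f y.
Proof.
move=> Cf; have [_ ->] := derive_coord_sum (rV2_coord_system R n n) y (a, b) Cf.
by rewrite big_sumType.
Qed.

Lemma reshape_index_homo (ns : seq nat) (i j : nat) :
  (i <= j)%N -> (reshape_index ns i <= reshape_index ns j)%N.
Proof.
rewrite /reshape_index -ltnS; move: i.+1 j.+1.
elim: ns => [//|n ns IH] a b ab /=; case: ifPn => // a0.
rewrite ifN ?ltnS; last by apply: contra a0; rewrite !subn_eq0 => /(leq_trans ab).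
by apply: IH; exact: leq_sub2r.
Qed.

Section group.
Variables (R : realType) (ns : seq nat) (G : stratified_group R ns).
Local Notation V := 'rV[R]_(sumn ns).
Local Notation mu := (@lebesgue_rV R (sumn ns)).
Local Notation op := (sg_op G).
Local Notation inv := (sg_inv G).
Local Notation wt j := (reshape_index ns j).+1.
Local Notation e_ i := (delta_mx ord0 i : V).

Definition sg_div (z : V * V) : V := op z.1 (inv z.2).

Lemma sg_inv_unique a b : op a b = 0 -> b = inv a.
Proof. by move=> ab; rewrite -[RHS](sg_opx0 G) -ab (sg_opA G) (sg_opVx G) (sg_op0x G). Qed.

Lemma sg_inv0 : inv 0 = 0.
Proof. by apply/esym/sg_inv_unique; exact: sg_op0x. Qed.

Lemma sg_invK : involutive inv.
Proof. by move=> a; apply/esym/sg_inv_unique; exact: sg_opVx. Qed.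

Lemma sg_invM a b : inv (op a b) = op (inv b) (inv a).
Proof.
apply/esym/sg_inv_unique.
by rewrite (sg_opA G) -(sg_opA G a) (sg_opxV G) (sg_opx0 G) (sg_opxV G).
Qed.

Lemma dilation0 (l : R) : dilation l (0 : V) = 0.
Proof. by apply/rowP => j; rewrite !mxE mulr0. Qed.

Lemma sg_inv_dilation l x : 0 < l -> inv (dilation l x) = dilation l (inv x).
Proof.
move=> l0; apply/esym/sg_inv_unique.
by rewrite -(sg_dilation G l0) (sg_opxV G) dilation0.
Qed.

Lemma sg_div_dilation l z : 0 < l ->
  sg_div (dilation l z.1, dilation l z.2) = dilation l (sg_div z).
Proof. by move=> l0; rewrite /sg_div /= sg_inv_dilation// -(sg_dilation G l0). Qed.

Lemma sg_inv_continuous : continuous inv.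
Proof. exact: (is_Ck_continuous (sg_inv_smooth G 0)). Qed.

Lemma sg_op_continuous : continuous (fun z : V * V => op z.1 z.2).
Proof. exact: (is_Ck_continuous (sg_op_smooth G 0)). Qed.

Lemma sg_div_smooth j : smooth (fun z : V * V => sg_div z ord0 j).
Proof.
move=> k.
have lin1 (i : 'I_(sumn ns)) : is_Ck k (fun z : V * V => z.1 ord0 i).
  have [lin _ bnd] := rV2_coord_system R (sumn ns) (sumn ns).
  apply: is_Ck_linear => [a x y|x]; first exact: (lin (inl i)).
  exact: (bnd (inl i)).
have lin2 (i : 'I_(sumn ns)) : is_Ck k (fun z : V * V => z.2 ord0 i).
  have [lin _ bnd] := rV2_coord_system R (sumn ns) (sumn ns).
  apply: is_Ck_linear => [a x y|x]; first exact: (lin (inr i)).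
  exact: (bnd (inr i)).
apply: (is_Ck_comp (rV2_coord_system R (sumn ns) (sumn ns))
  (f := fun z => op z.1 z.2 ord0 j) (g := fun z => (z.1, inv z.2))).
- apply: continuous_pair => z; first exact: cvg_fst.
  apply: (@continuous_comp _ _ _ snd inv); first exact: cvg_snd.
  exact: sg_inv_continuous.
- by apply: is_Ck_coord; exact: sg_op_smooth.
- case=> i /=; first exact: lin1.
  apply: (is_Ck_comp (rV_coord_system R (sumn ns))
    (f := fun x => inv x ord0 i) (g := snd)) => //.
  + by move=> z; exact: cvg_snd.
  + by apply: is_Ck_coord; exact: sg_inv_smooth.
Qed.

Lemma dilation_le (l : R) (x : V) : 0 <= l <= 1 -> `|dilation l x| <= l * `|x|.
Proof.
move=> /andP[l0 l1]; apply/rV_norm_le => [|i]; first by rewrite mulr_ge0.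
rewrite mxE normrM ger0_norm ?exprn_ge0//; apply: ler_pM; rewrite ?exprn_ge0//.
  by rewrite exprS ler_piMr// exprn_ile1.
exact: rV_coord_le.
Qed.

(** The identity x 0^-1 = x gives the derivative along [(e_ i, 0)], and x x^-1 = 0 makes the
    derivative along the diagonal vanish; the one sought is their difference. *)
Lemma sg_div_derive0 (i j : 'I_(sumn ns)) : 'D_(0, e_ i) (fun z : V * V => sg_div z ord0 j) 0 = - (i == j)%:R.
Proof.
set f := (fun z : V * V => _).
have f0 : f 0 = 0 by rewrite /f /sg_div /= sg_inv0 (sg_opx0 G) mxE.
have d1 : is_derive (0 : V * V) (e_ i, 0) f ((i == j)%:R).
  apply: is_derive_affine => h; rewrite addr0 f0 add0r /f /sg_div /=.
  by rewrite scaler0 sg_inv0 (sg_opx0 G) !mxE eqxx eq_sym.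
have d2 : is_derive (0 : V * V) (e_ i, e_ i) f 0.
  apply: is_derive_affine => h; rewrite addr0 f0 add0r /f /sg_div /=.
  by rewrite (sg_opxV G) mxE mulr0.
have [_ E1] := d1; have [_ E2] := d2.
have := derive_rV2 0 (e_ i) (e_ i) (sg_div_smooth j 1).
rewrite -/f E2 (sum_delta_mx i (fun k => 'D_(e_ k, 0) f 0)).
rewrite (sum_delta_mx i (fun k => 'D_(0, e_ k) f 0)) E1 => /esym.
by move/eqP; rewrite addrC addr_eq0 => /eqP.
Qed.

(* The coordinates of weight [d] of a product are homogeneous of degree [d], so
   their derivatives in coordinates of weight at least [d] are constant. *)
Lemma sg_div_derive (i j : 'I_(sumn ns)) (z : V * V) : (wt j <= wt i)%N ->
  'D_(0, e_ i) (fun z : V * V => sg_div z ord0 j) z = - (i == j)%:R.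
Proof.
move=> wji; rewrite -sg_div_derive0; set f := (fun z : V * V => _).
have [_ df cdf] := sg_div_smooth j 1.
pose D := 'D_(0, e_ i) f.
(* [sg_div_dilation] is differentiated along [e_ i]: dilating the argument multiplies by
   [l ^+ wt i], dilating the value by [l ^+ wt j]. *)
have scal l : 0 < l -> D z = l ^+ (wt i - wt j) * D (dilation l z.1, dilation l z.2).
  move=> l0.
  have h1 : is_derive (0 : R) (1 : R) (fun s : R => f (s *: (0, e_ i) + z)) (D z).
    by apply: is_derive_line; rewrite scale0r add0r; exact: derivableP.
  have h2 : is_derive (l ^+ wt i * 0) (1 : R)
      (fun s : R => f (s *: (0, e_ i) + (dilation l z.1, dilation l z.2)))
      (D (dilation l z.1, dilation l z.2)).
    by apply: is_derive_line; rewrite mulr0 scale0r add0r; exact: derivableP.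
  have h3 : is_derive (0 : R) (1 : R) (fun s : R => l ^+ wt i * s) (l ^+ wt i).
    by apply: is_derive_affine => h; rewrite addr0 mulr0 add0r [h *: 1]mulr1 mulrC.
  have h4 := is_derive1_comp h2 h3.
  have h5 : is_derive (0 : R) (1 : R) (fun s : R => l ^+ wt j * f (s *: (0, e_ i) + z))
      (l ^+ wt j * D z).
    have := is_deriveM (is_derive_cst (l ^+ wt j) (0 : R) (1 : R)) h1.
    by rewrite scaler0 addr0.
  have E : (fun s : R => l ^+ wt j * f (s *: (0, e_ i) + z)) =
     (fun s : R => f (s *: (0, e_ i) + (dilation l z.1, dilation l z.2))) \o
     (fun s : R => l ^+ wt i * s).
    apply/funext => s /=.
    have := sg_div_dilation (s *: (0, e_ i) + z) l0.
    move=> /(congr1 (fun x : V => x ord0 j)); rewrite [in RHS]mxE -/(f _) => <-.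
    congr (sg_div _ ord0 j); rewrite -[RHS]/(_ + _, _ + _)/=.
    rewrite !scaler0 !add0r; congr pair; apply/rowP => k; rewrite !mxE eqxx /=.
    by case: eqP => [->|_] /=; ring.
  rewrite E in h5; have eqD := is_derive_unique h5 h4.
  have wE : l ^+ wt i = l ^+ (wt i - wt j) * l ^+ wt j by rewrite -exprD subnK.
  have lw : l ^+ wt j != 0 by rewrite expf_neq0// gt_eqF.
  by apply: (mulfI lw); rewrite eqD wE; ring.
have close (e : R) : 0 < e -> exists l : R, [/\ 0 < l, l <= 1, l <= e &
    `|D 0 - D (dilation l z.1, dilation l z.2)| < e].
  move=> e0; have /cvgrPdist_lt/(_ e e0) := cdf (0, e_ i) 0.
  rewrite near_simpl => /nbhs_ballP[d /= d0 Hd].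
  have z1 : 0 < `|z| + 1 by rewrite ltr_wpDl.
  pose l := Num.min 1 (Num.min e (d / 2 / (`|z| + 1))).
  have l0 : 0 < l by rewrite !lt_min ltr01 e0 !divr_gt0.
  have ll : l <= d / 2 / (`|z| + 1) by rewrite !ge_min lexx !orbT.
  have l1 : l <= 1 by rewrite !ge_min lexx.
  exists l; split => //; first by rewrite !ge_min lexx orbT.
  apply: Hd; rewrite -ball_normE/= sub0r normrN.
  have ld : l * `|z| < d.
    apply: (@le_lt_trans _ _ (d / 2)); last by move: d0; lra.
    move: ll; rewrite ler_pdivlMr//; apply: le_trans.
    by rewrite ler_wpM2l ?(ltW l0)// lerDl.
  have l01 : 0 <= l <= 1 by rewrite l1 ltW.
  have zz : `|z| = Num.max `|z.1| `|z.2| by [].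
  rewrite prod_normE/= gt_max; apply/andP; split;
    apply: (le_lt_trans (dilation_le _ l01)); apply: le_lt_trans ld;
    by rewrite ler_wpM2l ?(ltW l0)// zz le_max lexx ?orbT.
rewrite -/(D z) -/(D 0).
(* Let [l] tend to 0. With equal weights the factor is 1 and [D z = D 0]; otherwise [i != j], so
   [D 0 = 0], and the factor is at most 1. *)
have [weq|wne] := eqVneq (wt i) (wt j).
  apply/eqP; rewrite -subr_eq0 -normr_eq0 eq_le normr_ge0 andbT.
  apply/ler_addgt0Pr => e e0; rewrite add0r.
  have [l [l0 _ _ h]] := close e e0.
  by rewrite (scal l l0) weq subnn mul1r distrC ltW.
have ij : i != j by apply: contraNneq wne => ->.
have D0 : D 0 = 0 by rewrite /D sg_div_derive0 (negbTE ij) oppr0.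
rewrite D0; apply/eqP; rewrite -normr_eq0 eq_le normr_ge0 andbT.
apply/ler_addgt0Pr => e e0; rewrite add0r.
have [l [l0 l1 _ h]] := close e e0.
rewrite (scal l l0) normrM; rewrite D0 sub0r normrN in h.
apply: le_trans (ltW h); rewrite ler_piMl// ger0_norm ?exprn_ge0 ?(ltW l0)//.
by apply: exprn_ile1 => //; exact: ltW.
Qed.

(** The derivative along [w - z] in the second argument is constant: coordinates before [j] do not
    change, those after [j] lie in layers at least as high and contribute 0 by [sg_div_derive], and
    [j] itself contributes with factor -1. *)
Lemma sg_div_triangular x (j : 'I_(sumn ns)) (z w : V) :
  (forall i : 'I_(sumn ns), (i < j)%N -> z ord0 i = w ord0 i) ->
  sg_div (x, z) ord0 j + z ord0 j = sg_div (x, w) ord0 j + w ord0 j.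
Proof.
move=> zw; set f := (fun z : V * V => sg_div z ord0 j).
have [_ df _] := sg_div_smooth j 1.
have D y : 'D_(0, w - z) f y = - (w - z) ord0 j.
  rewrite (derive_rV2 y 0 (w - z) (sg_div_smooth j 1)).
  rewrite big1 ?add0r => [|i _]; last by rewrite mxE mul0r.
  rewrite (bigD1 j)//= big1 ?addr0 => [|i ij]; last first.
    have [ltij|leji] := ltnP i j; first by rewrite !mxE zw// subrr mul0r.
    rewrite sg_div_derive ?(negbTE ij) ?oppr0 ?mulr0//.
    by rewrite ltnS; exact: reshape_index_homo.
  by rewrite sg_div_derive// eqxx mulrN1.
(* The derivative being constant, the mean value estimate with error 0 is an equality. *)
have := @mvt_directional R _ f (x, z) (0, w - z) 1 (- (w - z) ord0 j) 0
  (fun y => df y _).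
rewrite mul0r => H; have {H} : `|f (1 *: (0, w - z) + (x, z)) - f (x, z) -
    1 * - (w - z) ord0 j| <= 0.
  by apply: H => t _; rewrite D subrr normr0.
rewrite normr_le0 mul1r opprK scale1r -[(0, w - z) + _]/(0 + x, w - z + z).
rewrite add0r subrK !mxE /f => /eqP E.
by lra.
Qed.

Lemma sg_div_measurable x : measurable_fun setT (fun z => sg_div (x, z)).
Proof.
apply: measurable_rVP => i; apply: rV_continuous_measurable.
exact: (@continuous_slice R (sumn ns) V (fun z => sg_div z ord0 i) x
  (is_Ck_continuous (sg_div_smooth i 0))).
Qed.

Lemma sg_div_measure x A : measurable A ->
  mu ((fun z => sg_div (x, z)) @^-1` A) = mu A.
Proof.
apply: triangular_reflection_measure; first exact: sg_div_measurable.
by move=> j z w; exact: sg_div_triangular.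
Qed.

(** The chain rule along [gamma] produces the differential of [op a] applied to the field at
    [gamma t]; left invariance turns it into the field at the translated point. *)
Lemma integral_curve_translate k a gamma : integral_curve (sg_X G k) gamma ->
  integral_curve (sg_X G k) (op a \o gamma).
Proof.
move=> ic t.
have Ca j : is_Ck 1 (fun x => op a x ord0 j).
  have := sg_div_smooth j 1.
  have [lin _ bnd] := rV_coord_system R (sumn ns).
  have Cop : is_Ck 1 (fun z : V * V => op z.1 z.2 ord0 j).
    by apply: is_Ck_coord; exact: sg_op_smooth.
  move=> _; apply: (is_Ck_comp (rV2_coord_system R _ _)
    (f := fun z => op z.1 z.2 ord0 j) (g := fun x => (a, x))) => //.
    exact: pair_right_continuous.
  case=> i; first exact: (@is_Ck_cst _ _ _ 1 (a ord0 i)).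
  by apply: is_Ck_linear => [c x y|x]; [exact: lin|exact: bnd].
have Da x v : is_derive x v (op a) ('D_v (op a) x).
  apply: derivableP.
  have H : is_derive x v (op a) (\row_j 'D_v (fun x => op a x ord0 j) x).
    apply/is_derive_rVP => j; rewrite mxE; apply: derivableP.
    by case: (Ca j) => _ + _; exact.
  by case: H.
apply/is_derive_rVP => j /=.
rewrite -(sg_X_left G k a (gamma t)).
have dj := (is_derive_rVP _ _ _ _).1 (Da (gamma t) (sg_X G k (gamma t))) j.
have dj' := derive_coord_sum (rV_coord_system R _) (gamma t) (sg_X G k (gamma t)) (Ca j).
rewrite (is_derive_unique dj dj').
have [_ daj cdaj] := Ca j.
apply: (is_derive_chain (rV_coord_system R _) (g := gamma) daj).
  by move=> i; exact: cdaj.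
by move=> i; exact: ((is_derive_rVP _ _ _ _).1 (ic t) i).
Qed.

End group.

(** * Mollification *)

Section mollification.
Variables (R : realType) (ns : seq nat) (G : stratified_group R ns).
Local Notation V := 'rV[R]_(sumn ns).
Local Notation H := 'rV[R]_(head 0%N ns).
Local Notation mu := (@lebesgue_rV R (sumn ns)).
Local Notation op := (sg_op G).
Local Notation inv := (sg_inv G).
Local Notation cbox := (@rV_cbox R (sumn ns)).

Lemma sg_mulKV a b : op a (op (inv a) b) = b.
Proof. by rewrite (sg_opA G) (sg_opxV G) (sg_op0x G). Qed.

Lemma sg_divK x z : op (inv (sg_div G (x, z))) x = z.
Proof.
by rewrite /sg_div /= sg_invM sg_invK -(sg_opA G) (sg_opVx G) (sg_opx0 G).
Qed.

Lemma sg_div_continuous x : continuous (fun z => sg_div G (x, z)).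
Proof.
move=> z; apply: (@continuous_comp _ _ _ (fun z => (x, inv z)) (fun z : V * V => op z.1 z.2)).
  apply: continuous_pair; last exact: sg_inv_continuous.
  by move=> z'; exact: cst_continuous.
exact: sg_op_continuous.
Qed.

(** Each integrand vanishes outside its box, so both sides are integrals over the whole space,
    related by the measure-preserving substitution y = x z^-1. *)
Lemma Rintegral_sg_div (h : V -> R) x r1 r2 : continuous h ->
  (forall y, h y != 0 -> cbox r1 y) ->
  (forall z, h (sg_div G (x, z)) != 0 -> cbox r2 z) ->
  \int[mu]_(y in cbox r1) h y = \int[mu]_(z in cbox r2) h (sg_div G (x, z)).
Proof.
move=> ch h1 h2.
have patchT (f : V -> R) r : (forall y, f y != 0 -> cbox r y) -> f \_ (cbox r) = f.
  move=> fr; apply/funext => y; rewrite patchE; case: ifPn => // yr.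
  by apply/esym/eqP; apply: contraNT yr => /fr; rewrite inE.
rewrite Rintegral_mkcond patchT// [RHS]Rintegral_mkcond patchT//.
rewrite /Rintegral; congr fine.
have mT : measurable_fun setT (fun z => sg_div G (x, z)) := sg_div_measurable G x.
have chT : continuous (h \o (fun z => sg_div G (x, z))).
  by move=> z; apply: continuous_comp; [exact: sg_div_continuous|exact: ch].
have := @integral_pushforward _ _ _ _ R _ mT mu setT (EFin \o h).
rewrite preimage_setT => <- //.
- by apply: eq_measure_integral => A mA _; apply/esym; exact: sg_div_measure.
- by apply/measurable_EFinP; exact: rV_continuous_measurable.
have /(integrable_mkcond _ (@rV_cbox_measurable R (sumn ns) r2)).1 :
    mu.-integrable (cbox r2) (EFin \o (h \o (fun z => sg_div G (x, z)))).
  apply: rV_continuous_integrable => //; first exact: rV_cbox_measurable.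
  exact/compact_bounded/rV_cbox_compact.
by rewrite restrict_EFin patchT.
Qed.

Lemma sg_near_translate (S Omega : set V) : compact S -> open Omega ->
  S `<=` Omega -> \forall y \near (0 : V), forall x, S x -> Omega (op y x).
Proof.
move=> cS oO SO.
apply: ((@compact_near_coveringP V S).1 cS V (nbhs (0 : V)) (fun y x => Omega (op y x)) _).
move=> x Sx.
have Ox : nbhs (op 0 x) Omega.
  by rewrite (sg_op0x G); apply: open_nbhs_nbhs; split => //; exact: SO.
have [[P Q] /= [nP nQ] PQ] := @sg_op_continuous R ns G (0, x) _ Ox.
by exists (Q, P) => //= -[x' y'] /= [Qx Py]; exact: (PQ (y', x')).
Qed.

Lemma sg_translate_continuous (h : V -> R) : continuous h ->
  continuous (fun z : V * V => h (op (inv z.1) z.2)).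
Proof.
move=> ch z.
apply: (@continuous_comp _ _ _ (fun z : V * V => op (inv z.1) z.2) h); last exact: ch.
apply: (@continuous_comp _ _ _ (fun z : V * V => (inv z.1, z.2)) (fun z : V * V => op z.1 z.2)).
  apply: continuous_pair => z'; last exact: cvg_snd.
  by apply: (@continuous_comp _ _ _ fst inv); [exact: cvg_fst|exact: sg_inv_continuous].
exact: sg_op_continuous.
Qed.

(** A vanishing integral would make [eta] zero almost everywhere on the cube, but it is positive on
    the half cube, which has positive measure. *)
Lemma integral_bump_gt0 (eta : V -> R) (r : R) : 0 < r -> continuous eta ->
  (forall x, 0 <= eta x) -> (forall x, cbox (r / 2) x -> 0 < eta x) ->
  0 < \int[mu]_(y in cbox r) eta y.
Proof.
move=> r0 ceta eta0 etap.
have Ieta : mu.-integrable (cbox r) (EFin \o eta).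
  apply: rV_continuous_integrable => //; first exact: rV_cbox_measurable.
  exact/compact_bounded/rV_cbox_compact.
rewrite lt_neqAle Rintegral_ge0// andbT eq_sym; apply/negP => /eqP Z0.
have mcb := @rV_cbox_measurable R (sumn ns) r.
have int0 : (\int[mu]_(x in cbox r) `|(EFin \o eta) x| = 0)%E.
  under eq_integral do rewrite gee0_abs ?lee_fin//.
  rewrite -[LHS]fineK; first by rewrite -[fine _]/(\int[mu]_(y in cbox r) eta y) Z0.
  exact: (integrable_fin_num mcb Ieta).
have meta : measurable_fun (cbox r) (EFin \o eta).
  apply/measurable_EFinP; apply: (@measurable_funS _ _ _ _ setT) => //.
  exact: rV_continuous_measurable.
have [N [mN N0 sN]] := (ae_eq_integral_abs mu mcb meta).1 int0.
have r20 : 0 <= r / 2 by rewrite divr_ge0// ltW.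
have : (mu (cbox (r / 2)) <= mu N)%E.
  apply: le_measure; rewrite ?inE//; first exact: rV_cbox_measurable.
  move=> x xr; apply: sN => /= h.
  have xr' : cbox r x by move=> i; apply: (le_trans (xr i)); move: r0; lra.
  by have := etap x xr; have [->] := h xr'; rewrite ltxx.
rewrite N0 lebesgue_rV_box// lee_fin leNgt exprn_gt0//.
by rewrite mulrn_wgt0// divr_gt0.
Qed.

Variables (eta : V -> R) (r : R).
Hypotheses (r0 : 0 < r) (eta_smooth : smooth eta) (eta_ge0 : forall x, 0 <= eta x)
  (eta_supp : forall x, eta x != 0 -> cbox r x)
  (eta_pos : forall x, cbox (r / 2) x -> 0 < eta x).

Let ceta : continuous eta := is_Ck_continuous (eta_smooth 0).
Let Z : R := \int[mu]_(y in cbox r) eta y.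
Let Z0 : 0 < Z. Proof. exact: integral_bump_gt0. Qed.
Let cb : compact (cbox r). Proof. exact: rV_cbox_compact. Qed.
Let mb : measurable (cbox r). Proof. exact: rV_cbox_measurable. Qed.
Let bb : bounded_set (cbox r). Proof. exact: compact_bounded. Qed.

(** The average of h(y^-1 x) in y with density eta / Z. In the pair [z] the first component is the
    parameter, the second the variable of integration. *)
Definition mollifier (h : V -> R) (x : V) : R :=
  Z^-1 * param_int (cbox r) (fun z : V * V => eta z.2 * h (op (inv z.2) z.1)) x.

(** Stated for a general [g]: the identity serves for continuity in [x], an integral curve for the
    horizontal derivative. *)
Lemma mollifier_integrand_continuous (U : topologicalType) (g : U -> V) (h : V -> R) :
  continuous g -> continuous h ->
  continuous (fun z : U * V => eta z.2 * h (op (inv z.2) (g z.1)) : R).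
Proof.
move=> cg ch z; apply: continuousM.
  by apply: (@continuous_comp _ _ _ snd eta); [exact: cvg_snd|exact: ceta].
apply: (@continuous_comp _ _ _ (fun z : U * V => (z.2, g z.1))
  (fun z : V * V => h (op (inv z.1) z.2))); last exact: sg_translate_continuous.
apply: continuous_pair => z'; first exact: cvg_snd.
by apply: (@continuous_comp _ _ _ fst g); [exact: cvg_fst|exact: cg].
Qed.

Lemma mollifier_integrand_continuous_id (h : V -> R) : continuous h ->
  continuous (fun z : V * V => eta z.2 * h (op (inv z.2) z.1) : R).
Proof.
by apply: (@mollifier_integrand_continuous V id h) => y; exact: cvg_id.
Qed.

Lemma mollifier_continuous (h : V -> R) : continuous h -> continuous (mollifier h).
Proof.
move=> ch x.
have cF : continuous (fun z : V * V => eta z.2 * h (op (inv z.2) z.1) : R).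
  exact: mollifier_integrand_continuous_id.
have cI := param_int_continuous cb cF.
exact: (continuousM (@cst_continuous _ _ Z^-1 x) (cI x)).
Qed.

(** [eta / Z] is nonnegative with integral 1 over the box, so the difference is an average of the
    differences that [e] bounds. *)
Lemma mollifier_close (h : V -> R) x e : continuous h ->
  (forall y, cbox r y -> `|h (op (inv y) x) - h x| <= e) ->
  `|mollifier h x - h x| <= e.
Proof.
move=> ch he.
have I1 : mu.-integrable (cbox r) (EFin \o (fun y => eta y * h (op (inv y) x))).
  apply: rV_continuous_integrable => //.
  apply: (continuous_slice (F := fun z : V * V => eta z.2 * h (op (inv z.2) z.1))).
  exact: mollifier_integrand_continuous_id.
have I0 : mu.-integrable (cbox r) (EFin \o eta) by exact: rV_continuous_integrable.
have I2 c : mu.-integrable (cbox r) (EFin \o (fun y => c * eta y)).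
  by have := integrableZl mb c I0.
have -> : mollifier h x - h x =
    Z^-1 * \int[mu]_(y in cbox r) (eta y * h (op (inv y) x) - h x * eta y).
  rewrite RintegralB// RintegralZl// -/Z mulrBr /mollifier /param_int; congr (_ - _).
  by rewrite mulrCA mulVf ?gt_eqF// mulr1.
have I3 : mu.-integrable (cbox r) (EFin \o (fun y => eta y * h (op (inv y) x) - h x * eta y)).
  by have := integrableB mb I1 (I2 (h x)).
rewrite normrM gtr0_norm ?invr_gt0// ler_pdivrMl// mulrC.
apply: (le_trans (le_normr_Rintegral mb I3)).
rewrite -RintegralZl//; apply: le_Rintegral => //; first exact: integrable_norm.
move=> y ry; rewrite [h x * _]mulrC -mulrBr normrM ger0_norm// mulrC.
by rewrite ler_wpM2r// he.
Qed.

(** The substitution y = x z^-1 moves [x] out of [h], which is only continuous, into the smooth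
    factor [eta], where it can be differentiated under the integral. *)
Lemma mollifier_smooth (h : V -> R) rh : continuous h -> (forall x, h x != 0 -> cbox rh x) ->
  smooth (mollifier h).
Proof.
move=> ch hr k; apply: is_CkM; first exact: is_Ck_cst.
rewrite [X in is_Ck _ X](_ : _ =
  param_int (cbox rh) (fun z : V * V => eta (sg_div G z) * h z.2)).
  apply: is_Ck_param_int => //; first exact: rV_cbox_compact.
  apply: (is_Ck_comp (rV_coord_system R _) (f := eta) (g := sg_div G)) => //.
    move=> z; apply: (@continuous_comp _ _ _ (fun z : V * V => (z.1, inv z.2)) (fun z : V * V => op z.1 z.2)).
      apply: continuous_pair => z'; first exact: cvg_fst.
      by apply: (@continuous_comp _ _ _ snd inv); [exact: cvg_snd|exact: sg_inv_continuous].
    exact: sg_op_continuous.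
  by move=> i; exact: sg_div_smooth.
apply/funext => x; rewrite /param_int /=.
rewrite (@Rintegral_sg_div (fun y => eta y * h (op (inv y) x)) x r rh).
- by apply: eq_Rintegral => z _; rewrite sg_divK.
- apply: (continuous_slice (F := fun z : V * V => eta z.2 * h (op (inv z.2) z.1))).
  exact: mollifier_integrand_continuous_id.
- by move=> y; rewrite mulf_eq0 negb_or => /andP[/eta_supp].
- by move=> z; rewrite sg_divK mulf_eq0 negb_or => /andP[_ /hr].
Qed.

(** Along an integral curve, each left translate by y^-1 is integral for the same field, so the
    integrand has derivative [eta y] times [Dh] at the translated point. *)
Lemma mollifier_hgrad (h : V -> R) (Dh : V -> H) : continuous h -> continuous Dh -> is_hgrad G h Dh ->
  is_hgrad G (mollifier h)
    (fun x => \row_k mollifier (fun y => Dh y ord0 k) x).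
Proof.
move=> ch cDh dh k gamma ic t; rewrite mxE /mollifier.
have cgamma : continuous gamma.
  by move=> s; exact: is_derive_cvg_continuous (ic s).
have cDhk : continuous (fun y => Dh y ord0 k).
  move=> y; apply: (@continuous_comp _ _ _ Dh (fun y : H => y ord0 k)); first exact: cDh.
  exact: coord_continuous.
have := @param_int_derive R (sumn ns) (cbox r) cb R
  (fun z : R * V => eta z.2 * h (op (inv z.2) (gamma z.1)))
  (fun z : R * V => eta z.2 * Dh (op (inv z.2) (gamma z.1)) ord0 k) 1.
move=> /(_ _ _ _ t) dI.
have {}dI : is_derive t (1 : R)
    (param_int (cbox r) (fun z : R * V => eta z.2 * h (op (inv z.2) (gamma z.1))))
    (param_int (cbox r) (fun z : R * V => eta z.2 * Dh (op (inv z.2) (gamma z.1)) ord0 k) t).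
  apply: dI.
  - exact: (mollifier_integrand_continuous cgamma ch).
  - exact: (mollifier_integrand_continuous cgamma cDhk).
  move=> s y /=.
  have := dh k _ (integral_curve_translate (inv y) ic) s => d1.
  have := is_deriveM (is_derive_cst (eta y) s (1 : R)) d1.
  by rewrite scaler0 addr0.
have := is_deriveM (is_derive_cst (Z^-1) t (1 : R)) dI.
by rewrite scaler0 addr0.
Qed.

(** If [mollifier h x] is nonzero, then y^-1 x is in [S] for some y in the box, so [x] lies in the
    group product of the box and [S], which is compact, hence closed, and inside [Omega]. *)
Lemma mollifier_support (h : V -> R) (S Omega : set V) : compact S ->
  (forall x, h x != 0 -> S x) ->
  (forall y x, cbox r y -> S x -> Omega (op y x)) ->
  compact_support_in Omega (mollifier h).
Proof.
move=> cS hS SO.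
pose S' := (fun z : V * V => op z.1 z.2) @` (cbox r `*` S).
have cS' : compact S'.
  apply: continuous_compact; last exact: compact_setX.
  exact/continuous_subspaceT/sg_op_continuous.
have clS' : closed S' by apply: compact_closed => //; exact: norm_hausdorff.
have sub : closure [set x | mollifier h x != 0] `<=` S'.
  rewrite [S'](closure_id _).1//; apply: closure_subset => x /=.
  apply: contraNP => nx; rewrite /mollifier /param_int.
  rewrite (@eq_Rintegral _ _ _ _ _ (cst 0)); first by rewrite Rintegral_cst// mul0r mulr0.
  move=> y; rewrite inE => ry /=; apply/eqP; rewrite mulf_eq0; apply/orP; right.
  apply/negPn/negP => /hS Sx; apply: nx; exists (y, op (inv y) x) => //=.
  exact: sg_mulKV.
split; first by apply: (subclosed_compact _ cS' sub); exact: closed_closure.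
by apply: (subset_trans sub) => _ [[y x] /= [ry Sx] <-]; exact: SO.
Qed.

End mollification.

Lemma continuous_rV (R : realType) (T : topologicalType) n (f : T -> 'rV[R]_n) :
  (forall i, continuous (fun x => f x ord0 i)) -> continuous f.
Proof.
move=> cf x; apply/cvgrPdist_lt => e e0.
have e2 : 0 < e / 2 by rewrite divr_gt0.
have : \forall y \near x, forall i, `|f x ord0 i - f y ord0 i| < e / 2.
  apply: (@near_forall_fin _ _ _ (fun i y => `|f x ord0 i - f y ord0 i| < e / 2)).
  by move=> i; move/cvgrPdist_lt : (cf i x); exact.
apply: filterS => y hy; apply: (@le_lt_trans _ _ (e / 2)); last by move: e0; lra.
by apply/rV_norm_le => [|i]; [exact: ltW|rewrite !mxE ltW// hy].
Qed.

Section smooth_approximation.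
Variables (R : realType) (ns : seq nat) (G : stratified_group R ns).
Local Notation V := 'rV[R]_(sumn ns).
Local Notation H := 'rV[R]_(head 0%N ns).

(** Closeness of [phi] and of each component of [Dphi] on the cube, and translates of the support
    staying in [Omega], all hold for translations near the identity; the bump is supported among
    these. The cube will be one that contains [Omega]. *)
Lemma C10_smooth_approx (Omega : set V) (phi : V -> R) (Dphi : V -> H) (rK e : R) :
  open Omega -> C10 G Omega phi Dphi -> 0 < e ->
  exists psi Dpsi, [/\ smooth psi, compact_support_in Omega psi,
    is_hgrad G psi Dpsi, continuous Dpsi
    & forall x, rV_cbox rK x -> `|psi x - phi x| <= e /\
        forall k, `|Dpsi x ord0 k - Dphi x ord0 k| <= e].
Proof.
move=> oO [cphi hphi cDphi [cS SO]] e0.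
set S := closure _ in cS SO.
have cDk k : continuous (fun y => Dphi y ord0 k).
  move=> y; apply: (@continuous_comp _ _ _ Dphi (fun y : H => y ord0 k)); first exact: cDphi.
  exact: coord_continuous.
have trans0 x : sg_op G (sg_inv G 0) x = x by rewrite sg_inv0 (sg_op0x G).
have near_h (h : V -> R) : continuous h -> \forall y \near (0 : V), forall x,
    rV_cbox rK x -> `|h (sg_op G (sg_inv G y) x) - h x| <= e.
  move=> ch; have := compact_uniform_near (@rV_cbox_compact R (sumn ns) rK) 0
    (sg_translate_continuous (G := G) ch) e0.
  by apply: filterS => y hy x Kx; have := hy x Kx; rewrite /= trans0 => /ltW.
have n1 := near_h _ cphi.
have n2 := near_forall_fin (fun k => near_h _ (cDk k)).
have n3 := sg_near_translate G cS oO SO.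
have /nbhs_ballP[d /= d0 Hd] : \forall y \near (0 : V),
    [/\ forall x, rV_cbox rK x ->
          `|phi (sg_op G (sg_inv G y) x) - phi x| <= e,
        forall k x, rV_cbox rK x ->
          `|Dphi (sg_op G (sg_inv G y) x) ord0 k - Dphi x ord0 k| <= e
      & forall x, S x -> Omega (sg_op G y x)].
  by near=> y; split; near: y.
pose r := d / 2; have r0 : 0 < r by rewrite divr_gt0.
have rd y : rV_cbox r y -> ball (0 : V) d y.
  move=> yr; rewrite -ball_normE/= sub0r normrN.
  apply: (@le_lt_trans _ _ r); last by rewrite /r; move: d0; lra.
  by apply/rV_norm_le => //; exact: ltW.
have [eta [seta eta0 esupp epos]] := exists_smooth_bump (sumn ns) r0.
have [rh rh0 Srh] := rV_bounded_sub_cbox (compact_bounded cS).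
have phiS x : phi x != 0 -> S x by move=> h; apply: subset_closure.
exists (mollifier G eta r phi), (fun x => \row_k mollifier G eta r (fun y => Dphi y ord0 k) x).
split.
- have phib x : phi x != 0 -> rV_cbox rh x by move=> /phiS; exact: Srh.
  by apply: mollifier_smooth phib.
- apply: mollifier_support cS phiS _ => // y x ry Sx.
  by have [_ _ h] := Hd y (rd y ry); exact: h.
- exact: mollifier_hgrad.
- apply: continuous_rV => k.
  rewrite (_ : (fun x => _) = mollifier G eta r (fun y => Dphi y ord0 k)).
    exact: mollifier_continuous.
  by apply/funext => x; rewrite mxE.
- move=> x Kx; split.
    apply: mollifier_close => // y ry.
    by have [h _ _] := Hd y (rd y ry); exact: h.
  move=> k; rewrite mxE.
  apply: mollifier_close => // y ry.
  by have [_ h _] := Hd y (rd y ry); exact: h.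
Unshelve. all: by end_near. Qed.

End smooth_approximation.

(** * Pointwise inequalities *)

Section euclidean_norm.
Variables (R : realType) (n : nat).
Implicit Types a b : 'rV[R]_n.

Lemma dotRC a b : dotR a b = dotR b a.
Proof. by apply: eq_bigr => i _; rewrite mulrC. Qed.

Lemma dotRDr a b c : dotR a (b + c) = dotR a b + dotR a c.
Proof. by rewrite /dotR -big_split; apply: eq_bigr => i _; rewrite mxE mulrDr. Qed.

Lemma dotRZr a (k : R) b : dotR a (k *: b) = k * dotR a b.
Proof. by rewrite /dotR mulr_sumr; apply: eq_bigr => i _; rewrite mxE mulrCA. Qed.

Lemma dotR_ge0 a : 0 <= dotR a a.
Proof. by apply: sumr_ge0 => i _; rewrite -expr2 sqr_ge0. Qed.

Lemma enorm_ge0 a : 0 <= enorm a.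
Proof. exact: sqrtr_ge0. Qed.

Lemma enorm_sqr a : enorm a ^+ 2 = dotR a a.
Proof. by rewrite sqr_sqrtr// dotR_ge0. Qed.

Lemma coord_le_enorm a i : `|a ord0 i| <= enorm a.
Proof.
rewrite -ler_sqr ?nnegrE ?enorm_ge0// enorm_sqr real_normK ?num_real// /dotR.
rewrite (bigD1 i)//= -expr2 lerDl; apply: sumr_ge0 => j _.
by rewrite -expr2 sqr_ge0.
Qed.

Lemma enorm_eq0 a : enorm a = 0 -> a = 0.
Proof.
move=> a0; apply/rowP => i; rewrite mxE; apply/eqP; rewrite -normr_eq0 eq_le normr_ge0.
by rewrite -a0 coord_le_enorm.
Qed.

Lemma dotR_CauchySchwarz a b : `|dotR a b| <= enorm a * enorm b.
Proof.
have le (c d : 'rV[R]_n) : dotR c d <= enorm c * enorm d.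
  have [c0|c0] := eqVneq (enorm c) 0.
    rewrite c0 mul0r (enorm_eq0 c0) /dotR big1// => i _; by rewrite mxE mul0r.
  have [d0|d0] := eqVneq (enorm d) 0.
    rewrite d0 mulr0 (enorm_eq0 d0) /dotR big1// => i _; by rewrite mxE mulr0.
  have cp : 0 < enorm c by rewrite lt_neqAle eq_sym c0 enorm_ge0.
  have dp : 0 < enorm d by rewrite lt_neqAle eq_sym d0 enorm_ge0.
  (* Expanding this square gives 2 |c| |d| times the gap in the inequality. *)
  have := dotR_ge0 (enorm d *: c + (- enorm c) *: d).
  rewrite dotRDr !dotRZr dotRC [dotR _ d]dotRC !dotRDr !dotRZr -!enorm_sqr.
  rewrite [dotR d c]dotRC => h.
  have cd := mulr_gt0 cp dp.
  by rewrite -(ler_pM2l cd); move: h; lra.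
rewrite ler_norml le andbT lerNl -mulN1r -dotRZr.
have -> : enorm b = enorm (-1 *: b).
  by rewrite /enorm dotRZr dotRC dotRZr mulrA mulN1r opprK mul1r.
exact: le.
Qed.

Lemma enormD a b : enorm (a + b) <= enorm a + enorm b.
Proof.
rewrite -ler_sqr ?nnegrE ?addr_ge0 ?enorm_ge0// enorm_sqr.
rewrite dotRDr dotRC dotRDr [dotR (a + b) b]dotRC dotRDr -!enorm_sqr [dotR b a]dotRC.
have := le_trans (ler_norm _) (dotR_CauchySchwarz a b); lra.
Qed.

Lemma enorm_le_sum a (e : R) : 0 <= e -> (forall i, `|a ord0 i| <= e) ->
  enorm a <= n%:R * e.
Proof.
move=> e0 he; have ne0 : 0 <= n%:R * e by rewrite mulr_ge0.
rewrite -ler_sqr ?nnegrE ?enorm_ge0// enorm_sqr.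
apply: (@le_trans _ _ (\sum_(i < n) e ^+ 2)).
  apply: ler_sum => i _; rewrite -expr2 -[leLHS]real_normK ?num_real//.
  by apply: lerXn2r; rewrite ?nnegrE.
rewrite sumr_const card_ord -[leLHS]mulr_natl exprMn ler_wpM2r ?sqr_ge0//.
rewrite -natrX ler_nat; case: (n) => // m.
by rewrite expnS expn1 leq_pmulr.
Qed.

Lemma enorm_dist a b : `|enorm a - enorm b| <= enorm (a - b).
Proof.
have le (c d : 'rV[R]_n) : enorm c - enorm d <= enorm (c - d).
  by rewrite lerBlDr; have := enormD (c - d) d; rewrite subrK.
rewrite ler_norml le andbT lerNl opprB; apply: (le_trans (le b a)).
rewrite -opprB -scaleN1r.
by rewrite /enorm dotRZr dotRC dotRZr mulrA mulN1r opprK mul1r.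
Qed.

End euclidean_norm.

Section real_powers.
Variable R : realType.
Implicit Types a b t p r : R.

(** The sum is at most twice the larger term. *)
Lemma powR_add_le a b p : 0 <= a -> 0 <= b -> 0 <= p ->
  (a + b) `^ p <= 2 `^ p * (a `^ p + b `^ p).
Proof.
move=> a0 b0 p0.
have aux (c d : R) : 0 <= c -> 0 <= d -> c <= d ->
    (c + d) `^ p <= 2 `^ p * (c `^ p + d `^ p).
  move=> c0 d0 cd; apply: (@le_trans _ _ ((2 * d) `^ p)).
    by apply: ge0_ler_powR; rewrite ?nnegrE ?addr_ge0 ?mulr_ge0//; lra.
  by rewrite powRM// ler_wpM2l ?powR_ge0// lerDr powR_ge0.
by case: (leP a b) => [|/ltW] ab; [exact: aux|rewrite addrC [a `^ p + _]addrC; exact: aux].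
Qed.

(** Both factors are estimated by the larger of [a] and [b]. *)
Lemma powR_mul_le a b p : 0 <= a -> 0 <= b -> 1 < p ->
  a `^ (p - 1) * b <= a `^ p + b `^ p.
Proof.
move=> a0 b0 p1.
have E (c : R) : 0 <= c -> c `^ (p - 1) * c = c `^ p.
  by move=> c0; rewrite mulrC mulr_powRB1//; lra.
have [ab|/ltW ab] := leP a b.
  apply: (@le_trans _ _ (b `^ (p - 1) * b)); last by rewrite E// lerDr powR_ge0.
  by rewrite ler_wpM2r//; apply: ge0_ler_powR; rewrite ?nnegrE//; lra.
by apply: (@le_trans _ _ (a `^ (p - 1) * a)); rewrite ?ler_wpM2l ?powR_ge0// E// lerDl powR_ge0.
Qed.

(** Young's inequality for a and b^(p-1), with exponents [p] and [p / (p - 1)]. *)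
Lemma powR_young a b p : 0 <= a -> 0 <= b -> 1 < p ->
  p * a * b `^ (p - 1) <= a `^ p + (p - 1) * b `^ p.
Proof.
move=> a0 b0 p1.
have p0 : 0 < p by lra.
have p10 : 0 < p - 1 by lra.
have q0 : 0 < p / (p - 1) by rewrite divr_gt0.
have pq : p^-1 + (p / (p - 1))^-1 = 1.
  by rewrite invf_div; field; rewrite gt_eqF.
have := conjugate_powR a0 (powR_ge0 b (p - 1)) p0 q0 pq.
have -> : (b `^ (p - 1)) `^ (p / (p - 1)) = b `^ p.
  by rewrite -powRrM; congr (_ `^ _); field; rewrite gt_eqF.
move=> /(ler_wpM2l (ltW p0)); rewrite mulrA => /le_trans; apply.
rewrite mulrDr le_eqVlt; apply/orP; left; apply/eqP.
by field; rewrite !gt_eqF.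
Qed.

Lemma powR_lt_root r e h : 0 < r -> 0 < e -> 0 <= h -> h < e `^ r^-1 -> h `^ r < e.
Proof.
move=> r0 e0 h0 he.
have -> : e = (e `^ r^-1) `^ r by rewrite -powRrM mulVf ?gt_eqF// powRr1// ltW.
by apply: gt0_ltr_powR; rewrite ?nnegrE ?powR_ge0.
Qed.

Lemma norm_powR_continuous r : 0 < r -> continuous (fun t : R => `|t| `^ r).
Proof.
move=> r0 t; have [->|t0] := eqVneq t 0.
  apply/cvgrPdist_lt => e e0; rewrite normr0 powR0 ?gt_eqF//.
  apply/nbhs_ballP; exists (e `^ r^-1) => /=; first by rewrite powR_gt0.
  move=> h; rewrite /ball/= !sub0r !normrN => he.
  by rewrite ger0_norm ?powR_ge0//; exact: powR_lt_root.
apply: (@continuous_comp _ _ _ (@Num.norm R R) (fun s : R => s `^ r)).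
  exact: norm_continuous.
apply: is_derive_cvg_continuous (is_derive1_powR r _).
by rewrite normr_gt0.
Qed.

Definition dnorm_powR p t : R := p * `|t| `^ (p - 1) * Num.sg t.

Lemma norm_powR_derive p t : 1 < p ->
  is_derive t (1 : R) (fun s : R => `|s| `^ p) (dnorm_powR p t).
Proof.
move=> p1; rewrite /dnorm_powR; have [t0|t0|->] := ltgtP t 0.
- rewrite ltr0_sg// ltr0_norm// mulrN1.
  apply: (@near_eq_is_derive _ _ _ (fun s : R => (- s) `^ p)).
    by near=> s; rewrite ltr0_norm//; near: s; exact: lt_nbhsl.
  have d1 : is_derive (- t) (1 : R) (fun s : R => s `^ p) (p * (- t) `^ (p - 1)).
    by apply: is_derive1_powR; rewrite oppr_gt0.
  have d2 : is_derive t (1 : R) (fun s : R => - s) (- 1) by exact: is_deriveNid.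
  have := @is_derive1_comp R (fun s : R => s `^ p) (fun s : R => - s) t _ _ d1 d2.
  by rewrite mulrN1.
- rewrite gtr0_sg// gtr0_norm// mulr1.
  apply: (@near_eq_is_derive _ _ _ (fun s : R => s `^ p)).
    by near=> s; rewrite gtr0_norm//; near: s; exact: lt_nbhsr.
  exact: is_derive1_powR.
rewrite sgr0 mulr0; apply: eps_is_derive => e e0.
have p10 : 0 < p - 1 by lra.
apply/nbhs_ballP; exists (e `^ (p - 1)^-1) => /=; first by rewrite powR_gt0.
move=> h; rewrite /ball/= sub0r normrN => he.
rewrite [h *: 1]mulr1 addr0 normr0 powR0 ?gt_eqF//; last by lra.
rewrite subr0 scaler0 subr0 ger0_norm ?powR_ge0//.
have := powR_lt_root p10 e0 (normr_ge0 h) he => he'.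
rewrite -(@mulr_powRB1 _ `|h|)//; last by lra.
by rewrite mulrC ler_wpM2r// ltW.
Unshelve. all: by end_near. Qed.

Lemma dnorm_powR_continuous p : 1 < p -> continuous (dnorm_powR p).
Proof.
move=> p1 t; have p10 : 0 < p - 1 by lra.
have cn := norm_powR_continuous p10.
have [->|t0] := eqVneq t 0.
  apply/cvgrPdist_lt => e e0.
  have p0 : 0 < p by lra.
  have /cvgrPdist_lt/(_ _ (divr_gt0 e0 p0)) := cn 0.
  apply: filterS => s; rewrite /dnorm_powR sgr0 mulr0 normr0 powR0 ?gt_eqF//.
  rewrite !sub0r !normrN !normrM (ger0_norm (powR_ge0 _ _)) (gtr0_norm p0) normr_sg.
  rewrite ltr_pdivlMr// mulrC => /le_lt_trans; apply.
  by rewrite ler_piMr ?mulr_ge0 ?powR_ge0 ?(ltW p0)//; case: (s != 0).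
have near_sg : \forall s \near t, Num.sg s = Num.sg t.
  have [tn|tp|t00] := ltgtP t 0; last by rewrite t00 eqxx in t0.
    by near=> s; rewrite !ltr0_sg//; near: s; exact: lt_nbhsl.
  by near=> s; rewrite !gtr0_sg//; near: s; exact: lt_nbhsr.
have c1 : {for t, continuous (fun s : R => p * `|s| `^ (p - 1) * Num.sg t)}.
  apply: (@continuousM _ _ (fun s : R => p * `|s| `^ (p - 1)) (fun=> Num.sg t)).
    apply: (@continuousM _ _ (fun=> p) (fun s : R => `|s| `^ (p - 1))).
      exact: cst_continuous.
    exact: cn.
  exact: cst_continuous.
apply: cvg_trans c1; apply: near_eq_cvg.
by near=> s; rewrite /dnorm_powR; congr (_ * _); apply/esym; near: s.
Unshelve. all: by end_near. Qed.

(* [p |t|^(p-1) sg t a F + |t|^p F' w] is the gradient of [|t|^p F]. *)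
Lemma picone_pointwise n (p t s : R) (a w : 'rV[R]_n) : 1 < p -> 0 < s ->
  enorm w `^ (p - 2) * dotR w ((dnorm_powR p t * s `^ (1 - p)) *: a +
    (`|t| `^ p * ((1 - p) * s `^ (- p))) *: w) <= enorm a `^ p.
Proof.
move=> p1 s0.
(* Exponents need not add at base 0, so [w = 0] is separate: both sides then vanish, whatever the
   power [p - 2] of 0 is. *)
have wp : enorm w `^ (p - 2) * enorm w ^+ 2 = enorm w `^ p.
  have [->|w0] := eqVneq (enorm w) 0.
    by rewrite expr0n mulr0 powR0// gt_eqF//; lra.
  rewrite -powR_mulrn ?enorm_ge0// -powRD; last by rewrite w0 implybT.
  by congr (_ `^ _); ring.
have wp1 : enorm w `^ (p - 2) * enorm w = enorm w `^ (p - 1).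
  have [->|w0] := eqVneq (enorm w) 0.
    by rewrite mulr0 powR0// gt_eqF//; lra.
  rewrite -[X in _ * X]powRr1 ?enorm_ge0// -powRD; last by rewrite w0 implybT.
  by congr (_ `^ _); ring.
rewrite dotRDr !dotRZr -enorm_sqr mulrDr.
(* With b = |t| |w| / s, the term in [w] equals -(p - 1) b^p and the term in [a] is at most p |a|
   b^(p-1); [powR_young] for |a| and b concludes. *)
have -> : enorm w `^ (p - 2) * (`|t| `^ p * ((1 - p) * s `^ (- p)) * enorm w ^+ 2) =
    - ((p - 1) * ((`|t| * enorm w / s) `^ p)).
  rewrite powRM ?mulr_ge0 ?enorm_ge0 ?invr_ge0 ?(ltW s0)// powRM ?enorm_ge0//.
  rewrite -powR_inv1 ?(ltW s0)// -powRrM mulN1r -wp; ring.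
have h1 : enorm w `^ (p - 2) * (dnorm_powR p t * s `^ (1 - p) * dotR w a) <=
    p * enorm a * (`|t| * enorm w / s) `^ (p - 1).
  rewrite powRM ?mulr_ge0 ?enorm_ge0 ?invr_ge0 ?(ltW s0)// powRM ?enorm_ge0//.
  rewrite -[s^-1]powR_inv1 ?(ltW s0)// -powRrM mulN1r opprB -wp1.
  rewrite (_ : p * enorm a * _ = enorm w `^ (p - 2) *
    (p * `|t| `^ (p - 1) * s `^ (1 - p) * (enorm w * enorm a))); last by ring.
  rewrite ler_wpM2l ?powR_ge0//; apply: (le_trans (ler_norm _)).
  rewrite !normrM (ger0_norm (powR_ge0 _ _)) (ger0_norm (powR_ge0 s _)).
  rewrite (ger0_norm (_ : 0 <= p)); last by lra.
  apply: ler_pM => //; rewrite ?mulr_ge0 ?powR_ge0//; first by lra.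
    rewrite ler_wpM2r ?powR_ge0// ler_piMr ?mulr_ge0 ?powR_ge0//; first by lra.
    by rewrite normr_sg; case: (t != 0).
  exact: dotR_CauchySchwarz.
have := @powR_young (enorm a) (`|t| * enorm w / s) p (enorm_ge0 a).
rewrite divr_ge0 ?mulr_ge0 ?enorm_ge0 ?(ltW s0)// => /(_ isT p1); lra.
Qed.

End real_powers.

(** * Bounded C^1 continuation of a negative power *)

Section truncated_power.
Variable R : realType.

Lemma powRN_anti (r s t : R) : 0 <= r -> 0 < s -> s <= t -> t `^ (- r) <= s `^ (- r).
Proof.
move=> r0 s0 st; rewrite !powRN lef_pV2 ?posrE ?powR_gt0//; last exact: lt_le_trans st.
by apply: ge0_ler_powR => //; rewrite nnegrE ltW//; exact: lt_le_trans st.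
Qed.

(* A C^1 extension of [t + 2 e] from [t >= 0] to the line, bounded below by [e]. *)
Definition soft_shift (e t : R) : R := 2 * e + t / (1 + (`|t| - t) / (2 * e)).
Definition dsoft_shift (e t : R) : R := ((1 + (`|t| - t) / (2 * e))^-1) ^+ 2.

Lemma soft_shift_pos (e t : R) : 0 < e -> 0 <= t ->
  soft_shift e t = t + 2 * e /\ dsoft_shift e t = 1.
Proof.
move=> e0 t0; rewrite /soft_shift /dsoft_shift ger0_norm// subrr mul0r addr0 invr1.
by rewrite mulr1 addrC expr1n.
Qed.

Lemma soft_shift_neg (e t : R) : 0 < e -> t < 0 ->
  soft_shift e t = e + e ^+ 2 * (e - t)^-1 /\
  dsoft_shift e t = e ^+ 2 * (e - t) ^- 2.
Proof.
move=> e0 t0; rewrite /soft_shift /dsoft_shift ltr0_norm//.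
have et : 0 < e - t by lra.
have en0 : e != 0 by rewrite gt_eqF.
have etn0 : e - t != 0 by rewrite gt_eqF.
have -> : 1 + (- t - t) / (2 * e) = (e - t) / e by field.
by split; field; rewrite ?en0 ?etn0.
Qed.

Lemma soft_shift_ge (e t : R) : 0 < e -> e <= soft_shift e t.
Proof.
move=> e0; have [t0|t0] := leP 0 t; first by have [-> _] := soft_shift_pos e0 t0; lra.
have [-> _] := soft_shift_neg e0 t0.
by rewrite lerDl mulr_ge0 ?sqr_ge0// invr_ge0; lra.
Qed.

Lemma dsoft_shift_bound (e t : R) : 0 < e -> 0 <= dsoft_shift e t <= 1.
Proof.
move=> e0; rewrite /dsoft_shift sqr_ge0/=.
have m0 : 0 <= (`|t| - t) / (2 * e).
  by rewrite divr_ge0 ?mulr_ge0 ?(ltW e0)// subr_ge0 ler_norm.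
apply: exprn_ile1; first by rewrite invr_ge0; lra.
by rewrite invf_le1; lra.
Qed.

Lemma soft_shift_derive (e t : R) : 0 < e ->
  is_derive t (1 : R) (soft_shift e) (dsoft_shift e t).
Proof.
move=> e0; have [t0|t0|->] := ltgtP t 0.
- have [_ ->] := soft_shift_neg e0 t0.
  apply: (@near_eq_is_derive _ _ _ (fun s : R => e + e ^+ 2 * (e - s)^-1)).
    near=> s; have s0 : s < 0 by near: s; exact: lt_nbhsl.
    by have [-> _] := soft_shift_neg e0 s0.
  have et : e - t != 0 by rewrite gt_eqF//; lra.
  have d1 : is_derive t (1 : R) (fun s : R => e - s) (- 1).
    have := is_deriveB (is_derive_cst e t (1 : R)) (is_derive_id t (1 : R)).
    by rewrite sub0r.
  have d2 := @is_deriveV R (fun s => e - s) t _ _ et d1.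
  have d3 := is_deriveD (is_derive_cst e t (1 : R))
    (is_deriveM (is_derive_cst (e ^+ 2) t (1 : R)) d2).
  apply: (is_derive_eq d3); rewrite scaler0 addr0 add0r /cst /=.
  rewrite -[X in X = _]/(e ^+ 2 * (- (e - t) ^- 2 * - 1)); ring.
- have [_ ->] := soft_shift_pos e0 (ltW t0).
  apply: (@near_eq_is_derive _ _ _ (fun s : R => s + 2 * e)).
    near=> s; have s0 : 0 < s by near: s; exact: lt_nbhsr.
    by have [-> _] := soft_shift_pos e0 (ltW s0).
  have := is_deriveD (is_derive_id t (1 : R)) (is_derive_cst (2 * e) t (1 : R)).
  by rewrite addr0.
have [f0 ->] := soft_shift_pos e0 (lexx 0).
apply: eps_is_derive => d d0.
apply/nbhs_ballP; exists (d * e) => /=; first by rewrite mulr_gt0.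
move=> h; rewrite /ball/= sub0r normrN => he.
rewrite [h *: 1]mulr1 addr0 f0.
have [h0|h0] := leP 0 h.
  have [-> _] := soft_shift_pos e0 h0.
  by rewrite add0r addrK subrr normr0 mulr_ge0// ltW.
have [-> _] := soft_shift_neg e0 h0.
have eh : 0 < e - h by lra.
rewrite (_ : _ - _ = h ^+ 2 / (e - h)); last by field; rewrite gt_eqF.
rewrite normrM normfV (gtr0_norm eh) ler_pdivrMr// normrX expr2 mulrAC.
rewrite ler_wpM2r//; apply: (le_trans (ltW he)); rewrite ler_wpM2l ?(ltW d0)//; lra.
Unshelve. all: by end_near. Qed.

Lemma dsoft_shift_continuous (e : R) : 0 < e -> continuous (dsoft_shift e).
Proof.
move=> e0 t.
pose m (s : R) := 1 + (`|s| - s) / (2 * e).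
have cm : continuous m.
  move=> s.
  have c1 : {for s, continuous (fun s : R => `|s| - s)}.
    exact: (continuousB (@norm_continuous _ _ s) (@cvg_id _ (nbhs s))).
  have c2 : {for s, continuous (fun s : R => (`|s| - s) / (2 * e))}.
    exact: (continuousM c1 (@cst_continuous _ _ (2 * e)^-1 s)).
  have c3 : {for s, continuous (fun _ : R => 1 : R)} by exact: cst_continuous.
  exact: (continuousD c3 c2).
have m0 : m t != 0.
  rewrite gt_eqF// /m ltr_pwDl// divr_ge0 ?mulr_ge0 ?(ltW e0)// subr_ge0.
  exact: ler_norm.
have cV : {for t, continuous (fun s => (m s)^-1)}.
  by apply: continuousV => //; exact: cm.
exact: (continuousM cV cV).
Qed.

(** The approximants of [v] may be negative, so (t + 2e)^(1-p) is continued to the whole line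
    through [soft_shift]. The lower bound [e] of the latter makes [F] and [F'] bounded: the first
    summand of [M] bounds [F], the second [F']. *)
Lemma exists_truncated_power (p e : R) : 1 < p -> 0 < e ->
  exists F F' : R -> R, exists2 M : R,
   [/\ forall t, is_derive t (1 : R) F (F' t), continuous F', forall t, 0 <= F t,
       forall t, F t <= M & forall t, `|F' t| <= M] &
   forall t, 0 <= t -> F t = (t + 2 * e) `^ (1 - p) /\
                       F' t = (1 - p) * (t + 2 * e) `^ (- p).
Proof.
move=> p1 e0.
pose h := soft_shift e; pose h' := dsoft_shift e.
have h0 t : 0 < h t by apply: lt_le_trans (soft_shift_ge t e0).
have dh t : is_derive t (1 : R) h (h' t) by exact: soft_shift_derive.
have ch : continuous h by move=> t; exact: is_derive_cvg_continuous (dh t).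
exists (fun t => h t `^ (1 - p)), (fun t => (1 - p) * h t `^ (- p) * h' t).
have M1 : 0 <= (p - 1) * e `^ (- p) by rewrite mulr_ge0 ?powR_ge0//; lra.
exists (e `^ (1 - p) + (p - 1) * e `^ (- p)); first split.
- move=> t; have d1 := is_derive1_powR (1 - p) (h0 t).
  have := @is_derive1_comp R (fun s : R => s `^ (1 - p)) h t _ _ d1 (dh t).
  by rewrite (_ : 1 - p - 1 = - p)//; ring.
- move=> t.
  apply: (@continuousM _ _ (fun t => (1 - p) * h t `^ (- p)) h'); last exact: dsoft_shift_continuous.
  apply: (@continuousM _ _ (fun=> 1 - p) (fun t => h t `^ (- p))); first exact: cst_continuous.
  apply: (@continuous_comp _ _ _ h (fun s : R => s `^ (- p))); first exact: ch.
  exact: is_derive_cvg_continuous (is_derive1_powR _ (h0 t)).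
- by move=> t; exact: powR_ge0.
- move=> t; apply: ler_wpDr => //; rewrite -[1 - p]opprB.
  by apply: powRN_anti => //; [lra|exact: soft_shift_ge].
- move=> t; apply: ler_wpDl; first exact: powR_ge0.
  have /andP[d0 d1] := dsoft_shift_bound t e0.
  rewrite normrM [X in X * _]normrM (ger0_norm (powR_ge0 _ _)).
  rewrite (ger0_norm (d0 : 0 <= h' t)) distrC.
  rewrite (ger0_norm (_ : 0 <= p - 1)); last by lra.
  rewrite -mulrA ler_wpM2l//; first by lra.
  apply: (@le_trans _ _ (h t `^ (- p))); first by rewrite ler_piMr// powR_ge0.
  by apply: powRN_anti => //; [lra|exact: soft_shift_ge].
move=> t t0; have [ht h't] := soft_shift_pos e0 t0.
by rewrite /h /h' ht h't mulr1.
Qed.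

End truncated_power.

(** * Approximation in the Sobolev space *)

Section vector_measurability.
Context d (T : measurableType d) (R : realType) (D : set T) (n : nat).
Implicit Types f g : T -> 'rV[R]_n.

Lemma measurable_fun_coord f i : measurable_fun D f ->
  measurable_fun D (fun x => f x ord0 i).
Proof.
move=> mf; apply: (@measurableT_comp _ _ _ _ _ _ (fun y : 'rV[R]_n => y ord0 i)) => //.
exact: measurable_coord.
Qed.

Lemma measurable_fun_dotR f g :
  (forall i, measurable_fun D (fun x => f x ord0 i)) ->
  (forall i, measurable_fun D (fun x => g x ord0 i)) ->
  measurable_fun D (fun x => dotR (f x) (g x)).
Proof. by move=> mf mg; apply: measurable_sum => i; exact: measurable_funM. Qed.

Lemma measurable_fun_enorm f :
  (forall i, measurable_fun D (fun x => f x ord0 i)) ->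
  measurable_fun D (fun x => enorm (f x)).
Proof.
move=> mf; rewrite (_ : (fun x => _) = (fun x => dotR (f x) (f x) `^ 2^-1)).
  apply: (@measurableT_comp _ _ _ _ _ _ (fun y : R => y `^ 2^-1)) => //.
  exact: measurable_fun_dotR.
by apply/funext => x; rewrite powR12_sqrt// dotR_ge0.
Qed.

Lemma measurable_fun_powR (f : T -> R) p : measurable_fun D f ->
  measurable_fun D (fun x => f x `^ p).
Proof.
by move=> mf; apply: (@measurableT_comp _ _ _ _ _ _ (fun y : R => y `^ p)).
Qed.

Lemma measurable_fun_normr (f : T -> R) : measurable_fun D f ->
  measurable_fun D (fun x => `|f x|).
Proof. by move=> mf; exact: measurableT_comp. Qed.

End vector_measurability.

Section dominating_series.
Context d (T : measurableType d) (R : realType) (mu : {measure set T -> \bar R}).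
Variables (D : set T) (mD : measurable D).

(** The sum [g] of the series has integral at most 1, hence is finite almost everywhere; it
    dominates each term, and a convergent series has terms tending to 0. *)
Lemma summable_dominated (a : nat -> T -> R) :
  (forall n, measurable_fun D (a n)) -> (forall n x, 0 <= a n x) ->
  (forall n, (\int[mu]_(x in D) (a n x)%:E <= (1 / (2 ^ n.+1)%:R)%:E)%E) ->
  exists g : T -> \bar R, [/\ mu.-integrable D g,
    forall n x, ((a n x)%:E <= g x)%E &
    {ae mu, forall x, D x -> a n x @[n --> \oo] --> (0 : R)}].
Proof.
move=> ma a0 Ia.
pose g x := (\sum_(0 <= n <oo) (a n x)%:E)%E.
have g0 x : (0 <= g x)%E by apply: nneseries_ge0 => n _ _; rewrite lee_fin.
have mg : measurable_fun D g.
  apply: ge0_emeasurable_sum => [n x _ _|n _]; first by rewrite lee_fin.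
  exact/measurable_EFinP.
have Ig : mu.-integrable D g.
  apply/integrableP; split => //.
  under eq_integral do rewrite gee0_abs//.
  rewrite integral_nneseries//; last 2 first.
  - by move=> n; exact/measurable_EFinP.
  - by move=> n x _; rewrite lee_fin.
  apply: (@le_lt_trans _ _ 1%:E); last exact: ltry.
  apply: (@le_trans _ _ (\sum_(0 <= n <oo) (1 / (2 ^ n.+1)%:R)%:E)%E).
    apply: lee_nneseries => [n _ _|n _]; last exact: Ia.
    by apply: integral_ge0 => x _; rewrite lee_fin.
  exact: epsilon_trick0.
exists g; split => //.
  move=> n x; apply: (@le_trans _ _ (\sum_(0 <= i < n.+1) (a i x)%:E)%E); last first.
    by apply: nneseries_lim_ge => i _ _; rewrite lee_fin.
  rewrite big_nat_recr//= leeDr//.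
  by apply: sume_ge0 => i _; rewrite lee_fin.
have [N [mN N0 sN]] := integrable_ae mD Ig.
exists N; split => //; apply: subset_trans sN; apply: subsetC => x /= gfin Dx.
apply: cvg_series_cvg_0; apply: nondecreasing_is_cvgn.
  by apply: nondecreasing_series => n _ _.
exists (fine (g x)) => _ [n _ <-].
rewrite -lee_fin fineK; last exact: gfin.
rewrite /series /= -sumEFin; apply: nneseries_lim_ge => i _ _; by rewrite lee_fin.
Qed.

End dominating_series.

Section Lp_convergence.
Variables (R : realType) (ns : seq nat).
Local Notation V := 'rV[R]_(sumn ns).
Local Notation mu := (@lebesgue_rV R (sumn ns)).

Lemma Lp_norm_cvg0 (Omega : set V) (p : R) (w : nat -> V -> R) : 1 < p ->
  Lp_norm Omega p (w n) @[n --> \oo] --> 0%E ->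
  forall e : R, 0 < e -> \forall n \near \oo,
    (\int[mu]_(x in Omega) (`|w n x| `^ p)%:E <= e%:E)%E.
Proof.
move=> p1 cw e e0.
have p0 : 0 < p by lra.
have ep0 : 0 < e `^ p^-1 by rewrite powR_gt0.
have nb : nbhs 0%E [set y : \bar R | (y < (e `^ p^-1)%:E)%E].
  by apply: open_nbhs_nbhs; split; [exact: open_ereal_lt_ereal|rewrite /= lte_fin].
have nearn : \forall n \near \oo, (Lp_norm Omega p (w n) < (e `^ p^-1)%:E)%E := cw _ nb.
near=> n.
have h : (Lp_norm Omega p (w n) < (e `^ p^-1)%:E)%E by near: n.
rewrite leNgt; apply/negP => h'.
move: h; rewrite ltNge => /negP; apply.
rewrite /Lp_norm -poweR_EFin; apply: gt0_ler_poweR => //.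
- by rewrite invr_ge0 ltW.
- by rewrite in_itv/= leey lee_fin ltW.
- rewrite in_itv/= leey andbT; apply: integral_ge0 => x _.
  by rewrite lee_fin powR_ge0.
- exact: ltW.
Unshelve. all: by end_near. Qed.

End Lp_convergence.

Section sobolev.
Variables (R : realType) (ns : seq nat) (G : stratified_group R ns).
Local Notation V := 'rV[R]_(sumn ns).
Local Notation H := 'rV[R]_(head 0%N ns).
Local Notation mu := (@lebesgue_rV R (sumn ns)).
Variables (Omega : set V) (p : R).
Hypotheses (p1 : 1 < p) (bO : bounded_set Omega) (oO : open Omega).

Let mO : measurable Omega. Proof. exact: rV_open_measurable. Qed.

Lemma bounded_open_finite : (mu Omega < +oo)%E.
Proof.
have [r r0 Or] := rV_bounded_sub_cbox bO.
apply: le_lt_trans (@rV_cbox_finite R (sumn ns) r); apply: le_measure; rewrite ?inE//.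
exact: rV_cbox_measurable.
Qed.

Lemma C10_measurable phi Dphi : C10 G Omega phi Dphi ->
  measurable_fun Omega phi /\ measurable_fun Omega Dphi.
Proof.
move=> [cphi _ cD _]; split; apply: (@measurable_funS _ _ _ _ setT) => //.
  exact: rV_continuous_measurable.
apply: measurable_rVP => i; apply: rV_continuous_measurable => x.
apply: (@continuous_comp _ _ _ Dphi (fun y : H => y ord0 i)); first exact: cD.
exact: coord_continuous.
Qed.

Lemma continuous_bounded_on (f : V -> R) : continuous f ->
  exists2 M : R, 0 <= M & forall x, Omega x -> `|f x| <= M.
Proof.
move=> cf; have [r r0 Or] := rV_bounded_sub_cbox bO.
have cfr : {within rV_cbox r, continuous f} by exact: continuous_subspaceT.
have /compact_bounded[M [Mr hM]] := continuous_compact cfr (@rV_cbox_compact R _ r).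
exists (`|M| + 1); first by rewrite addr_ge0.
move=> x /Or xr; apply: hM; last by exists x.
by rewrite ltr_pwDr// ler_norm.
Qed.

Lemma C10_bounded phi Dphi : C10 G Omega phi Dphi ->
  exists2 M : R, 0 <= M & forall x, Omega x -> `|phi x| <= M /\ enorm (Dphi x) <= M.
Proof.
move=> [cphi _ cD _].
have [M1 M10 h1] := continuous_bounded_on cphi.
have cDk k : continuous (fun y => Dphi y ord0 k).
  move=> x; apply: (@continuous_comp _ _ _ Dphi (fun y : H => y ord0 k)); first exact: cD.
  exact: coord_continuous.
have /choice[M2 h2] : forall k : 'I_(head 0%N ns), exists M, 0 <= M /\
    forall x, Omega x -> `|Dphi x ord0 k| <= M.
  by move=> k; have [M M0 h] := continuous_bounded_on (cDk k); exists M.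
pose S := \sum_k M2 k.
have S0 : 0 <= S by apply: sumr_ge0 => k _; have [] := h2 k.
exists (M1 + (head 0%N ns)%:R * S); first by rewrite addr_ge0// mulr_ge0.
move=> x Ox; split.
  by apply: (le_trans (h1 x Ox)); rewrite lerDl mulr_ge0.
apply: (@le_trans _ _ ((head 0%N ns)%:R * S)); last by rewrite lerDr.
apply: enorm_le_sum => // k; have [_ /(_ x Ox) hk] := h2 k; apply: (le_trans hk).
rewrite /S (bigD1 k)//= lerDl; apply: sumr_ge0 => j _; by have [] := h2 j.
Qed.

(** Norm convergence alone gives no common majorant, but a subsequence with summable errors does.
    The errors of the functions and of the gradients are added so that one [g] serves both. *)
Lemma S1p0_fast_approx u Du : S1p0 G Omega p u Du ->
  exists phi Dphi (g : V -> \bar R), [/\ forall n : nat, C10 G Omega (phi n) (Dphi n),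
    mu.-integrable Omega g,
    forall n x, ((`|phi n x - u x| `^ p)%:E <= g x)%E /\
                ((enorm (Dphi n x - Du x) `^ p)%:E <= g x)%E &
    {ae mu, forall x, Omega x -> phi n x @[n --> \oo] --> u x /\
       enorm (Dphi n x - Du x) @[n --> \oo] --> (0 : R)}].
Proof.
move=> [mu_ mDu [phi [Dphi [C cphi cDphi]]]].
have p0 : 0 < p := lt_trans ltr01 p1.
(* Half of the bound asked by [summable_dominated], since [a n] is a sum of two errors. *)
pose e n : R := 1 / (2 ^ n.+2)%:R.
have e0 n : 0 < e n by rewrite /e divr_gt0// ltr0n expn_gt0.
have /choice[s hs] : forall n, exists k,
    (\int[mu]_(x in Omega) (`|phi k x - u x| `^ p)%:E <= (e n)%:E)%E /\
    (\int[mu]_(x in Omega) (`|enorm (Dphi k x - Du x)| `^ p)%:E <= (e n)%:E)%E.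
  move=> n.
  have n1 := Lp_norm_cvg0 p1 cphi (e0 n).
  have n2 := Lp_norm_cvg0 p1 cDphi (e0 n).
  have [N1 _ h1] := n1; have [N2 _ h2] := n2; exists (maxn N1 N2); split.
    by apply: h1; exact: leq_maxl.
  by apply: h2; exact: leq_maxr.
pose a n x := `|phi (s n) x - u x| `^ p + enorm (Dphi (s n) x - Du x) `^ p.
have ma1 n : measurable_fun Omega (fun x => `|phi (s n) x - u x| `^ p).
  have [m1 m2] := C10_measurable (C (s n)).
  by apply/measurable_fun_powR/measurable_fun_normr/measurable_funB.
have ma2 n : measurable_fun Omega (fun x => enorm (Dphi (s n) x - Du x) `^ p).
  have [m1 m2] := C10_measurable (C (s n)).
  apply/measurable_fun_powR/measurable_fun_enorm.
  move=> i; rewrite (_ : (fun x => _) = (fun x => Dphi (s n) x ord0 i - Du x ord0 i)).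
    by apply: measurable_funB; exact: measurable_fun_coord.
  by apply/funext => x; rewrite !mxE.
have ma n : measurable_fun Omega (a n) by exact: measurable_funD.
have a0 n x : 0 <= a n x by rewrite addr_ge0 ?powR_ge0.
have [|g [Ig ag ca]] := summable_dominated (mu := mu) mO ma a0.
  move=> n.
  have -> : (\int[mu]_(x in Omega) (a n x)%:E =
      \int[mu]_(x in Omega) (`|phi (s n) x - u x| `^ p)%:E +
      \int[mu]_(x in Omega) (enorm (Dphi (s n) x - Du x) `^ p)%:E)%E.
    under eq_integral do rewrite EFinD.
    apply: ge0_integralD => //; try exact/measurable_EFinP.
    by move=> x _; rewrite lee_fin powR_ge0.
  have [h1 h2] := hs n.
  have {}h2 : (\int[mu]_(x in Omega) (enorm (Dphi (s n) x - Du x) `^ p)%:E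
      <= (e n)%:E)%E.
    by apply: le_trans h2; under [leRHS]eq_integral do rewrite (ger0_norm (enorm_ge0 _)).
  have -> : (1 / (2 ^ n.+1)%:R)%:E = ((e n)%:E + (e n)%:E)%E :> \bar R.
    have X0 : (2 ^ n.+1)%:R != 0 :> R by rewrite pnatr_eq0 expn_eq0.
    rewrite -EFinD /e (expnS 2 n.+1) natrM; congr EFin.
    by move: X0; move: (_%:R) => X X0; field.
  exact: leeD.
exists (fun n => phi (s n)), (fun n => Dphi (s n)), g; split => //.
- move=> n x; split; apply: le_trans (ag n x); rewrite lee_fin.
    by rewrite lerDl powR_ge0.
  by rewrite lerDr powR_ge0.
have p'0 : 0 < p^-1 by rewrite invr_gt0.
have cvg0 (b : nat -> R) : (forall n, 0 <= b n) ->
    b n `^ p @[n --> \oo] --> (0 : R) -> b n @[n --> \oo] --> (0 : R).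
  move=> b0 cb; have cn : `|t| `^ p^-1 @[t --> (0 : R)] --> (0 : R).
    have := @norm_powR_continuous R p^-1 p'0 0.
    by rewrite /continuous_at /= normr0 powR0 ?gt_eqF.
  have := cvg_comp _ _ cb cn; apply: cvg_trans; apply: near_eq_cvg.
  apply: nearW => n /=; rewrite ger0_norm ?powR_ge0// -powRrM mulfV ?gt_eqF//.
  by rewrite powRr1.
apply: filterS ca => x ca Ox; have {ca}ca := ca Ox.
have c1 : `|phi (s n) x - u x| `^ p @[n --> \oo] --> (0 : R).
  apply: (@squeeze_cvgr _ _ _ _ (fun=> 0) (fun n => a n x)) => //.
    by apply: nearW => n; rewrite powR_ge0/= lerDl powR_ge0.
  exact: cvg_cst.
have c2 : enorm (Dphi (s n) x - Du x) `^ p @[n --> \oo] --> (0 : R).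
  apply: (@squeeze_cvgr _ _ _ _ (fun=> 0) (fun n => a n x)) => //.
    by apply: nearW => n; rewrite powR_ge0/= lerDr powR_ge0.
  exact: cvg_cst.
split; last by apply: cvg0 => // n; exact: enorm_ge0.
by apply/subr_cvg0; apply: norm_cvg0; apply: cvg0.
Unshelve. all: by end_near. Qed.

End sobolev.

(** * The weak form and Picone's inequality *)

Section integral_comparison.
Import HBNNSimple.
Context d (T : measurableType d) (R : realType) (mu : {measure set T -> \bar R}).
Variables (D : set T) (mD : measurable D).

(* No measurability of [f]: a simple function below [f^\+] is measurable and lies
   a.e. below [g]. *)
Lemma ae_le_integral_majorant (f g : T -> \bar R) :
  (forall x, D x -> (0 <= g x)%E) -> measurable_fun D g ->
  {ae mu, forall x, D x -> (f x <= g x)%E} ->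
  (\int[mu]_(x in D) f x <= \int[mu]_(x in D) g x)%E.
Proof.
move=> g0 mg fg; rewrite /(integral mu D f).
set B := ereal_sup _; set C := ereal_sup _.
have C0 : (0 <= C)%E.
  apply: ereal_sup_ubound; exists nnsfun0 => //=; last exact: sintegral0.
  by move=> x; rewrite funenegE le_max lexx orbT.
(* [C] is the integral of the negative part; dropping it does not decrease the left side. *)
apply: (@le_trans _ _ B); first by rewrite -[leRHS]sube0 leeB.
rewrite /B; apply: ge_ereal_sup => _ [h /= hf <-].
rewrite -integralT_nnsfun integral_mkcond [leRHS]integral_mkcond !patch_setT.
apply: ae_ge0_le_integral => //.
- by move=> x _; rewrite lee_fin; exact: fun_ge0.
- exact/measurable_EFinP.
- by move=> x _; rewrite /patch; case: ifPn => // /set_mem; exact: g0.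
- exact/(measurable_restrictT g mD).
apply: filterS fg => x fg _; apply: (le_trans (hf x)); rewrite funeposE ge_max.
by rewrite /patch; case: ifPn => [/set_mem Dx|_]; rewrite ?lexx// fg// g0.
Qed.

Lemma dominated_le_integral (a b : nat -> T -> R) (a' b' : T -> R) (g : T -> \bar R) :
  (forall n, measurable_fun D (a n)) -> (forall n, measurable_fun D (b n)) ->
  measurable_fun D a' -> measurable_fun D b' -> mu.-integrable D g ->
  {ae mu, forall x, D x -> a n x @[n --> \oo] --> a' x /\ b n x @[n --> \oo] --> b' x} ->
  {ae mu, forall x, D x -> forall n, (`|a n x|%:E <= g x)%E /\ (`|b n x|%:E <= g x)%E} ->
  (forall n, (\int[mu]_(x in D) (a n x)%:E <= \int[mu]_(x in D) (b n x)%:E)%E) ->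
  (\int[mu]_(x in D) (a' x)%:E <= \int[mu]_(x in D) (b' x)%:E)%E.
Proof.
move=> ma mb ma' mb' Ig cab gab Iab.
have [|||||_ _ ca] := @dominated_convergence _ _ _ mu D mD (fun n x => (a n x)%:E)
    (fun x => (a' x)%:E) g.
- by move=> n; exact/measurable_EFinP.
- exact/measurable_EFinP.
- by apply: filterS cab => x h /h[h1 _]; exact: cvg_EFin (nearW _ _) h1.
- exact: Ig.
- by apply: filterS gab => x h n /h/(_ n)[].
have [|||||_ _ cb] := @dominated_convergence _ _ _ mu D mD (fun n x => (b n x)%:E)
    (fun x => (b' x)%:E) g.
- by move=> n; exact/measurable_EFinP.
- exact/measurable_EFinP.
- by apply: filterS cab => x h /h[_ h1]; exact: cvg_EFin (nearW _ _) h1.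
- exact: Ig.
- by apply: filterS gab => x h n /h/(_ n)[].
by apply: (lee_cvg_to ca cb); exact: nearW.
Qed.

Lemma le_fun_integrable (f g : T -> \bar R) : measurable_fun D f ->
  (forall x, D x -> (0 <= f x)%E) -> (forall x, D x -> (f x <= g x)%E) ->
  mu.-integrable D g -> mu.-integrable D f.
Proof.
move=> mf f0 fg; apply: le_integrable => // x Dx.
by rewrite !gee0_abs ?(le_trans (f0 x Dx)) ?f0 ?fg.
Qed.

End integral_comparison.

Section flux.
Variables (R : realType) (n : nat).
Implicit Types w a : 'rV[R]_n.

Definition flux p w a : R := enorm w `^ (p - 2) * dotR w a.

Lemma enormZ (c : R) a : enorm (c *: a) = `|c| * enorm a.
Proof.
by rewrite /enorm dotRZr dotRC dotRZr mulrA -expr2 sqrtrM ?sqr_ge0// sqrtr_sqr.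
Qed.

(** Cauchy-Schwarz; at [w = 0] the scalar product vanishes, so exponents below 2 cause no
    singularity. *)
Lemma flux_le (p : R) w a : 1 < p -> `|flux p w a| <= enorm w `^ (p - 1) * enorm a.
Proof.
move=> p1; rewrite /flux normrM ger0_norm ?powR_ge0//.
have [w0|w0] := eqVneq (enorm w) 0.
  rewrite (enorm_eq0 w0) [X in `|X|](_ : _ = 0); last first.
    by rewrite /dotR big1// => i _; rewrite mxE mul0r.
  by rewrite normr0 mulr0 mulr_ge0 ?powR_ge0 ?enorm_ge0.
have -> : enorm w `^ (p - 1) = enorm w `^ (p - 2) * enorm w.
  rewrite -[X in _ = _ * X]powRr1 ?enorm_ge0// -powRD; last by rewrite w0 implybT.
  by congr (_ `^ _); ring.
by rewrite -mulrA ler_wpM2l ?powR_ge0// dotR_CauchySchwarz.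
Qed.

Lemma flux_cvg (p : R) w a (b : nat -> 'rV[R]_n) :
  (forall i, b k ord0 i @[k --> \oo] --> a ord0 i) ->
  flux p w (b k) @[k --> \oo] --> flux p w a.
Proof.
move=> ba; apply: cvgMr; rewrite /dotR.
by apply: cvg_big => [|i _]; [exact: add_continuous|apply: cvgMr].
Qed.

Lemma enorm_cvg_coord a (b : nat -> 'rV[R]_n) i :
  enorm (b k - a) @[k --> \oo] --> (0 : R) -> b k ord0 i @[k --> \oo] --> a ord0 i.
Proof.
move=> ba; apply/subr_cvg0; apply: norm_cvg0.
apply: (@squeeze_cvgr _ _ _ _ (fun=> 0) (fun k => enorm (b k - a))) => //.
  apply: nearW => k; rewrite normr_ge0/=.
  by have := coord_le_enorm (b k - a) i; rewrite !mxE.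
exact: cvg_cst.
Qed.

Lemma enorm_cvg a (b : nat -> 'rV[R]_n) :
  enorm (b k - a) @[k --> \oo] --> (0 : R) -> enorm (b k) @[k --> \oo] --> enorm a.
Proof.
move=> ba; apply/subr_cvg0; apply: norm_cvg0.
apply: (@squeeze_cvgr _ _ _ _ (fun=> 0) (fun k => enorm (b k - a))) => //.
  by apply: nearW => k; rewrite normr_ge0/= enorm_dist.
exact: cvg_cst.
Qed.

End flux.

(** * Extension of the weak equation to C^1_0 test functions *)

Section weak_form.
Variables (R : realType) (ns : seq nat) (G : stratified_group R ns).
Local Notation V := 'rV[R]_(sumn ns).
Local Notation H := 'rV[R]_(head 0%N ns).
Local Notation mu := (@lebesgue_rV R (sumn ns)).
Variables (Omega : set V) (p : R).
Hypotheses (p1 : 1 < p) (bO : bounded_set Omega) (oO : open Omega).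

Let mO : measurable Omega. Proof. exact: rV_open_measurable. Qed.

Lemma integrable_cst (k : R) : mu.-integrable Omega (fun=> k%:E).
Proof.
apply: (@measurable_bounded_integrable _ _ _ mu (cst k)) => //.
  exact: bounded_open_finite.
by exists `|k|; split => // M kM x _ /=; rewrite ltW.
Qed.

(** [u] differs from the bounded function [phi 0] by an error whose p-th power lies below the
    integrable [g], and likewise for the gradients; constants are integrable on [Omega]. *)
Lemma S1p0_integrable u Du : S1p0 G Omega p u Du ->
  mu.-integrable Omega (fun x => (`|u x| `^ p)%:E) /\
  mu.-integrable Omega (fun x => (enorm (Du x) `^ p)%:E).
Proof.
move=> hu; have [mu_ mDu _] := hu.
have [phi [Dphi [g [Cn Ig hg _]]]] := S1p0_fast_approx p1 oO hu.
have [M M0 hM] := C10_bounded bO (Cn 0).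
have Ib : mu.-integrable Omega (fun x => (2 `^ p)%:E * (g x + (M `^ p)%:E))%E.
  by apply: integrableZl => //; apply: integrableD => //; exact: integrable_cst.
split; apply: le_fun_integrable Ib => //.
- exact/measurable_EFinP/measurable_fun_powR/measurable_fun_normr.
- move=> x Ox; have [h1 _] := hg 0%N x; have [h2 _] := hM x Ox.
  apply: (@le_trans _ _ (2 `^ p * (`|phi 0%N x - u x| `^ p + M `^ p))%:E); last first.
    by rewrite EFinM lee_wpmul2l ?lee_fin ?powR_ge0// EFinD leeD.
  have p0 : 0 <= p := ltW (lt_trans ltr01 p1).
  rewrite lee_fin; apply: le_trans (powR_add_le _ M0 p0) => //.
  apply: ge0_ler_powR; rewrite ?nnegrE ?addr_ge0//.
  have := ler_normB (phi 0%N x) (phi 0%N x - u x).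
  by rewrite opprB addrC subrK; lra.
- apply/measurable_EFinP/measurable_fun_powR/measurable_fun_enorm => i.
  exact: measurable_fun_coord.
- by move=> x _; rewrite lee_fin powR_ge0.
- move=> x Ox; have [_ h1] := hg 0%N x; have [_ h2] := hM x Ox.
  apply: (@le_trans _ _ (2 `^ p * (enorm (Dphi 0%N x - Du x) `^ p + M `^ p))%:E); last first.
    by rewrite EFinM lee_wpmul2l ?lee_fin ?powR_ge0// EFinD leeD.
  have p0 : 0 <= p := ltW (lt_trans ltr01 p1).
  rewrite lee_fin; apply: le_trans (powR_add_le (enorm_ge0 _) M0 p0).
  apply: ge0_ler_powR; rewrite ?nnegrE ?addr_ge0 ?enorm_ge0//.
  have := enorm_dist (Dphi 0%N x) (Du x); rewrite ler_norml => /andP[h3 _].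
  lra.
Qed.

(** The gradient comes from the product and chain rules along integral curves, valid at the zeros of
    [phi] because [p > 1]; the support is inherited from [phi]. *)
Lemma C10_picone_test (F F' : R -> R) phi Dphi w Dw :
  (forall t, is_derive t (1 : R) F (F' t)) -> continuous F' ->
  C10 G Omega phi Dphi -> C10 G Omega w Dw ->
  C10 G Omega (fun x => `|phi x| `^ p * F (w x))
    (fun x => (dnorm_powR p (phi x) * F (w x)) *: Dphi x +
              (`|phi x| `^ p * F' (w x)) *: Dw x).
Proof.
move=> dF cF' [cphi hphi cDphi [Kphi Sphi]] [cw hw cDw _].
have p0 : 0 < p := lt_trans ltr01 p1.
have cF : continuous F by move=> t; exact: is_derive_cvg_continuous (dF t).
have comp (h : V -> R) (k : R -> R) : continuous h -> continuous k ->
    continuous (fun x => k (h x)).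
  by move=> ch ck x; apply: continuous_comp; [exact: ch|exact: ck].
have c1 := comp _ _ cphi (norm_powR_continuous p0).
have c2 := comp _ _ cphi (dnorm_powR_continuous p1).
have c3 := comp _ _ cw cF.
have c4 := comp _ _ cw cF'.
have coord (f : V -> H) i : continuous f -> continuous (fun x => f x ord0 i).
  move=> cf x; apply: (@continuous_comp _ _ _ f (fun y : H => y ord0 i)); first exact: cf.
  exact: coord_continuous.
split.
- by move=> x; exact: (continuousM (c1 x) (c3 x)).
- move=> k gamma hgamma t; rewrite !mxE.
  have d1 := @is_derive1_comp R (fun s : R => `|s| `^ p) (phi \o gamma) t _ _
    (norm_powR_derive _ p1) (hphi k gamma hgamma t).
  have d2 := @is_derive1_comp R F (w \o gamma) t _ _ (dF _) (hw k gamma hgamma t).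
  apply: (is_derive_eq (is_deriveM d1 d2)) => /=; rewrite -[_ *: (_ : R)]/(_ * _) -[X in _ + X]/(_ * _) /=.
  ring.
- apply: continuous_rV => k x; rewrite (_ : (fun y => _) = (fun y =>
    dnorm_powR p (phi y) * F (w y) * Dphi y ord0 k +
    `|phi y| `^ p * F' (w y) * Dw y ord0 k)); last by apply/funext => y; rewrite !mxE.
  apply: (@continuousD _ _ _ (fun y => dnorm_powR p (phi y) * F (w y) * Dphi y ord0 k)
    (fun y => `|phi y| `^ p * F' (w y) * Dw y ord0 k)).
    exact: (continuousM (continuousM (c2 x) (c3 x)) (coord _ k cDphi x)).
  exact: (continuousM (continuousM (c1 x) (c4 x)) (coord _ k cDw x)).
- have sub : closure [set x | `|phi x| `^ p * F (w x) != 0] `<=`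
      closure [set x | phi x != 0].
    apply: closure_subset => x /=; apply: contra_neq => ->.
    by rewrite normr0 powR0 ?gt_eqF// mul0r.
  split; last exact: subset_trans sub Sphi.
  by apply: subclosed_compact Kphi sub; exact: closed_closure.
Qed.

Variables (v : V -> R) (Dv : V -> H) (Lpv : V -> R) (L : R).
Hypotheses (hv : S1p0 G Omega p v Dv) (hL : weak_p_sub_Laplacian G Omega p Dv Lpv).
Hypotheses (L0 : 0 <= L) (LpvL : {ae mu, forall x, Omega x -> `|Lpv x| <= L}).

Let mLpv : measurable_fun Omega (fun x => - Lpv x).
Proof. by have [[m _] _] := hL; exact: measurable_funN. Qed.

Let mDv i : measurable_fun Omega (fun x => Dv x ord0 i).
Proof. by have [_ m _] := hv; exact: measurable_fun_coord. Qed.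

Lemma measurable_flux (a : V -> H) : (forall i, measurable_fun Omega (fun x => a x ord0 i)) ->
  measurable_fun Omega (fun x => flux p (Dv x) (a x)).
Proof.
move=> ma; apply: measurable_funM; last exact: measurable_fun_dotR.
by apply: measurable_fun_powR; exact: measurable_fun_enorm.
Qed.

Lemma enorm_powB1_le (w : H) : enorm w `^ (p - 1) <= enorm w `^ p + 1.
Proof.
have := powR_mul_le (enorm_ge0 w) ler01 p1.
by rewrite mulr1 powR1.
Qed.

(** Smooth test functions approximate [psi] and its gradient uniformly on a cube containing [Omega];
    both sides converge by domination, the flux being linear in the test gradient and [Lpv]
    bounded. *)
Lemma weak_form_C10 psi Dpsi : C10 G Omega psi Dpsi ->
  (\int[mu]_(x in Omega) (flux p (Dv x) (Dpsi x))%:E =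
   \int[mu]_(x in Omega) (- Lpv x * psi x)%:E)%E.
Proof.
move=> Cpsi; have [M M0 hM] := C10_bounded bO Cpsi.
have [r r0 Or] := rV_bounded_sub_cbox bO.
have e0 (k : nat) : 0 < (k.+1%:R^-1 : R) by rewrite invr_gt0.
have /choice[a ha] : forall k : nat, exists a : (V -> R) * (V -> H),
    [/\ smooth a.1, compact_support_in Omega a.1, is_hgrad G a.1 a.2, continuous a.2
    & forall x, rV_cbox r x -> `|a.1 x - psi x| <= (k.+1%:R^-1 : R) /\
       forall i, `|a.2 x ord0 i - Dpsi x ord0 i| <= (k.+1%:R^-1 : R)].
  by move=> k; have [b [Db h]] := C10_smooth_approx r oO Cpsi (e0 k); exists (b, Db).
have Ca k : C10 G Omega (a k).1 (a k).2.
  by have [sa ? ? ? _] := ha k; split => //; exact: (sa 0%N).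
have wa k : (\int[mu]_(x in Omega) (flux p (Dv x) ((a k).2 x))%:E =
    \int[mu]_(x in Omega) (- Lpv x * (a k).1 x)%:E)%E.
  by have [sa ca ga _ _] := ha k; have [_ w] := hL; exact: w.
pose N : R := (head 0%N ns)%:R.
have inv1 (k : nat) : (k.+1%:R^-1 : R) <= 1 by rewrite invf_le1// ler1n.
have bnd k x : Omega x -> `|(a k).1 x| <= M + 1 /\ enorm ((a k).2 x) <= M + N.
  move=> Ox; have [_ _ _ _ /(_ _ (Or _ Ox))[h1 h2]] := ha k; have [h3 h4] := hM x Ox.
  split.
    rewrite -[(a k).1 x](subrK (psi x)) addrC; apply: (le_trans (ler_normD _ _)).
    by apply: lerD => //; exact: le_trans h1 (inv1 k).
  rewrite -[(a k).2 x](subrK (Dpsi x)) addrC; apply: (le_trans (enormD _ _)).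
  apply: lerD => //; rewrite /N -[X in _ <= X]mulr1; apply: enorm_le_sum => // i.
  by rewrite !mxE; exact: le_trans (h2 i) (inv1 k).
have cinv : (k.+1%:R^-1 : R) @[k --> \oo] --> (0 : R) by exact: cvg_harmonic.
have cv1 x : Omega x -> - Lpv x * (a k).1 x @[k --> \oo] --> - Lpv x * psi x.
  move=> Ox; apply: cvgMr; apply/subr_cvg0; apply: norm_cvg0.
  apply: (@squeeze_cvgr _ _ _ _ (fun=> 0) (fun k => k.+1%:R^-1)) => //; last exact: cvg_cst.
  apply: nearW => k; rewrite normr_ge0/=.
  by have [_ _ _ _ /(_ _ (Or _ Ox))[]] := ha k.
have cv2 x : Omega x ->
    flux p (Dv x) ((a k).2 x) @[k --> \oo] --> flux p (Dv x) (Dpsi x).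
  move=> Ox; apply: flux_cvg => i; apply/subr_cvg0; apply: norm_cvg0.
  apply: (@squeeze_cvgr _ _ _ _ (fun=> 0) (fun k => k.+1%:R^-1)) => //; last exact: cvg_cst.
  apply: nearW => k; rewrite normr_ge0/=.
  by have [_ _ _ _ /(_ _ (Or _ Ox))[_]] := ha k.
(* The product dominates the flux, as |Dv|^(p-1) is at most |Dv|^p + 1, and the last term dominates
   the other side. [N] comes from an error of at most 1 in each coordinate of the gradient. *)
pose g x : \bar R := (((enorm (Dv x) `^ p)%:E + 1%:E) * (M + N)%:E + (L * (M + 1))%:E)%E.
have Ig : mu.-integrable Omega g.
  apply: integrableD => //; last exact: integrable_cst.
  apply: integrableZr => //; apply: integrableD => //; last exact: integrable_cst.
  by have [] := S1p0_integrable hv.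
have gE x : g x = ((enorm (Dv x) `^ p + 1) * (M + N) + L * (M + 1))%:E by [].
have g1 k x : Omega x -> (`|flux p (Dv x) ((a k).2 x)|%:E <= g x)%E.
  move=> Ox; rewrite gE lee_fin; have [_ h] := bnd k x Ox.
  apply: (le_trans (flux_le _ _ p1)); rewrite -[leLHS]addr0 lerD//; last first.
    by rewrite mulr_ge0// addr_ge0.
  by apply: ler_pM => //; rewrite ?powR_ge0 ?enorm_ge0 ?enorm_powB1_le.
have g2 k x : Omega x -> `|Lpv x| <= L -> (`|- Lpv x * (a k).1 x|%:E <= g x)%E.
  move=> Ox Lx; rewrite gE lee_fin; have [h _] := bnd k x Ox.
  rewrite normrM normrN -[leLHS]add0r lerD//; last by apply: ler_pM.
  by rewrite mulr_ge0 ?addr_ge0 ?powR_ge0 ?ler0n.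
have ma1 k : measurable_fun Omega (fun x => - Lpv x * (a k).1 x).
  by apply: measurable_funM => //; have [] := C10_measurable (Ca k).
have ma2 k : measurable_fun Omega (fun x => flux p (Dv x) ((a k).2 x)).
  apply: measurable_flux => i; apply: measurable_fun_coord.
  by have [] := C10_measurable (Ca k).
have m1 : measurable_fun Omega (fun x => - Lpv x * psi x).
  by apply: measurable_funM => //; have [] := C10_measurable Cpsi.
have m2 : measurable_fun Omega (fun x => flux p (Dv x) (Dpsi x)).
  apply: measurable_flux => i; apply: measurable_fun_coord.
  by have [] := C10_measurable Cpsi.
apply/eqP; rewrite eq_le; apply/andP; split.
- apply: (dominated_le_integral mO ma2 ma1 m2 m1 Ig) => [||k]; last by rewrite wa.
  + by apply: aeW => x Ox; split; [exact: cv2|exact: cv1].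
  + by apply: filterS LpvL => x Lx Ox k; split; [exact: g1|exact: g2 (Lx Ox)].
- apply: (dominated_le_integral mO ma1 ma2 m1 m2 Ig) => [||k]; last by rewrite wa.
  + by apply: aeW => x Ox; split; [exact: cv1|exact: cv2].
  + by apply: filterS LpvL => x Lx Ox k; split; [exact: g2 (Lx Ox)|exact: g1].
Qed.

(** With [phi] fixed, the weak equation is tested with |phi|^p F(w k), where the [w k] approximate
    [v], and [k] tends to infinity. *)
Lemma picone_C10 (e : R) phi Dphi : 0 < e -> {ae mu, forall x, Omega x -> 0 <= v x} ->
  C10 G Omega phi Dphi ->
  (\int[mu]_(x in Omega) (- Lpv x * (`|phi x| `^ p * (`|v x| + 2 * e) `^ (1 - p)))%:E <=
   \int[mu]_(x in Omega) (enorm (Dphi x) `^ p)%:E)%E.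
Proof.
move=> e0 v0 Cphi; have [F [F' [M [dF cF' F0 FM F'M] FE]]] := exists_truncated_power p1 e0.
have [w [Dw [g [Cw Ig hg cw]]]] := S1p0_fast_approx p1 oO hv.
have [A A0 hA] := C10_bounded bO Cphi.
have [cphi _ _ _] := Cphi.
have p0 : 0 <= p := ltW (lt_trans ltr01 p1).
have M0 : 0 <= M := le_trans (F0 0) (FM 0).
have cF : continuous F by move=> t; exact: is_derive_cvg_continuous (dF t).
have [B B0 hB] : exists2 B : R, 0 <= B & forall x, Omega x -> `|dnorm_powR p (phi x)| <= B.
  apply: (continuous_bounded_on bO) => x.
  by apply: continuous_comp; [exact: cphi|exact: dnorm_powR_continuous].
have CT k := C10_picone_test dF cF' Cphi (Cw k).
pose T k x := `|phi x| `^ p * F (w k x).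
pose DT k x := (dnorm_powR p (phi x) * F (w k x)) *: Dphi x +
  (`|phi x| `^ p * F' (w k x)) *: Dw k x.
pose T' x := `|phi x| `^ p * F (v x).
pose DT' x := (dnorm_powR p (phi x) * F (v x)) *: Dphi x +
  (`|phi x| `^ p * F' (v x)) *: Dv x.
have [mv mDv0 _] := hv.
have [mphi mDphi] := C10_measurable Cphi.
have mF : measurable_fun Omega (fun x => F (v x)).
  apply: (@measurableT_comp _ _ _ _ _ _ F) => //; exact: continuous_measurable_fun.
have mF' : measurable_fun Omega (fun x => F' (v x)).
  apply: (@measurableT_comp _ _ _ _ _ _ F') => //; exact: continuous_measurable_fun.
have mphip : measurable_fun Omega (fun x => `|phi x| `^ p).
  by apply/measurable_fun_powR/measurable_fun_normr.
have mdphi : measurable_fun Omega (fun x => dnorm_powR p (phi x)).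
  apply: (@measurableT_comp _ _ _ _ _ _ (dnorm_powR p)) => //.
  by apply: continuous_measurable_fun; exact: dnorm_powR_continuous.
have mT : measurable_fun Omega (fun x => - Lpv x * T' x).
  by do 2 apply: measurable_funM => //.
have mDT : measurable_fun Omega (fun x => flux p (Dv x) (DT' x)).
  apply: measurable_flux => i; rewrite (_ : (fun x => _) = (fun x =>
    dnorm_powR p (phi x) * F (v x) * Dphi x ord0 i +
    `|phi x| `^ p * F' (v x) * Dv x ord0 i)); last by apply/funext => y; rewrite !mxE.
  apply: measurable_funD; apply: measurable_funM.
  - exact: measurable_funM.
  - exact: measurable_fun_coord.
  - exact: measurable_funM.
  - exact: mDv.
have -> : (\int[mu]_(x in Omega)
     (- Lpv x * (`|phi x| `^ p * (`|v x| + 2 * e) `^ (1 - p)))%:E =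
   \int[mu]_(x in Omega) (- Lpv x * T' x)%:E)%E.
  apply: ae_eq_integral => //; try exact/measurable_EFinP.
    apply/measurable_EFinP/measurable_funM => //; apply: measurable_funM => //.
    apply/measurable_fun_powR/measurable_funD => //; exact: measurable_fun_normr.
  apply: filterS v0 => x v0 Ox; rewrite /T'; have [-> _] := FE _ (v0 Ox).
  by rewrite (ger0_norm (v0 Ox)).
(* [picone_pointwise] wants the same gradient in the flux and in the test function, so it applies to
   the limit [DT'] and not to the approximants [DT k]. *)
apply: (@le_trans _ _ (\int[mu]_(x in Omega) (flux p (Dv x) (DT' x))%:E)%E); last first.
  apply: ae_le_integral_majorant => //.
  - by move=> x _; rewrite lee_fin powR_ge0.
  - apply/measurable_EFinP/measurable_fun_powR/measurable_fun_enorm => i.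
    exact: measurable_fun_coord.
  apply: filterS v0 => x v0 Ox; rewrite lee_fin /flux /DT'.
  have [-> ->] := FE _ (v0 Ox); apply: picone_pointwise => //.
  by rewrite ltr_wpDl ?v0// mulr_gt0.
pose E x := enorm (Dv x) `^ p.
have E0 x : 0 <= E x by exact: powR_ge0.
pose K1 := B * M * A; pose K2 := A `^ p * M.
have K10 : 0 <= K1 by rewrite /K1 !mulr_ge0.
have K20 : 0 <= K2 by rewrite /K2 mulr_ge0// powR_ge0.
(* The factor 3 comes from |Dv|^(p-1) |Dw| with |Dw| <= |Dv| + |Dw - Dv|: the first part costs 2
   |Dv|^p, the second |Dv|^p and a power of the error, which is below [g]. [L * K2] dominates the
   left side. *)
pose g' x : \bar R := ((K1 + 3 * K2)%:E * (E x)%:E + (K1 + L * K2)%:E + K2%:E * g x)%E.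
have Ig' : mu.-integrable Omega g'.
  apply: integrableD => //; last exact: integrableZl.
  apply: integrableD => //; last exact: integrable_cst.
  by apply: integrableZl => //; have [] := S1p0_integrable hv.
have g0 x : (0 <= g x)%E.
  by have [+ _] := hg 0%N x; apply: le_trans; rewrite lee_fin powR_ge0.
have phiA x : Omega x -> `|phi x| `^ p <= A `^ p.
  by move=> /hA[h _]; apply: ge0_ler_powR; rewrite ?nnegrE.
have g1 k x : Omega x -> `|Lpv x| <= L -> (`|- Lpv x * T k x|%:E <= g' x)%E.
  move=> Ox Lx; apply: (@le_trans _ _ (L * K2)%:E).
    rewrite lee_fin normrM normrN; apply: ler_pM => //.
    rewrite /T normrM (ger0_norm (powR_ge0 _ _)) (ger0_norm (F0 _)).
    by apply: ler_pM; rewrite ?powR_ge0 ?phiA.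
  rewrite /g' -EFinM -EFinD -[leLHS]adde0; apply: leeD; last by rewrite mule_ge0// lee_fin.
  rewrite lee_fin addrA lerDr; apply: addr_ge0 => //; apply: mulr_ge0 => //.
  by rewrite addr_ge0// mulr_ge0.
have g2 k x : Omega x -> (`|flux p (Dv x) (DT k x)|%:E <= g' x)%E.
  move=> Ox; apply: (@le_trans _ _ (((K1 + 3 * K2) * E x + (K1 + L * K2)) +
      K2 * enorm (Dw k x - Dv x) `^ p)%:E); last first.
    rewrite EFinD /g' EFinD EFinM; apply: leeD => //.
    by rewrite EFinM lee_wpmul2l// ?lee_fin//; have [] := hg k x.
  rewrite lee_fin; apply: (le_trans (flux_le _ _ p1)).
  set q := enorm (Dv x) `^ (p - 1); have q0 : 0 <= q by exact: powR_ge0.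
  have hD : enorm (DT k x) <= K1 + K2 * (enorm (Dv x) + enorm (Dw k x - Dv x)).
    apply: (le_trans (enormD _ _)); rewrite !enormZ; apply: lerD.
      rewrite normrM (ger0_norm (F0 _)); have [_ h] := hA x Ox.
      by apply: ler_pM => //; rewrite ?mulr_ge0 ?enorm_ge0//; apply: ler_pM => //; exact: hB.
    apply: ler_pM; rewrite ?enorm_ge0// ?normr_ge0//.
      rewrite normrM (ger0_norm (powR_ge0 _ _)).
      by apply: ler_pM; rewrite ?powR_ge0 ?phiA.
    by rewrite -[X in enorm X <= _](subrK (Dv x)) addrC enormD.
  apply: (le_trans (ler_wpM2l q0 hD)).
  have h1 : q <= E x + 1 by exact: enorm_powB1_le.
  have h2 : q * enorm (Dv x) <= E x + E x by exact: powR_mul_le (enorm_ge0 _) (enorm_ge0 _) p1.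
  have h3 := powR_mul_le (enorm_ge0 (Dv x)) (enorm_ge0 (Dw k x - Dv x)) p1.
  rewrite -/q -/(E x) in h3.
  have := ler_wpM2r K10 h1; have := ler_wpM2l K20 h2; have := ler_wpM2l K20 h3.
  have := mulr_ge0 L0 K20.
  move: (enorm (Dv x)) (enorm (Dw k x - Dv x)) (enorm (Dw k x - Dv x) `^ p).
  by move=> a b c; lra.
have CTm k := C10_measurable (CT k).
have cFw x : w k x @[k --> \oo] --> v x -> F (w k x) @[k --> \oo] --> F (v x).
  by move=> h; apply: cvg_comp h _; exact: cF.
have cF'w x : w k x @[k --> \oo] --> v x -> F' (w k x) @[k --> \oo] --> F' (v x).
  by move=> h; apply: cvg_comp h _; exact: cF'.
apply: (@dominated_le_integral _ _ _ mu Omega mO (fun k x => - Lpv x * T k x)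
  (fun k x => flux p (Dv x) (DT k x)) _ _ g') => //.
- by move=> k; apply: measurable_funM => //; have [] := CTm k.
- move=> k; apply: measurable_flux => i; apply: measurable_fun_coord.
  by have [] := CTm k.
- apply: filterS cw => x cw Ox; have [c1 c2] := cw Ox; split.
    by apply: cvgMr; apply: cvgMr; exact: cFw.
  apply: flux_cvg => i; rewrite !mxE.
  rewrite (_ : (fun k => _) = (fun k => dnorm_powR p (phi x) * F (w k x) * Dphi x ord0 i +
    `|phi x| `^ p * F' (w k x) * Dw k x ord0 i)); last by apply/funext => k; rewrite !mxE.
  apply: cvgD.
    by apply: cvgMl; apply: cvgMr; exact: cFw.
  apply: cvgM; last exact: enorm_cvg_coord.
  by apply: cvgMr; exact: cF'w.
- by apply: filterS LpvL => x Lx Ox k; split; [exact: g1 (Lx Ox)|exact: g2].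
- by move=> k; rewrite -(weak_form_C10 (CT k)).
Qed.

End weak_form.

(** * Sobolev functions and vanishing regularization *)

Section picone_sobolev.
Variables (R : realType) (ns : seq nat) (G : stratified_group R ns).
Local Notation V := 'rV[R]_(sumn ns).
Local Notation H := 'rV[R]_(head 0%N ns).
Local Notation mu := (@lebesgue_rV R (sumn ns)).
Variables (Omega : set V) (p : R).
Hypotheses (p1 : 1 < p) (bO : bounded_set Omega) (oO : open Omega).
Variables (v : V -> R) (Dv : V -> H) (Lpv : V -> R) (L : R).
Hypotheses (hv : S1p0 G Omega p v Dv) (hL : weak_p_sub_Laplacian G Omega p Dv Lpv).
Hypotheses (L0 : 0 <= L) (LpvL : {ae mu, forall x, Omega x -> `|Lpv x| <= L}).
Hypotheses (v0 : {ae mu, forall x, Omega x -> 0 <= v x}).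
Variables (u : V -> R) (Du : V -> H).
Hypothesis hu : S1p0 G Omega p u Du.

Let mO : measurable Omega. Proof. exact: rV_open_measurable. Qed.

Let p0 : 0 < p. Proof. exact: lt_trans ltr01 p1. Qed.

Let mLpv : measurable_fun Omega (fun x => - Lpv x).
Proof. by have [[m _] _] := hL; exact: measurable_funN. Qed.

Let mw (e : R) : measurable_fun Omega (fun x => (`|v x| + 2 * e) `^ (1 - p)).
Proof.
have [mv _ _] := hv; apply/measurable_fun_powR/measurable_funD => //.
exact: measurable_fun_normr.
Qed.

(** For fixed [e] the weight is at most (2e)^(1-p), so the approximants of [u] pass to the limit by
    domination. *)
Lemma picone_S1p0 (e : R) : 0 < e ->
  (\int[mu]_(x in Omega) (- Lpv x * (`|u x| `^ p * (`|v x| + 2 * e) `^ (1 - p)))%:E <=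
   \int[mu]_(x in Omega) (enorm (Du x) `^ p)%:E)%E.
Proof.
move=> e0; have [phi [Dphi [g [Cphi Ig hg cphi]]]] := S1p0_fast_approx p1 oO hu.
have [Iu IDu] := S1p0_integrable p1 bO oO hu.
have [mu_ mDu _] := hu.
pose c := (2 * e) `^ (1 - p).
have c0 : 0 <= c by exact: powR_ge0.
have wc x : (`|v x| + 2 * e) `^ (1 - p) <= c.
  rewrite /c -[1 - p]opprB; apply: powRN_anti; rewrite ?mulr_gt0 ?lerDr//.
  by rewrite subr_ge0 ltW.
(* 2^p comes from [powR_add_le]; 1 serves the right integrand and [L * c] the left one. *)
pose k0 : R := 2 `^ p * (1 + L * c).
have k00 : 0 <= k0 by rewrite mulr_ge0 ?powR_ge0// addr_ge0// mulr_ge0.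
pose S x : \bar R := ((`|u x| `^ p)%:E + (enorm (Du x) `^ p)%:E + g x)%E.
pose g' x : \bar R := (k0%:E * S x)%E.
have Ig' : mu.-integrable Omega g'.
  by apply: integrableZl => //; do 2 apply: integrableD => //.
have g0 x : (0 <= g x)%E.
  by have [+ _] := hg 0%N x; apply: le_trans; rewrite lee_fin powR_ge0.
have S1 n x : ((`|u x| `^ p + `|phi n x - u x| `^ p)%:E <= S x)%E.
  rewrite /S EFinD; apply: leeD; last by have [] := hg n x.
  by rewrite -EFinD lee_fin lerDl powR_ge0.
have S2 n x : ((enorm (Du x) `^ p + enorm (Dphi n x - Du x) `^ p)%:E <= S x)%E.
  rewrite /S EFinD; apply: leeD; last by have [] := hg n x.
  by rewrite -EFinD lee_fin lerDr powR_ge0.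
have up (a b d : R) : 0 <= a -> 0 <= b -> 0 <= d -> d <= a + b ->
    d `^ p <= 2 `^ p * (a `^ p + b `^ p).
  move=> a0 b0 d0 ab; apply: le_trans (powR_add_le a0 b0 (ltW p0)).
  by apply: ge0_ler_powR; rewrite ?nnegrE ?addr_ge0 ?(ltW p0).
have b1 n x : `|phi n x| `^ p <= 2 `^ p * (`|u x| `^ p + `|phi n x - u x| `^ p).
  by apply: up => //; rewrite -[X in `|X| <= _](subrK (u x)) addrC ler_normD.
have b2 n x : enorm (Dphi n x) `^ p <=
    2 `^ p * (enorm (Du x) `^ p + enorm (Dphi n x - Du x) `^ p).
  apply: up; rewrite ?enorm_ge0//.
  by rewrite -[X in enorm X <= _](subrK (Du x)) addrC enormD.
have g1 n x : `|Lpv x| <= L ->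
    (`|- Lpv x * (`|phi n x| `^ p * (`|v x| + 2 * e) `^ (1 - p))|%:E <= g' x)%E.
  move=> Lx; apply: (@le_trans _ _ (k0 * (`|u x| `^ p + `|phi n x - u x| `^ p))%:E); last first.
    by rewrite EFinM; apply: lee_wpmul2l; rewrite ?lee_fin.
  rewrite lee_fin normrM normrN [X in _ * X]ger0_norm ?mulr_ge0 ?powR_ge0//.
  apply: (@le_trans _ _ (L * (2 `^ p * (`|u x| `^ p + `|phi n x - u x| `^ p) * c))).
    apply: ler_pM; rewrite ?mulr_ge0 ?powR_ge0//.
    by apply: ler_pM; rewrite ?powR_ge0.
  have := mulr_ge0 (powR_ge0 2 p) (addr_ge0 (powR_ge0 `|u x| p) (powR_ge0 `|phi n x - u x| p)).
  by rewrite /k0; move: (_ `^ p + _) (2 `^ p) => a b ab; lra.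
have g2 n x : (`|enorm (Dphi n x) `^ p|%:E <= g' x)%E.
  apply: (@le_trans _ _ (k0 * (enorm (Du x) `^ p + enorm (Dphi n x - Du x) `^ p))%:E); last first.
    by rewrite EFinM; apply: lee_wpmul2l; rewrite ?lee_fin.
  rewrite lee_fin ger0_norm ?powR_ge0//; apply: (le_trans (b2 n x)).
  rewrite ler_wpM2r ?addr_ge0 ?powR_ge0// /k0 ler_peMr ?powR_ge0//.
  by rewrite lerDl mulr_ge0.
have cpow (a : nat -> R) (b : R) : a n @[n --> \oo] --> b ->
    `|a n| `^ p @[n --> \oo] --> `|b| `^ p.
  by move=> ab; exact: (cvg_comp _ _ ab (@norm_powR_continuous R p p0 b)).
apply: (@dominated_le_integral _ _ _ mu Omega mO
  (fun n x => - Lpv x * (`|phi n x| `^ p * (`|v x| + 2 * e) `^ (1 - p)))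
  (fun n x => enorm (Dphi n x) `^ p) _ _ g') => //.
- move=> n; apply: measurable_funM => //; apply: measurable_funM => //.
  by apply/measurable_fun_powR/measurable_fun_normr; have [] := C10_measurable (Cphi n).
- move=> n; apply/measurable_fun_powR/measurable_fun_enorm => i.
  by apply: measurable_fun_coord; have [] := C10_measurable (Cphi n).
- apply: measurable_funM => //; apply: measurable_funM => //.
  by apply/measurable_fun_powR/measurable_fun_normr.
- apply/measurable_fun_powR/measurable_fun_enorm => i.
  exact: measurable_fun_coord.
- apply: filterS cphi => x cx Ox; have [c1 c2] := cx Ox; split.
    by apply: cvgMr; apply: cvgMl; exact: cpow.
  have := cpow _ _ (enorm_cvg c2); rewrite ger0_norm ?enorm_ge0//.
  by apply: cvg_trans; apply: near_eq_cvg; apply: nearW => n /=; rewrite ger0_norm ?enorm_ge0.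
- by apply: filterS LpvL => x Lx Ox n; split; [exact: g1 (Lx Ox)|exact: g2].
- by move=> n; exact: (picone_C10 p1 bO oO hv hL L0 LpvL e0 v0 (Cphi n)).
Qed.

(* [l] is the increasing limit of the integrands of [picone_S1p0] as [e] tends to
   [0]. The last bound gives [u x = 0] wherever [v x = 0]. *)
Lemma picone_limit : {ae mu, forall x, Omega x -> 0 < - Lpv x} ->
  exists l : V -> \bar R, [/\ measurable_fun Omega l, forall x, (0 <= l x)%E,
    (\int[mu]_(x in Omega) l x <= \int[mu]_(x in Omega) (enorm (Du x) `^ p)%:E)%E
  & {ae mu, forall x, Omega x -> exists2 r : R, l x = r%:E &
      - Lpv x * `|u x| `^ p <= r * `|v x| `^ (p - 1)}].
Proof.
move=> Lpos; have [mu_ mDu _] := hu.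
have e0 (n : nat) : 0 < (n.+1%:R^-1 : R) by rewrite invr_gt0.
(* The absolute value, equal to [- Lpv x] almost everywhere on [Omega], makes the sequence
   nonnegative and monotone at every point, for monotone convergence. *)
pose a n x : R := `|Lpv x| * (`|u x| `^ p * (`|v x| + 2 * n.+1%:R^-1) `^ (1 - p)).
have a0 n x : 0 <= a n x by rewrite !mulr_ge0 ?powR_ge0.
have mua : measurable_fun Omega (fun x => `|u x| `^ p).
  by apply/measurable_fun_powR/measurable_fun_normr.
have ma n : measurable_fun Omega (a n).
  apply: measurable_funM; last exact: measurable_funM.
  by rewrite (_ : (fun x => _) = (fun x => `|- Lpv x|)); [exact: measurable_fun_normr|
    apply/funext => x; rewrite normrN].
have aI n : (\int[mu]_(x in Omega) (a n x)%:E <=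
    \int[mu]_(x in Omega) (enorm (Du x) `^ p)%:E)%E.
  apply: le_trans (picone_S1p0 (e0 n)).
  rewrite (ae_eq_integral (fun x => (- Lpv x * (`|u x| `^ p *
    (`|v x| + 2 * n.+1%:R^-1) `^ (1 - p)))%:E)) //; try exact/measurable_EFinP.
    by apply/measurable_EFinP/measurable_funM => //; exact: measurable_funM.
  by apply: filterS Lpos => x Lx Ox; rewrite /a -normrN gtr0_norm// Lx.
have nd x : {homo (fun n => (a n x)%:E) : n m / (n <= m)%N >-> (n <= m)%E}.
  move=> n m nm; rewrite lee_fin /a; apply: ler_wpM2l => //.
  apply: ler_wpM2l; rewrite ?powR_ge0//.
  rewrite -[1 - p]opprB; apply: powRN_anti.
  - by rewrite subr_ge0 ltW.
  - by rewrite ltr_wpDl// mulr_gt0.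
  - by rewrite lerD2l ler_wpM2l// lef_pV2 ?posrE// ler_nat.
pose l x : \bar R := ereal_sup (range (fun n => (a n x)%:E)).
have cl x : (a n x)%:E @[n --> \oo] --> l x by exact: ereal_nondecreasing_cvgn (nd x).
have al n x : ((a n x)%:E <= l x)%E by apply: ereal_sup_ubound; exists n.
have l0 x : (0 <= l x)%E by apply: le_trans (al 0%N x); rewrite lee_fin.
have a0' n x : (0 <= (a n x)%:E)%E by rewrite lee_fin.
have ma' n : measurable_fun Omega (fun x => (a n x)%:E) by exact/measurable_EFinP.
have ml : measurable_fun Omega l by apply: emeasurable_fun_cvg ma' _ => x _; exact: cl.
have Il : (\int[mu]_(x in Omega) l x <= \int[mu]_(x in Omega) (enorm (Du x) `^ p)%:E)%E.
  have := @cvg_monotone_convergence _ _ _ mu Omega mO (fun n x => (a n x)%:E) ma'.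
  rewrite (_ : (fun x => limn _) = l); last by apply/funext => x; exact: cvg_lim (cl x).
  move=> cI; have {}cI := cI (fun n x _ => a0' n x) (fun x _ => nd x).
  by apply: (cvge_le _ cI); exact: nearW.
exists l; split => //.
have [_ IDu] := S1p0_integrable p1 bO oO hu.
have Ill : mu.-integrable Omega l.
  apply/integrableP; split => //; under eq_integral do rewrite gee0_abs//.
  apply: (le_lt_trans Il); have /integrableP[_] := IDu.
  by under eq_integral do rewrite gee0_abs ?lee_fin ?powR_ge0//.
move: (integrable_ae mO Ill) Lpos; apply: filterS2 => x lfin Lx Ox.
have {}lfin := lfin Ox; have {}Lx := Lx Ox.
exists (fine (l x)); first by rewrite fineK.
(* Multiplying [a n x <= l x] by the reciprocal of the weight removes its singularity, so the limit
   is meaningful also where [v x = 0]. *)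
have h n : - Lpv x * `|u x| `^ p <= fine (l x) * `| `|v x| + 2 * n.+1%:R^-1| `^ (p - 1).
  have := al n x; rewrite -(fineK lfin) lee_fin /a -normrN gtr0_norm//.
  have s0 : 0 < `|v x| + 2 * n.+1%:R^-1 by rewrite ltr_wpDl// mulr_gt0.
  move=> /(ler_wpM2r (powR_ge0 (`|v x| + 2 * n.+1%:R^-1) (p - 1))).
  rewrite -!mulrA -powRD; last by rewrite (gt_eqF s0) implybT.
  by rewrite /= (_ : 1 - p + (p - 1) = 0); [rewrite powRr0 mulr1 (gtr0_norm s0)|ring].
have ch : (`|v x| + 2 * n.+1%:R^-1) @[n --> \oo] --> `|v x|.
  rewrite -[X in _ --> X]addr0; apply: cvgD; first exact: cvg_cst.
  by rewrite -[X in _ --> X](mulr0 2); apply: cvgMr; exact: cvg_harmonic.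
have p10 : 0 < p - 1 by rewrite subr_gt0.
have ch' : fine (l x) * `| `|v x| + 2 * n.+1%:R^-1| `^ (p - 1) @[n --> \oo] -->
    fine (l x) * `|v x| `^ (p - 1).
  apply: cvgMr; have := cvg_comp _ _ ch (@norm_powR_continuous R (p - 1) p10 `|v x|).
  by rewrite /= normr_id.
rewrite -(cvg_lim _ ch')//; apply: limr_ge; first exact: cvgP ch'.
exact: nearW.
Qed.

End picone_sobolev.

Theorem theorem3p4 (R : realType) (ns : seq nat) (G : stratified_group R ns)
    (p : R) (f : R -> R) (Omega : set 'rV[R]_(sumn ns))
    (g : 'rV[R]_(sumn ns) -> R -> R) (C : R)
    (u v : 'rV[R]_(sumn ns) -> R)
    (Du Dv : 'rV[R]_(sumn ns) -> 'rV[R]_(head 0%N ns))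
    (Lpv : 'rV[R]_(sumn ns) -> R)
    (hp : 1 < p)
    (f_pos : forall t : R, 0 < t -> 0 < f t)
    (f_lip : forall t : R, 0 < t ->
       exists2 A : set R, nbhs t A & [lipschitz f s | s in A])
    (f_der : {ae @lebesgue_measure R, forall t : R, 0 < t ->
       derivable f t 1 /\
       (p - 1) * `|f t| `^ ((p - 2) / (p - 1)) <= derive1 f t})
    (Omega_bounded : bounded_set Omega)
    (Omega_open : open Omega)
    (g_pos : forall x rho, Omega x -> 0 < g x rho)
    (g_bounded : exists M : R, forall x rho, Omega x -> `|g x rho| <= M)
    (g_meas : measurable_fun (Omega `*` setT)
       (fun z : 'rV[R]_(sumn ns) * R => g z.1 z.2))
    (g_growth : forall x rho, Omega x -> 0 < rho ->
       g x rho <= C * (rho `^ (p - 1) + 1))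
    (hu : S1p0 G Omega p u Du)
    (hv : S1p0 G Omega p v Dv)
    (v_neq0 : ~ {ae @lebesgue_rV R (sumn ns),
       forall x, Omega x -> v x = 0})
    (v_ge0 : {ae @lebesgue_rV R (sumn ns), forall x, Omega x -> 0 <= v x})
    (hLpv : weak_p_sub_Laplacian G Omega p Dv Lpv)
    (v_eq : {ae @lebesgue_rV R (sumn ns),
       forall x, Omega x -> - Lpv x = g x (v x)}) :
  (\int[@lebesgue_rV R (sumn ns)]_(x in Omega)
      (`|u x| `^ p / f (v x) * - Lpv x)%:E
   <= \int[@lebesgue_rV R (sumn ns)]_(x in Omega)
      (enorm (Du x) `^ p)%:E)%E.
Proof.
have [M hM] := g_bounded.
have Lpos : {ae @lebesgue_rV R (sumn ns), forall x, Omega x -> 0 < - Lpv x}.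
  by apply: filterS v_eq => x h Ox; rewrite (h Ox) g_pos.
have LpvM : {ae @lebesgue_rV R (sumn ns), forall x, Omega x -> `|Lpv x| <= `|M|}.
  apply: filterS v_eq => x h Ox; rewrite -normrN (h Ox).
  by apply: le_trans (hM _ _ Ox) (ler_norm M).
have [l [ml l0 Il lE]] := picone_limit hp Omega_bounded Omega_open hv hLpv
  (normr_ge0 M) LpvM v_ge0 hu Lpos.
(* The values of [f] outside the positive half-line are arbitrary, so the left integrand need not be
   measurable; it is compared with the measurable [l]. *)
apply: le_trans Il; apply: ae_le_integral_majorant => //.
  exact: rV_open_measurable.
apply: filterS3 v_ge0 Lpos lE => x v0 Lx lE Ox.
have [r lr h] := lE Ox; move: {v0 Lx} (v0 Ox) (Lx Ox) => v0 Lx.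
have r0 : 0 <= r by have := l0 x; rewrite lr lee_fin.
rewrite lr lee_fin; rewrite (ger0_norm v0) in h.
(* Where [v x = 0] the numerator vanishes, so the quotient is 0 whatever [f 0] is, division by 0
   included. *)
have [v00|v00] := eqVneq (v x) 0.
  move: h; rewrite v00 powR0; last by rewrite subr_eq0 gt_eqF.
  rewrite mulr0 pmulr_rle0// => u0.
  have -> : `|u x| `^ p = 0 by apply/eqP; rewrite eq_le u0 powR_ge0.
  by rewrite !mul0r.
have vp : 0 < v x by rewrite lt_neqAle eq_sym v00.
have fv := powR_le_of_derive_ge hp f_pos f_lip f_der vp.
rewrite mulrAC ler_pdivrMr ?f_pos// mulrC; apply: (le_trans h).
by rewrite ler_wpM2l.
Qed.
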